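(* Let $k\in\mathbb N$ and suppose $\lim_{n\to\infty}nr_n^d=0$ and $\lim_{n\to\infty}n(nr_n^d)^{k-1}=\infty$. Then $\mathbb E[S_{n,k}]\sim I_{n,k}$ as $n\to\infty$. Moreover, if $k\ge2$ then, as $n\to\infty$ (with $r=r_n$), $$\mathrm{Var}[S_{n,k}]=\mathbb E[S_{n,k}]\big(1+O((nr^d)^{k-1})\big),\qquad d_{\mathrm{TV}}(S_{n,k},Z_{\mathbb E S_{n,k}})=O\big((nr^d)^{k-1}\big),$$ $$d_{\mathrm K}\big((\mathrm{Var}\,S_{n,k})^{-1/2}(S_{n,k}-\mathbb E S_{n,k}),\mathcal N\big)=O\Big(\max\big((nr^d)^{k-1},\ (n(nr^d)^{k-1})^{-1/2}\big)\Big).$$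
   Context: Setting. Let $d\in\mathbb N$, and let $X_1,X_2,\ldots$ be i.i.d. random vectors in $\mathbb R^d$ with a common probability density $f$ that is bounded ($f_{\max}:=\sup f<\infty$); no other assumption is made on $f$ or its support. For $n\in\mathbb N$ let $\mathcal X_n=\{X_1,\ldots,X_n\}$. For $t>0$, $Z_t$ denotes a Poisson random variable with mean $t$; for $n>0$ take $Z_n$ independent of $(X_i)$ and let $\mathcal P_n=\{X_1,\ldots,X_{Z_n}\}$. For finite $\mathcal X\subset\mathbb R^d$ and $r>0$, $G(\mathcal X,r)$ is the graph on $\mathcal X$ with an edge between each pair of distinct points at Euclidean distance at most $r$. $S_{n,k}$ (resp. $S'_{n,k}$) is the number of connected components with exactly $k$ vertices of $G(\mathcal X_n,r_n)$ (resp. $G(\mathcal P_n,r_n)$), and $I_{n,k}=\mathbb E[S'_{n,k}]$. Here $r_n>0$ is a given sequence. $a_n\sim b_n$ means $a_n/b_n\to1$. $\mathcal N$ is a standard normal variable. $d_{\mathrm K}(X,Y)=\sup_{z}|\Pr[X\le z]-\Pr[Y\le z]|$ and $d_{\mathrm{TV}}(X,Y)=\sup_E|\Pr[X\in E]-\Pr[Y\in E]|$ over Borel $E\subset\mathbb R$. *)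

(* Defs.v *)
From HB Require Import structures.
From mathcomp Require Import all_boot all_order all_algebra finmap.
From mathcomp Require Import all_classical all_reals all_analysis.

Set Implicit Arguments.
Unset Strict Implicit.
Unset Printing Implicit Defensive.

Import Order.TTheory GRing.Theory Num.Theory.
Import numFieldNormedType.Exports.

Local Open Scope classical_set_scope.
Local Open Scope ring_scope.

(* The space R^d. Its sigma-algebra, generated by the coordinate projections
   and the Borel sets of the line, is the Borel sigma-algebra of R^d. *)
Notation Rd R d := (d.-tuple (measurableTypeR R)).

(* Lebesgue measure on R^d, as an iterated product measure: R^(n+1) is
   identified with R x R^n. *)
Section lebesgue_tuple.
Context {R : realType}.

Definition cons_pair n (p : measurableTypeR R * Rd R n) : Rd R n.+1 :=
  [tuple of p.1 :: p.2].

Lemma measurable_cons_pair n : measurable_fun setT (@cons_pair n).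
Proof. exact: (measurable_cons measurable_fst measurable_snd). Qed.

HB.instance Definition _ n := isMeasurableFun.Build _ _ _ _ (@cons_pair n)
  (@measurable_cons_pair n).

Section step.
Variables (n : nat) (m : {sigma_finite_measure set (Rd R n) -> \bar R}).

Definition lebesgue_cons : set (Rd R n.+1) -> \bar R :=
  pushforward (lebesgue_measure \x m)%E (@cons_pair n).

Let lebesgue_cons0 : lebesgue_cons set0 = 0%E.
Proof. by rewrite /lebesgue_cons /pushforward preimage_set0 measure0. Qed.

Let lebesgue_cons_ge0 A : (0 <= lebesgue_cons A)%E.
Proof. exact: measure_ge0. Qed.

Let lebesgue_cons_sigma_additive : semi_sigma_additive lebesgue_cons.
Proof.
move=> F mF tF mUF; rewrite /lebesgue_cons /pushforward preimage_bigcup.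
apply: measure_semi_sigma_additive.
- by move=> i; exact: measurable_funPTI.
- apply/trivIsetP => /= i j _ _ ij; rewrite -preimage_setI.
  by move/trivIsetP : tF => /(_ _ _ _ _ ij) ->//; rewrite preimage_set0.
- by rewrite -preimage_bigcup; exact: measurable_funPTI.
Qed.

HB.instance Definition _ := isMeasure.Build _ _ _ lebesgue_cons
  lebesgue_cons0 lebesgue_cons_ge0 lebesgue_cons_sigma_additive.

Let lebesgue_cons_sigma_finite : sigma_finite setT lebesgue_cons.
Proof.
have /sigma_finiteP[F [TF ndF Foo]] := sigma_finiteT (@lebesgue_measure R).
have /sigma_finiteP[G [TG ndG Goo]] := sigma_finiteT m.
pose dec (t : Rd R n.+1) : measurableTypeR R * Rd R n :=
  (thead t, [tuple of behead t]).
have mdec : measurable_fun setT dec.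
  apply: measurable_fun_pair; last exact: measurable_behead.
  exact: measurable_tnth.
have decK p : dec (cons_pair p) = p.
  by case: p => x t; congr pair; exact: val_inj.
exists (fun i => dec @^-1` (F i `*` G i)).
  apply/seteqP; split => // t _.
  have [i _ Fi] : (\bigcup_i F i) (dec t).1 by rewrite -TF.
  have [j _ Gj] : (\bigcup_i G i) (dec t).2 by rewrite -TG.
  exists (maxn i j) => //; split.
    by move: Fi; exact/subsetPset/ndF/leq_maxl.
  by move: Gj; exact/subsetPset/ndG/leq_maxr.
move=> i; have [mF Fi] := Foo i; have [mG Gi] := Goo i; split.
  by rewrite -[X in measurable X]setTI; apply: mdec => //; exact: measurableX.
rewrite /lebesgue_cons /pushforward.
suff -> : @cons_pair n @^-1` (dec @^-1` (F i `*` G i)) = F i `*` G i.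
  by rewrite product_measure1E// lte_mul_pinfty// ge0_fin_numE.
by apply/seteqP; split => p; rewrite /preimage /mkset decK.
Qed.

HB.instance Definition _ := @Measure_isSigmaFinite.Build _ _ _
  lebesgue_cons lebesgue_cons_sigma_finite.

End step.

Fixpoint lebesgue_tuple (n : nat) :
    {sigma_finite_measure set (Rd R n) -> \bar R} :=
  match n with
  | 0 => \d_[tuple]
  | n'.+1 => lebesgue_cons (lebesgue_tuple n')
  end.

(* Together with sigma-finiteness, this characterizes Lebesgue measure. *)
Lemma lebesgue_tuple_box n (A : 'I_n -> set (measurableTypeR R)) :
  (forall i, measurable (A i)) ->
  lebesgue_tuple n [set x | forall i, A i (tnth x i)] =
    (\prod_(i < n) lebesgue_measure (A i))%E.
Proof.
elim: n A => [|n IHn] A mA /=.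
  by rewrite big_ord0 diracE mem_set //= => -[].
rewrite /lebesgue_cons /pushforward big_ord_recl -IHn//.
rewrite -product_measure1E//; last first.
  rewrite [X in measurable X](_ : _ =
    \bigcap_(i in [set: 'I_n]) ((@tnth n _)^~ i @^-1` A (lift ord0 i))); last first.
    by apply/seteqP; split => [x Ax i _|x Ax i]; exact: Ax.
  apply: fin_bigcap_measurable => // i _.
  by rewrite -[X in measurable X]setTI; exact: measurable_tnth.
congr (product_measure1 _ _ _); apply/seteqP; split => [[x t]/= xt|[x t]/= [Ax At] i].
  split; first by have := xt ord0; rewrite tnth0.
  by move=> i; have := xt (lift ord0 i); rewrite tnthS.
by case: (unliftP ord0 i) => [j ->|->]; rewrite ?tnthS ?tnth0.
Qed.

End lebesgue_tuple.

Section geometric_graph.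
Context {R : realType} {d : nat}.

Definition eucl_dist (x y : Rd R d) : R :=
  Num.sqrt (\sum_(i < d) ((tnth x i : R) - tnth y i) ^+ 2).

Definition geom_edge (V : {fset Rd R d}) (r : R) : rel V :=
  fun x y => (x != y) && (eucl_dist (val x) (val y) <= r).

Definition geom_components (V : {fset Rd R d}) (r : R) : {set {set V}} :=
  equivalence_partition (connect (geom_edge r)) [set: V]%SET.

(* The number of connected components of G(V, r) with exactly k vertices. *)
Definition nb_components (V : {fset Rd R d}) (r : R) (k : nat) : nat :=
  #|[set C in geom_components V r | #|C| == k]%SET|.

End geometric_graph.

Section probability_notions.
Context {R : realType} {dO : measure_display} {Omega : measurableType dO}.
Variable P : probability Omega R.

Definition has_density d (X : Omega -> Rd R d) (f : Rd R d -> R) : Prop :=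
  [/\ measurable_fun setT f,
      (forall x, 0 <= f x) &
      forall A, measurable A ->
        P (X @^-1` A) = (\int[lebesgue_tuple d]_(x in A) (f x)%:E)%E].

Definition mutually_independent dT (T : measurableType dT)
    (X : nat -> Omega -> T) : Prop :=
  forall (J : {fset nat}) (A : nat -> set T), (forall i, measurable (A i)) ->
    P (\bigcap_(i in [set` J]) (X i @^-1` A i)) =
    (\prod_(i <- J) P (X i @^-1` A i))%E.

Definition sigma_of_family dT (T : measurableType dT)
    (X : nat -> Omega -> T) : set (set Omega) :=
  <<s \bigcup_i preimage_set_system setT (X i) measurable >>.

Definition independent_of_family dN (TN : measurableType dN) (N : Omega -> TN)
    dT (T : measurableType dT) (X : nat -> Omega -> T) : Prop :=
  forall B E, measurable B -> sigma_of_family X E ->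
    P (N @^-1` B `&` E) = (P (N @^-1` B) * P E)%E.

(* The last argument of poisson_prob is not used by the library. *)
Definition poisson_distributed (N : Omega -> nat) (t : R) : Prop :=
  forall B : set nat, P (N @^-1` B) = poisson_prob t 0 B.

End probability_notions.

Section distances.
Context {R : realType}.

(* Laws on the line are probability measures, so that fine below only casts
   numbers of [0, 1] to R. *)
Definition d_TV (mu nu : set R -> \bar R) : R :=
  sup [set `|fine (mu E) - fine (nu E)| | E in (measurable : set (set R))].

Definition d_K (mu nu : set R -> \bar R) : R :=
  sup [set `|fine (mu `]-oo, z]%classic) - fine (nu `]-oo, z]%classic)| | z in [set: R]].

Definition law {dO} {Omega : measurableType dO} (P : probability Omega R)
  (Y : Omega -> R) : set R -> \bar R := pushforward P Y.

Definition poisson_law (t : R) : set R -> \bar R :=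
  pushforward (poisson_prob t 0) (fun j : nat => j%:R : R).

Definition std_normal_law : set R -> \bar R := normal_prob 0 1.

End distances.

Section component_counts.
Context {R : realType} {d : nat} {dO : measure_display}
  {Omega : measurableType dO}.

(* The set {X_1, ..., X_n}; the sequence X is indexed from 0. *)
Definition sample (X : nat -> Omega -> Rd R d) (n : nat) (w : Omega) :
  {fset Rd R d} := [fset X i w | i in iota 0 n]%fset.

(* S_ X r k n is S_{n,k}, and S'_ X N r k n is S'_{n,k} with N n as Z_n. *)
Definition S_ (X : nat -> Omega -> Rd R d) (r : nat -> R) (k n : nat)
  (w : Omega) : R := (nb_components (sample X n w) (r n) k)%:R.

Definition S'_ (X : nat -> Omega -> Rd R d) (N : nat -> Omega -> nat)
  (r : nat -> R) (k n : nat) (w : Omega) : R :=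
  (nb_components (sample X (N n w) w) (r n) k)%:R.

(* Both counts are nonnegative and have finite moments (S_{n,k} <= n and
   S'_{n,k} <= Z_n), so that fine only casts finite extended reals to R. *)
Definition mean (P : probability Omega R) (Y : Omega -> R) : R :=
  fine ('E_P[Y])%E.

Definition var (P : probability Omega R) (Y : Omega -> R) : R :=
  fine ('V_P[Y])%E.

Definition standardize (P : probability Omega R) (Y : Omega -> R) (w : Omega) : R :=
  (Num.sqrt (var P Y))^-1 * (Y w - mean P Y).

End component_counts.

(* Main.v *)
(* On the event that a k-set A of sample points is a component, W = S_{n,k} equals 1 plus
   the number of k-components of the other points.  Replace these one at a time by
   independent copies, to decouple them from the event: by exchangeability a replacement
   contributes only if the point is adjacent to A and also affects some k-component.
   This gives an approximate Stein identity
     E[W h(W)] = E[W] E[h(W + 1)] + O(eps sup|h(j+1) - h(j)| E[W]),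
   with eps of order (n r^d)^(k-1).  Taking h linear gives the variance, h the solution
   of the Stein-Chen equation gives the Poisson approximation, and h the solution of the
   normal Stein equation at (W - E[W]) / sqrt(E[W]) gives the Kolmogorov distance, with
   the additional error E[W]^(-1/2) of a Taylor expansion.  The sample enters only through
   the law of its geometric graph, a weight on finite graphs with three properties:
   independence over disjoint vertex sets, exchangeability, and a bound on the probability
   that a fresh vertex is adjacent to a given one.  That k points are connected has
   probability at least c (r^d)^(k-1), by the power mean inequality for the masses of the
   cells of a grid of diameter at most r; hence E[W] is at least of order n (n r^d)^(k-1).
   The Poissonized mean is the Poisson mixture of the means of the S_{m,k}. *)

Require Import Defs.
From mathcomp Require Import all_boot all_order perm all_algebra finmap.
From mathcomp Require Import all_classical all_reals all_analysis measurable_realfun.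
From mathcomp Require Import zify ring lra.

Set Implicit Arguments.
Unset Strict Implicit.
Unset Printing Implicit Defensive.

Import Order.TTheory GRing.Theory Num.Theory.
Import numFieldNormedType.Exports.

Local Open Scope ring_scope.

(** * Connected components of a relation *)

(** Stein's argument runs on a finite space: functions of a graph on ['I_n * bool], summed against a
    weight, so that it involves no measurability. The obstacle is that the event that [A] is a
    component constrains every other point, since none may be near [A]. Replacing one point by its
    copy costs a factor rho = M (2r)^d for the adjacency to [A], times the expected number of
    pivots, at most kappa = 2 k! (n rho)^(k-1). There are at most n replacements and n rho <= 1.
    Putting [A] back into the vertex set costs k kappa, so the error has the order of kappa, which
    tends to 0 only for k >= 2. Errors first appear relative to the probability p that [A] is
    connected; n k rho <= 1/2 gives p <= 2 P(A is a component) and turns them into multiples of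
    E[W]. For the first claim, both means equal p n^k / k! up to factors tending to 1, so p cancels
    in the ratio; its lower bound supplies positivity there, and later the rate E[W]^(-1/2).
    Coincident sample points merge in the set of points but stay distinct as vertices; this
    discrepancy has probability 0. *)

Section components.
Import fintype boot.finset.
Variable T : finType.
Implicit Types (e : rel T) (A B C : {set T}).

Definition linked e A B := [exists a in A, exists b in B, e a b].

Lemma linkedP e A B :
  reflect (exists a b, [/\ a \in A, b \in B & e a b]) (linked e A B).
Proof.
apply: (iffP exists_inP) => [[a aA /exists_inP[b bB eab]]|[a [b [aA bB eab]]]].
  by exists a, b.
by exists a => //; apply/exists_inP; exists b.
Qed.

Lemma linked_sym e A B : symmetric e -> linked e A B = linked e B A.
Proof.
move=> e_sym; apply/linkedP/linkedP => -[a [b [? ? ?]]];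
  by exists b, a; split; rewrite // e_sym.
Qed.

Lemma linkedS e A A' B B' : A \subset A' -> B \subset B' ->
  linked e A B -> linked e A' B'.
Proof.
move=> /subsetP sA /subsetP sB /linkedP[a [b [aA bB eab]]].
by apply/linkedP; exists a, b; split; [exact: sA|exact: sB|].
Qed.

(** Connectivity by cuts instead of paths: only edges inside [A] enter, so locality, transport along
    injections and the adjunction of a vertex need no manipulation of paths. *)
Definition conn e A := (A != set0) &&
  [forall B : {set T}, [&& B \subset A, B != set0 & B != A] ==>
    linked e B (A :\: B)].

Lemma connP e A : reflect (A != set0 /\ forall B, B \subset A ->
  B != set0 -> B != A -> linked e B (A :\: B)) (conn e A).
Proof.
apply: (iffP andP) => -[-> cA]; split => //.
  by move=> B BA B0 BnA; move/forallP : cA => /(_ B); rewrite BA B0 BnA.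
by apply/forallP => B; apply/implyP => /and3P[]; exact: cA.
Qed.

Lemma conn1 e a : conn e [set a]%SET.
Proof.
apply/connP; split=> [|B]; first by apply/set0Pn; exists a; rewrite inE.
by rewrite subset1 => /orP[/eqP->|/eqP->]; rewrite ?eqxx.
Qed.

Lemma connU1 e A b : symmetric e -> conn e A -> linked e A [set b]%SET ->
  conn e (b |: A).
Proof.
move=> e_sym /connP[A0 cA] Ab; apply/connP; split.
  by apply/set0Pn; exists b; rewrite !inE eqxx.
have [bA|bA] := boolP (b \in A).
  by rewrite (setUidPr _) ?sub1set //.
move=> B BbA B0 BbA'.
(* [B] contains [A], misses [A], or cuts it properly. The edge from [A] to [b] crosses in the first
   two cases, connectivity of [A] gives an edge in the third. *)
have [AB|nAB] := boolP (A \subset B).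
  apply: linkedS Ab => //; apply/subsetP => x; rewrite !inE => /eqP ->.
  rewrite eqxx andbT; apply: contra BbA' => bB.
  by rewrite eqEsubset BbA subUset sub1set bB.
have [BA0|BA0] := eqVneq (A :&: B) set0.
  have -> : B = [set b]%SET.
    apply/eqP; rewrite eqEsubset; apply/andP; split.
      apply/subsetP => x xB; move/subsetP : BbA => /(_ x xB).
      by rewrite !inE => /orP[//|xA]; move/setP : BA0 => /(_ x); rewrite !inE xA xB.
    case/set0Pn : B0 => x xB; move/subsetP : BbA => /(_ x xB).
    rewrite !inE => /orP[/eqP <-|xA]; first by rewrite sub1set.
    by move/setP : BA0 => /(_ x); rewrite !inE xA xB.
  rewrite linked_sym//; apply: linkedS Ab => //.
  by apply/subsetP => x xA; rewrite !inE xA orbT andbT; apply: contraNneq bA => <-.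
have /cA := subsetIl A B; move/(_ BA0).
have -> : A :&: B != A.
  by apply: contra nAB => /eqP/setIidPl.
move/(_ isT); apply: linkedS; first exact: subsetIr.
apply/subsetP => x; rewrite !inE => /andP[+ xA]; rewrite xA /= => ->.
by rewrite orbT.
Qed.

(* A maximal connected proper subset containing i misses exactly one vertex. *)
Lemma conn_leaf e A i : symmetric e -> i \notin A -> conn e (i |: A) ->
  A != set0 ->
  exists a b, [/\ b \in A, a \in i |: (A :\ b), conn e (i |: (A :\ b)) & e a b].
Proof.
move=> e_sym iA cA A0.
pose Q B := [&& i \in B, B \subset i |: A, B != i |: A & conn e B].
have Q1 : Q [set i]%SET.
  rewrite /Q inE eqxx conn1 andbT sub1set !inE eqxx /=.
  case/set0Pn : A0 => x xA; apply/eqP => /setP/(_ x); rewrite !inE xA orbT.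
  by move/eqP => xi; rewrite -xi xA in iA.
have [B QB Bmax] := @arg_maxnP {set T} [set i]%SET Q (fun B => #|B|) Q1.
case/and4P : QB => iB BA BnA cB.
have B0 : B != set0 by apply/set0Pn; exists i.
have /connP[_ /(_ B BA B0 BnA)/linkedP[a [b [aB]]]] := cA.
rewrite !inE => /andP[bB bA] eab.
have bni : b != i by apply: contraNneq bB => ->.
rewrite (negbTE bni) /= in bA.
have BbE : b |: B = i |: A.
  apply/eqP; apply/negPn/negP => BbA.
  have : Q (b |: B).
    rewrite /Q !inE iB orbT BbA /= subUset BA sub1set !inE bA orbT /=.
    by apply: connU1 => //; apply/linkedP; exists a, b; rewrite !inE.
  by move=> /Bmax /=; rewrite cardsU1 bB add1n ltnn.
have BE : B = i |: (A :\ b).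
  apply/setP => x; move/setP : BbE => /(_ x); rewrite !inE.
  have [->|xb] /= := eqVneq x b; last by [].
  by rewrite (negbTE bB) (negbTE bni).
by exists a, b; rewrite -BE; split.
Qed.

Definition comps e k C : {set {set T}} :=
  [set A : {set T} | [&& A \subset C, #|A| == k, conn e A &
    ~~ linked e A (C :\: A)]]%SET.

Definition ncomps e k C := #|comps e k C|.

(** If [A] were not inside [A'], its cut at [A :&: A'] would be crossed by an edge that leaves [A'],
    although [A'] is isolated in [C]. *)
Lemma comps_sub_eq e k C A A' : symmetric e -> A \in comps e k C ->
  A' \in comps e k C -> A :&: A' != set0 -> A = A'.
Proof.
move=> e_sym; wlog suff H : A A' / A \in comps e k C ->
  A' \in comps e k C -> A :&: A' != set0 -> A \subset A'.
  move=> hA hA' AA'; apply/eqP; rewrite eqEsubset H//= H//.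
  by rewrite setIC.
rewrite !inE => /and4P[AC _ /connP[_ cA] _] /and4P[_ _ _ iA'] AA'.
apply/negPn/negP => nAA'.
have /cA := subsetIl A A'; rewrite AA' => /(_ isT).
have -> : A :&: A' != A by apply: contra nAA' => /eqP/setIidPl.
move=> /(_ isT) h; case/negP : iA'; apply: linkedS h; first exact: subsetIr.
apply/subsetP => x; rewrite !inE => /andP[+ xA]; rewrite xA/= => ->.
exact: (subsetP AC).
Qed.

Lemma comps_setD e k C A : symmetric e -> A \in comps e k C ->
  comps e k C = A |: comps e k (C :\: A).
Proof.
move=> e_sym hA; apply/setP => A'; rewrite in_setU1.
have [->//|A'A] /= := eqVneq A' A.
apply/idP/idP => hA'; last first.
  move: (hA) hA'; rewrite !inE => /and4P[AC _ _ iA] /and4P[A'C -> -> iA'].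
  rewrite (subset_trans A'C (subsetDl _ _))/=.
  apply: contra iA' => /linkedP[a [b [aA' + eab]]].
  rewrite !inE => /andP[bA' bC]; apply/linkedP; exists a, b; split => //.
  rewrite !inE bA' bC andbT /=; apply: contra iA => bA; apply/linkedP.
  exists b, a; split => //; last by rewrite e_sym.
  by move/subsetP : A'C => /(_ a aA').
have A'A0 : A' :&: A = set0.
  by apply/eqP; apply: contraNT A'A => h; apply/eqP/(comps_sub_eq e_sym hA' hA).
move: hA'; rewrite !inE => /and4P[A'C -> -> iA'] /=; apply/andP; split.
  apply/subsetP => x xA'; rewrite inE (subsetP A'C)// andbT.
  by move/setP : A'A0 => /(_ x); rewrite !inE xA' => /= ->.
apply: contra iA'; apply: linkedS => //.
by apply: setSD; exact: subsetDl.
Qed.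

Lemma ncomps_setD e k C A : symmetric e -> (0 < k)%N -> A \in comps e k C ->
  ncomps e k C = (ncomps e k (C :\: A)).+1.
Proof.
move=> e_sym k0 hA; rewrite /ncomps (comps_setD e_sym hA) cardsU1.
suff -> : A \notin comps e k (C :\: A) by [].
move: hA; rewrite !inE => /and4P[_ /eqP Ak _ _].
apply/negP => /and4P[AC _ _ _]; have : A == set0.
  rewrite -subset0; apply/subsetP => x xA; move/subsetP : AC => /(_ x xA).
  by rewrite !inE xA.
by move=> /eqP A0; rewrite A0 cards0 in Ak; rewrite -Ak in k0.
Qed.

(* The components that appear or disappear when the vertex i is added to C:
   either they contain i, or they become connected once i is added. *)
Definition pivots e k i C : {set {set T}} :=
  [set A : {set T} | [&& A \subset C, (#|A| == k.-1) || (#|A| == k) &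
    conn e (i |: A)]]%SET.

Lemma ncomps_add e k i C : symmetric e -> (0 < k)%N -> i \notin C ->
  ((ncomps e k (i |: C) <= ncomps e k C + #|pivots e k i C|) /\
   (ncomps e k C <= ncomps e k (i |: C) + #|pivots e k i C|))%N.
Proof.
move=> e_sym k0 iC; split.
  have sub : comps e k (i |: C) \subset
      comps e k C :|: [set i |: A | A in pivots e k i C]%SET.
    apply/subsetP => A; rewrite !inE => /and4P[AC Ak cA iA].
    have [iiA|iiA] := boolP (i \in A); apply/orP; [right|left].
      apply/imsetP; exists (A :\ i); last by rewrite setD1K.
      rewrite !inE setD1K// cA andbT; apply/andP; split.
        apply/subsetP => x; rewrite !inE => /andP[xi xA].
        by move/subsetP : AC => /(_ x xA); rewrite !inE (negbTE xi).
      by have := cardsD1 i A; rewrite iiA (eqP Ak) add1n => ->; rewrite eqxx.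
    rewrite Ak cA /=; apply/andP; split.
      apply/subsetP => x xA; move/subsetP : AC => /(_ x xA).
      by rewrite !inE => /orP[/eqP xi|//]; rewrite -xi xA in iiA.
    by apply: contra iA; apply: linkedS => //; apply: setSD; exact: subsetUr.
  apply: leq_trans (subset_leq_card sub) _.
  by apply: leq_trans (leq_card_setU _ _) _; rewrite leq_add2l leq_imset_card.
have sub : comps e k C \subset comps e k (i |: C) :|: pivots e k i C.
  apply/subsetP => A; rewrite !inE => /and4P[AC Ak cA iA].
  have [iiA|iiA] := boolP (linked e A [set i]%SET); apply/orP; [right|left].
    by rewrite AC Ak orbT connU1.
  rewrite (subset_trans AC (subsetUr _ _)) Ak cA /=.
  apply/linkedP => -[a [b [aA + eab]]]; rewrite !inE => /andP[bA /orP[/eqP bi|bC]].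
    by case/negP : iiA; apply/linkedP; exists a, b; rewrite inE bi; split => //; rewrite -bi.
  by case/negP : iA; apply/linkedP; exists a, b; rewrite inE bA.
by apply: leq_trans (subset_leq_card sub) _; exact: leq_card_setU.
Qed.

Lemma eq_linked e e' A B : {in A & B, forall a b, e a b = e' a b} ->
  linked e A B = linked e' A B.
Proof.
move=> ee'; apply/linkedP/linkedP => -[a [b [aA bB eab]]]; exists a, b; split => //.
  by rewrite -ee'.
by rewrite ee'.
Qed.

Lemma eq_conn e e' A : {in A &, forall a b, e a b = e' a b} ->
  conn e A = conn e' A.
Proof.
move=> ee'; congr (_ && _); apply: eq_forallb => B.
case: (boolP (B \subset A)) => //= BA; congr (_ ==> _); apply: eq_linked.
move=> a b aB; rewrite inE => /andP[_ bA]; apply: ee' => //.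
exact: (subsetP BA).
Qed.

Lemma eq_ncomps e e' k C : {in C &, forall a b, e a b = e' a b} ->
  ncomps e k C = ncomps e' k C.
Proof.
move=> ee'; rewrite /ncomps; apply: eq_card => A; rewrite !inE.
case: (boolP (A \subset C)) => //= /subsetP AC; congr [&& _, _ & ~~ _].
  by apply: eq_conn => a b aA bA; apply: ee'; exact: AC.
by apply: eq_linked => a b aA; rewrite inE => /andP[_ bC]; apply: ee' => //; exact: AC.
Qed.

End components.

(** * Transport of connectivity and component counts along injections *)

Section injective_reindexing.
Import fintype boot.finset.
Variables (T T' : finType) (j : T -> T').
Hypothesis j_inj : injective j.
Variables (e : rel T') (k : nat).
Implicit Types A B C : {set T}.

Lemma linked_imset A B :
  linked e (j @: A) (j @: B) = linked (fun a b => e (j a) (j b)) A B.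
Proof.
apply/linkedP/linkedP => [[_ [_ [/imsetP[a aA ->] /imsetP[b bB ->] eab]]]|].
  by exists a, b.
by move=> [a [b [aA bB eab]]]; exists (j a), (j b); rewrite !imset_f.
Qed.

Lemma imset_setD_inj A B : j @: (A :\: B) = (j @: A) :\: (j @: B).
Proof.
apply/setP => y; rewrite inE; apply/imsetP/andP => [[x + ->]|].
  by rewrite inE => /andP[xB xA]; rewrite !mem_imset.
by move=> [yB /imsetP[x xA yE]]; exists x => //; rewrite inE xA andbT; move: yB; rewrite yE mem_imset.
Qed.

Lemma sub_imset_inj A (B : {set T'}) : B \subset j @: A ->
  exists2 B' : {set T}, B = j @: B' & B' \subset A.
Proof.
move=> BA; exists [set x in A | j x \in B]%SET; last by apply/subsetP => x; rewrite inE => /andP[].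
apply/setP => y; apply/idP/imsetP => [yB|[x]].
  by move/subsetP : (BA) => /(_ y yB)/imsetP[x xA yE]; exists x; rewrite ?inE ?xA -?yE.
by rewrite !inE => /andP[_ ? ->].
Qed.

Lemma conn_imset A : conn e (j @: A) = conn (fun a b => e (j a) (j b)) A.
Proof.
apply/connP/connP => -[A0 cA]; split.
- by apply: contra A0 => /eqP ->; rewrite imset0.
- move=> B BA B0 BnA; rewrite -linked_imset imset_setD_inj; apply: cA.
  + exact: imsetS.
  + by apply: contra B0 => /eqP h; rewrite -cards_eq0 -(card_imset _ j_inj) h cards0.
  + by apply: contra BnA => /eqP/(imset_inj j_inj) ->.
- by apply: contra A0 => /eqP h; rewrite -cards_eq0 -(card_imset _ j_inj) h cards0.
move=> B' /sub_imset_inj[B -> BA] B0 BnA; rewrite -imset_setD_inj linked_imset.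
apply: cA => //.
  by apply: contra B0 => /eqP ->; rewrite imset0.
by apply: contra BnA => /eqP ->.
Qed.

Lemma ncomps_imset C :
  ncomps e k (j @: C) = ncomps (fun a b => e (j a) (j b)) k C.
Proof.
rewrite /ncomps -(card_imset _ (imset_inj j_inj)); apply: eq_card => A'.
apply/idP/imsetP => [|[A + ->]]; rewrite !inE.
  move=> /and4P[/sub_imset_inj[A -> AC]].
  rewrite card_imset// conn_imset -imset_setD_inj linked_imset => ? ? ?.
  by exists A => //; rewrite inE; apply/and4P.
by rewrite card_imset// conn_imset -imset_setD_inj linked_imset => /and4P[/(imsetS j)->->->->].
Qed.

End injective_reindexing.

(** * Random graphs and the Stein identity for component counts *)

(** Plain Boolean functions form a finite type, so expectations are finite sums. Symmetry is
    restored by [adj]; loops are harmless, because connectivity and isolation only test edges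
    between disjoint sets. *)
Definition graph (T : finType) := {ffun T * T -> bool}.

Definition adj (T : finType) (G : graph T) : rel T :=
  fun a b => G (a, b) || G (b, a).

Lemma adj_sym (T : finType) (G : graph T) : symmetric (adj G).
Proof. by move=> a b; rewrite /adj orbC. Qed.

Definition reindex_graph (T T' : finType) (j : T -> T') (G : graph T') : graph T :=
  [ffun p => G (j p.1, j p.2)].

Lemma adj_reindex (T T' : finType) (j : T -> T') (G : graph T') a b :
  adj (reindex_graph j G) a b = adj G (j a) (j b).
Proof. by rewrite /adj !ffunE. Qed.

Section random_graph.
Import fintype boot.finset.
Variables (R : realFieldType) (T : finType) (w : graph T -> R).
Implicit Types (A B C : {set T}) (F H Y : graph T -> R).

Definition Ex F : R := \sum_G w G * F G.

(** Stands for measurability with respect to the subgraph induced on [A]. *)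
Definition local_on A F := forall G G' : graph T,
  {in A &, forall a b, adj G a b = adj G' a b} -> F G = F G'.

Hypothesis w_ge0 : forall G, 0 <= w G.
Hypothesis w_sum : \sum_G w G = 1.

Lemma ExD F H : Ex (fun G => F G + H G) = Ex F + Ex H.
Proof. by rewrite /Ex -big_split; apply: eq_bigr => G _; rewrite mulrDr. Qed.

Lemma ExN F : Ex (fun G => - F G) = - Ex F.
Proof. by rewrite /Ex -sumrN; apply: eq_bigr => G _; rewrite mulrN. Qed.

Lemma ExB F H : Ex (fun G => F G - H G) = Ex F - Ex H.
Proof. by rewrite ExD ExN. Qed.

Lemma ExZ c F : Ex (fun G => c * F G) = c * Ex F.
Proof. by rewrite /Ex mulr_sumr; apply: eq_bigr => G _; rewrite mulrCA. Qed.

Lemma Ex_cst c : Ex (fun=> c) = c.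
Proof. by rewrite /Ex -mulr_suml w_sum mul1r. Qed.

Lemma Ex_sum (I : Type) (s : seq I) (Q : pred I) (F : I -> graph T -> R) :
  Ex (fun G => \sum_(i <- s | Q i) F i G) = \sum_(i <- s | Q i) Ex (F i).
Proof.
rewrite /Ex exchange_big; apply: eq_bigr => G _.
by rewrite mulr_sumr.
Qed.

Lemma eq_Ex F H : F =1 H -> Ex F = Ex H.
Proof. by move=> FH; apply: eq_bigr => G _; rewrite FH. Qed.

Lemma ler_Ex F H : (forall G, F G <= H G) -> Ex F <= Ex H.
Proof. by move=> FH; apply: ler_sum => G _; exact: ler_wpM2l. Qed.

Lemma Ex_ge0 F : (forall G, 0 <= F G) -> 0 <= Ex F.
Proof. by move=> F0; apply: sumr_ge0 => G _; exact: mulr_ge0. Qed.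

Lemma ler_norm_Ex F : `|Ex F| <= Ex (fun G => `|F G|).
Proof.
rewrite ler_norml -ExN; apply/andP; split; apply: ler_Ex => G.
  by rewrite lerNl ler_normr lexx orbT.
exact: ler_norm.
Qed.

Lemma local_onS A A' F : A \subset A' -> local_on A F -> local_on A' F.
Proof.
by move=> /subsetP AA' lF G G' GG'; apply: lF => a b aA bA; apply: GG'; exact: AA'.
Qed.

Lemma local_onM A F H : local_on A F -> local_on A H ->
  local_on A (fun G => F G * H G).
Proof. by move=> lF lH G G' GG'; rewrite (lF G G')// (lH G G'). Qed.

Lemma local_on_adj A a b : a \in A -> b \in A ->
  local_on A (fun G => (adj G a b)%:R).
Proof. by move=> aA bA G G' GG'; rewrite GG'. Qed.

Lemma local_on_conn A : local_on A (fun G => (conn (adj G) A)%:R).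
Proof. by move=> G G' GG'; rewrite (eq_conn GG'). Qed.

Lemma local_on_ncomps A k (h : nat -> R) :
  local_on A (fun G => h (ncomps (adj G) k A)).
Proof. by move=> G G' GG'; rewrite (eq_ncomps k GG'). Qed.

Variable rho : R.
Hypothesis rho_ge0 : 0 <= rho.
(** A conditional probability bound in integrated form: given the subgraph on [A], the fresh vertex
    [b] is adjacent to [a] with probability at most [rho]. *)
Hypothesis Ex_adj : forall A F a b, local_on A F -> (forall G, 0 <= F G) ->
  a \in A -> b \notin A -> Ex (fun G => F G * (adj G a b)%:R) <= rho * Ex F.

(* Building a connected set from i one leaf at a time costs a factor rho per vertex;
   s`!^2 bounds the number of ways to choose the leaves and their neighbours. *)
Lemma Ex_conn A B i Y : local_on A Y -> (forall G, 0 <= Y G) -> i \in A ->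
  [disjoint A & B] ->
  Ex (fun G => Y G * (conn (adj G) (i |: B))%:R) <= ((#|B|)`! ^ 2)%:R * rho ^+ #|B| * Ex Y.
Proof.
move: {-2}#|B| (erefl #|B|) => s; elim: s B => [|s IHs] B /esym Bs lY Y0 iA AB.
  rewrite expr0 mulr1 mul1r; apply: ler_Ex => G; apply: ler_piMr => //.
  by rewrite lern1; case: (conn _ _).
have iB : i \notin B by rewrite (disjointFr AB).
have -> : (s.+1`! ^ 2)%:R * rho ^+ s.+1 * Ex Y =
    \sum_(b in B) \sum_(a in i |: (B :\ b)) rho * ((s`! ^ 2)%:R * rho ^+ s * Ex Y).
  rewrite (eq_bigr (fun=> s.+1%:R * (rho * ((s`! ^ 2)%:R * rho ^+ s * Ex Y)))).
    rewrite sumr_const Bs -[RHS]mulr_natl factS expnMn exprS !natrM; ring.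
  move=> b bB; rewrite sumr_const cardsU1 !inE (negbTE iB) andbF add1n.
  by have := cardsD1 b B; rewrite bB Bs add1n => -[<-]; rewrite -[LHS]mulr_natl.
apply: (@le_trans _ _ (\sum_(b in B) \sum_(a in i |: (B :\ b))
    Ex (fun G => Y G * (conn (adj G) (i |: (B :\ b)))%:R * (adj G a b)%:R))).
  under eq_bigr do rewrite -Ex_sum.
  rewrite -Ex_sum; apply: ler_Ex => G.
  have ge0 b a : 0 <= Y G * (conn (adj G) (i |: B :\ b))%:R * (adj G a b)%:R.
    by rewrite !mulr_ge0.
  case: (boolP (conn _ _)) => [cB|_]; last first.
    by rewrite mulr0; do 2!(apply: sumr_ge0 => ? _).
  have B0 : B != set0 by rewrite -card_gt0 Bs.
  have [a [b [bB aB cb ab]]] := conn_leaf (@adj_sym _ G) iB cB B0.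
  rewrite (bigD1 b)//= (bigD1 a)//= cb ab !mulr1 -addrA lerDl addr_ge0//.
    by apply: sumr_ge0 => ? _; rewrite mulr_ge0.
  by do 2!(apply: sumr_ge0 => ? _).
apply: ler_sum => b bB; apply: ler_sum => a aB.
have dAB : [disjoint A & B :\ b].
  by apply: disjointWr AB; exact: subD1set.
have Bbs : #|B :\ b| = s by have := cardsD1 b B; rewrite bB Bs add1n => -[].
apply: le_trans (_ : rho * Ex (fun G => Y G * (conn (adj G) (i |: B :\ b))%:R) <= _); last first.
  by apply: ler_wpM2l => //; exact: (IHs _ (esym Bbs)).
apply: (Ex_adj (A := A :|: (i |: (B :\ b)))).
- apply: local_onM; first by apply: local_onS lY; exact: subsetUl.
  by apply: local_onS (@local_on_conn _); exact: subsetUr.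
- by move=> G; rewrite mulr_ge0.
- by rewrite inE aB orbT.
- rewrite !inE eqxx /= orbF negb_or (disjointFl AB)//=.
  by apply: contraNneq iB => <-.
Qed.

Variables (n k : nat).
Hypothesis k_gt0 : (0 < k)%N.
Hypothesis nrho : n%:R * rho <= 1.

(** Union bound over the sets [B] of size s: there are 'C(|C|, s) of them and each costs s!^2 rho^s,
    in total at most s! (n rho)^s. Both s = k-1 and s = k contribute at most k! (n rho)^(k-1), the
    latter because n rho <= 1; hence the factor 2 k!. The vertex [i] may lie in [A], so [Y] may
    depend on edges at [i]. *)
Lemma Ex_pivots A C i Y : local_on A Y -> (forall G, 0 <= Y G) ->
  [disjoint A & C] -> i \notin C -> (#|C| <= n)%N ->
  Ex (fun G => Y G * #|pivots (adj G) k i C|%:R) <=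
    (k`!.*2)%:R * (n%:R * rho) ^+ k.-1 * Ex Y.
Proof.
move=> lY Y0 AC iC Cn.
have EY0 : 0 <= Ex Y by exact: Ex_ge0.
have nrho0 : 0 <= n%:R * rho by rewrite mulr_ge0.
have step s : Ex (fun G => \sum_(B : {set T} | (B \subset C) && (#|B| == s))
    Y G * (conn (adj G) (i |: B))%:R) <= s`!%:R * (n%:R * rho) ^+ s * Ex Y.
  rewrite Ex_sum.
  apply: (@le_trans _ _ (\sum_(B : {set T} | (B \subset C) && (#|B| == s))
      ((s`! ^ 2)%:R * rho ^+ s * Ex Y))).
    apply: ler_sum => B /andP[BC /eqP Bs]; rewrite -Bs.
    have liY : local_on (i |: A) Y by apply: local_onS lY; exact: subsetUr.
    have := Ex_conn (B := B) liY Y0 (setU11 i A); apply.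
    rewrite -setI_eq0 setIUl setU_eq0 !setI_eq0 disjoints1 (disjointWr BC AC) andbT.
    by apply: contra iC => /(subsetP BC).
  rewrite sumr_const -cardsE cards_draws -[leLHS]mulr_natl mulrA ler_wpM2r//.
  rewrite exprMn !mulrA ler_wpM2r ?exprn_ge0// -natrX -!natrM ler_nat.
  rewrite mulnA mulnC mulnA [X in (X <= _)%N](_ : _ = s`! * ('C(#|C|, s) * s`!))%N; last by lia.
  rewrite leq_mul2l; apply/orP; right; rewrite bin_ffact.
  apply: leq_trans (_ : #|C| ^ s <= _)%N; last by case: (s) => // s'; rewrite leq_exp2r.
  rewrite ffact_prod -[s in (_ ^ s)%N]card_ord -prod_nat_const.
  by apply: leq_prod => j _; exact: leq_subr.
have split_pivots G : Y G * #|pivots (adj G) k i C|%:R =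
   \sum_(B : {set T} | (B \subset C) && (#|B| == k.-1)) Y G * (conn (adj G) (i |: B))%:R +
   \sum_(B : {set T} | (B \subset C) && (#|B| == k)) Y G * (conn (adj G) (i |: B))%:R.
  rewrite -!mulr_sumr -mulrDr; congr (_ * _).
  rewrite -sum1_card natr_sum big_mkcond [X in X + _]big_mkcond.
  rewrite [X in _ + X]big_mkcond -big_split /=; apply: eq_bigr => B _.
  rewrite inE; case: (B \subset C) => //=; last by rewrite addr0.
  have [->|] := eqVneq #|B| k.-1.
    rewrite ltn_eqF ?ltn_predL//= addr0.
    by case: (conn _ _).
  by move=> _; rewrite add0r; case: (_ == _) => //=; case: (conn _ _).
rewrite (eq_Ex split_pivots) ExD (le_trans (lerD (step _) (step _)))//.
rewrite -mulrDl ler_wpM2r// -addnn natrD mulrDl lerD//.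
  by rewrite ler_wpM2r ?exprn_ge0// ler_nat -[in X in (_ <= X)%N](prednK k_gt0) factS leq_pmull.
by rewrite ler_wpM2l// ler_wiXn2l// leq_pred.
Qed.

End random_graph.

(** * The approximate Stein identity for the number of k-components *)

Section stein_identity.
Import fintype boot.finset.
Variables (R : realFieldType) (n k : nat).
Let T : finType := ('I_n * bool)%type.
Variable w : graph T -> R.
Implicit Types (A B C : {set T}) (D : {set 'I_n}) (F H : graph T -> R).
Local Notation Ex := (Ex w).
Hypothesis w_ge0 : forall G, 0 <= w G.
Hypothesis w_sum : \sum_G w G = 1.
Hypothesis k_gt0 : (0 < k)%N.

Variables (rho p : R).
Hypothesis rho_ge0 : 0 <= rho.
Hypothesis Ex_adj : forall A F a b, local_on A F -> (forall G, 0 <= F G) ->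
  a \in A -> b \notin A -> Ex (fun G => F G * (adj G a b)%:R) <= rho * Ex F.
Hypothesis Ex_indep : forall A B F H, [disjoint A & B] -> local_on A F ->
  local_on B H -> Ex (fun G => F G * H G) = Ex F * Ex H.
Hypothesis Ex_perm : forall (s : {perm T}) F,
  Ex (fun G => F (reindex_graph s G)) = Ex F.
Hypothesis Ex_conn_p : forall A, #|A| = k -> Ex (fun G => (conn (adj G) A)%:R) = p.
Hypothesis nkrho : n%:R * k%:R * rho <= 2^-1.

Let nrho : n%:R * rho <= 1.
Proof.
have : n%:R * rho <= n%:R * k%:R * rho.
  by rewrite ler_wpM2r// -natrM ler_nat leq_pmulr.
move=> /le_trans/(_ nkrho)/le_trans; apply; lra.
Qed.

Let p_ge0 A : #|A| = k -> 0 <= p.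
Proof. by move=> /Ex_conn_p <-; apply: Ex_ge0. Qed.

(* The vertices (i, true) carry an independent copy of the n vertices (i, false). *)
Definition base : {set T} := [set x | ~~ x.2]%SET.

Definition is_comp A (G : graph T) : bool :=
  conn (adj G) A && ~~ linked (adj G) A (base :\: A).

Definition nbase (G : graph T) : nat := ncomps (adj G) k base.

Lemma card_base : #|base| = n.
Proof.
have -> : base = [set (i, false) | i : 'I_n]%SET.
  apply/setP => -[i b]; rewrite !inE; apply/idP/imsetP => [/=|[j _ [_ ->//]]].
  by case: b => // _; exists i.
by rewrite card_imset ?card_ord// => i j [].
Qed.

Lemma nbase_sum G : (nbase G)%:R =
  \sum_(A : {set T} | (A \subset base) && (#|A| == k)) (is_comp A G)%:R :> R.
Proof.
rewrite /nbase /ncomps -sum1_card natr_sum big_mkcond [RHS]big_mkcond.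
apply: eq_bigr => A _; rewrite inE /is_comp.
case: (A \subset base) => //=; case: (#|A| == k) => //=; by case: (_ && _).
Qed.

Lemma local_on_is_comp A : A \subset base -> local_on base (fun G => (is_comp A G)%:R : R).
Proof.
move=> /subsetP Ab G G' GG'; rewrite /is_comp.
rewrite (@eq_conn _ (adj G) (adj G')) ?(@eq_linked _ (adj G) (adj G'))//.
  by move=> a b aA; rewrite inE => /andP[_ bb]; apply: GG' => //; exact: Ab.
by move=> a b aA bA; apply: GG'; exact: Ab.
Qed.

Lemma Ex_is_comp_le A : #|A| = k -> Ex (fun G => (is_comp A G)%:R) <= p.
Proof.
move=> Ak; rewrite -(Ex_conn_p Ak); apply: ler_Ex => // G.
by rewrite ler_nat /is_comp; case: (conn _ _) => //=; exact: leq_b1.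
Qed.

(** A connected [A] fails to be a component only if one of its k vertices is adjacent to one of the
    at most n base vertices outside it; each such pair costs [rho]. *)
Lemma Ex_is_comp_ge A : #|A| = k -> p * (1 - n%:R * k%:R * rho) <= Ex (fun G => (is_comp A G)%:R).
Proof.
move=> Ak.
apply: (@le_trans _ _ (Ex (fun G => (conn (adj G) A)%:R -
    \sum_(a in A) \sum_(b in base :\: A) (conn (adj G) A)%:R * (adj G a b)%:R))).
  rewrite ExB Ex_conn_p// mulrBr mulr1 lerD2l lerN2 Ex_sum.
  under eq_bigr do rewrite Ex_sum.
  apply: (@le_trans _ _ (\sum_(a in A) \sum_(b in base :\: A) rho * p)).
    apply: ler_sum => a aA; apply: ler_sum => b; rewrite inE => /andP[bA _].
    rewrite -(Ex_conn_p Ak); apply: (Ex_adj (A := A)) => //; exact: local_on_conn.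
  rewrite !sumr_const Ak -mulrnA -[leLHS]mulr_natl natrM.
  rewrite mulrC [leRHS](_ : _ = rho * p * (n%:R * k%:R)); last by ring.
  rewrite ler_wpM2l ?mulr_ge0 ?(p_ge0 Ak)// ler_wpM2r// ler_nat.
  by rewrite -[leqRHS]card_base subset_leq_card// subsetDl.
apply: ler_Ex => // G; rewrite /is_comp; case: (conn _ _) => /=; last first.
  by rewrite sub0r big1 ?oppr0// => a _; rewrite big1// => b _; rewrite mul0r.
case: (boolP (linked _ _ _)) => [/linkedP[a [b [aA bA ab]]]|_] /=; last first.
  by rewrite gerBl; do 2!(apply: sumr_ge0 => ? _); rewrite mul1r.
rewrite subr_le0 (bigD1 a)//= (bigD1 b)//= ab mulr1 -addrA lerDl addr_ge0//.
  by apply: sumr_ge0 => ? _; rewrite mul1r.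
by do 2!(apply: sumr_ge0 => ? _); rewrite mul1r.
Qed.

Lemma Ex_nbase_bounds : 'C(n, k)%:R * p * (1 - n%:R * k%:R * rho) <=
  Ex (fun G => (nbase G)%:R) <= 'C(n, k)%:R * p.
Proof.
have cE (x : R) : 'C(n, k)%:R * x =
    \sum_(A : {set T} | (A \subset base) && (#|A| == k)) x.
  by rewrite sumr_const -cardsE cards_draws card_base mulr_natl.
rewrite (eq_Ex w nbase_sum) Ex_sum -mulrA !cE; apply/andP; split.
  by apply: ler_sum => A /andP[_ /eqP Ak]; exact: Ex_is_comp_ge.
by apply: ler_sum => A /andP[_ /eqP Ak]; exact: Ex_is_comp_le.
Qed.

Lemma nbase_mul G (h : nat -> R) : (nbase G)%:R * h (nbase G) =
  \sum_(A : {set T} | (A \subset base) && (#|A| == k))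
     (is_comp A G)%:R * h (ncomps (adj G) k (base :\: A)).+1.
Proof.
rewrite nbase_sum mulr_suml; apply: eq_bigr => A /andP[Ab Ak].
case: (boolP (is_comp A G)) => [/andP[cA iA]|_]; last by rewrite !mul0r.
rewrite /nbase (@ncomps_setD _ _ _ _ A)//; first exact: adj_sym.
by rewrite inE Ab Ak cA iA.
Qed.

Variables (h : nat -> R) (delta : R).
Hypothesis h_lip : forall j, `|h j.+1 - h j| <= delta.

Let delta_ge0 : 0 <= delta.
Proof. by apply: le_trans (h_lip 0); exact: normr_ge0. Qed.

Lemma lipschitz_nat a b c : (a <= b + c)%N -> (b <= a + c)%N ->
  `|h a - h b| <= delta * c%:R.
Proof.
have H i j : `|h (i + j)%N - h i| <= delta * j%:R.
  elim: j => [|j IHj]; first by rewrite addn0 subrr normr0 mulr0.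
  rewrite addnS -(subrKA (h (i + j)%N)); apply: le_trans (ler_normD _ _) _.
  by rewrite -natr1 mulrDr mulr1 addrC lerD.
have [ab|/ltnW ba] := leqP a b => abc bac.
  rewrite distrC -(subnKC ab); apply: le_trans (H _ _) _.
  by rewrite ler_wpM2l// ler_nat leq_subLR.
rewrite -(subnKC ba); apply: le_trans (H _ _) _.
by rewrite ler_wpM2l// ler_nat leq_subLR.
Qed.

Local Notation H C := (fun G : graph T => h (ncomps (adj G) k C).+1).
(** The bound of [Ex_pivots]: the mean number of k-component changes caused by adding one vertex. *)
Let kappa : R := (k`!.*2)%:R * (n%:R * rho) ^+ k.-1.

Let kappa_ge0 : 0 <= kappa.
Proof. by rewrite /kappa mulr_ge0// exprn_ge0// mulr_ge0. Qed.

Let h_pivots G i C : i \notin C ->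
  `|H (i |: C) G - H C G| <= delta * #|pivots (adj G) k i C|%:R.
Proof.
move=> iC; have [h1 h2] := ncomps_add (@adj_sym _ G) k_gt0 iC.
by apply: lipschitz_nat; rewrite addSn.
Qed.

(** Vertices are added one at a time; each changes the count by at most its number of pivots, whose
    mean is at most [kappa] by [Ex_pivots] with [Y] constantly 1. *)
Lemma Ex_add_vertices A C : [disjoint A & C] -> (#|A :|: C| <= n)%N ->
  `|Ex (H (A :|: C)) - Ex (H C)| <= #|A|%:R * (delta * kappa).
Proof.
move: {-2}#|A| (erefl #|A|) => s; elim: s A => [|s IHs] A /esym As AC ACn.
  by rewrite (cards0_eq As) set0U subrr normr0 mul0r.
have /set0Pn[i iA] : A != set0 by rewrite -card_gt0 As.
have := cardsD1 i A; rewrite iA As add1n => -[As'].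
have iAC : i \notin (A :\ i) :|: C by rewrite !inE eqxx/= (disjointFr AC).
have AE : A :|: C = i |: ((A :\ i) :|: C) by rewrite setUA setD1K.
have cAC : (#|(A :\ i) :|: C| <= n)%N.
  by apply: leq_trans ACn; rewrite AE cardsU1 iAC leq_addl.
rewrite -(subrKA (Ex (H ((A :\ i) :|: C)))); apply: le_trans (ler_normD _ _) _.
rewrite -nat1r mulrDl mul1r lerD//; last first.
  by apply: IHs => //; exact: disjointWl (subD1set _ _) AC.
rewrite AE -ExB; apply: le_trans (ler_norm_Ex _ _) _ => //.
apply: (@le_trans _ _ (Ex (fun G => delta * (1 * #|pivots (adj G) k i (A :\ i :|: C)|%:R)))).
  by apply: ler_Ex => // G; rewrite mul1r; exact: h_pivots.
rewrite ExZ ler_wpM2l//.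
have -> : kappa = kappa * Ex (fun=> 1) by rewrite Ex_cst// mulr1.
apply: (@Ex_pivots _ _ _ w_ge0 _ rho_ge0 Ex_adj _ _ k_gt0 nrho set0) => //.
by rewrite -setI_eq0 set0I.
Qed.

Section one_component.
Variable A : {set T}.
Hypotheses (A_base : A \subset base) (Ak : #|A| = k).

Let others : {set 'I_n} := [set i | (i, false) \notin A]%SET.
(** Interpolates between [base :\: A], obtained for [D] empty and [B = others], and the set of
    copies alone, obtained for [D = B = others]. *)
Let mixed (D B : {set 'I_n}) : {set T} := [set (i, i \in D) | i in B]%SET.

Let mixed_card D (B : {set 'I_n}) : (#|mixed D B| <= n)%N.
Proof.
apply: leq_trans (leq_imset_card _ _) _.
by rewrite -[leqRHS]card_ord max_card.
Qed.

Let mixed_A D (B : {set 'I_n}) : B \subset others -> [disjoint A & mixed D B].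
Proof.
move=> /subsetP Bo; rewrite -setI_eq0; apply/eqP/setP => -[i b]; rewrite !inE.
apply/negbTE/andP => -[ibA /imsetP[j jB [ij bj]]].
have := subsetP A_base _ ibA; rewrite inE /= => /negbTE b0; move: ibA.
by have := Bo _ jB; rewrite inE ij b0 => /negbTE ->.
Qed.

Let mixed0 : mixed set0 others = base :\: A.
Proof.
apply/setP => -[i b]; rewrite !inE; apply/imsetP/andP => /= [[j]|].
  by rewrite !inE => jA [-> ->].
by case: b => -[ibA _] //; exists i; rewrite !inE.
Qed.

(* Replacing vertex i by its independent copy: the part of is_comp A that does not
   look at i drops out by exchangeability. *)
Let mixed_step D i : i \in others -> i \notin D ->
  `|Ex (fun G => (is_comp A G)%:R * (H (mixed D others) G - H (mixed (i |: D) others) G))|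
    <= k%:R * (rho * p) * (delta * (2 * kappa)).
Proof.
move=> io iD.
pose C := mixed D (others :\ i); pose i0 : T := (i, false); pose i1 : T := (i, true).
have E0 : mixed D others = i0 |: C.
  rewrite /mixed -[in LHS](setD1K io) imsetU imset_set1.
  by rewrite /i0 -(negbTE iD).
have E1 : mixed (i |: D) others = i1 |: C.
  rewrite /mixed -[in LHS](setD1K io) imsetU imset_set1 setU11; congr (_ |: _).
  apply: eq_in_imset => j; rewrite !inE => /andP[ji _].
  by rewrite (negbTE ji).
have iC b : (i, b) \notin C.
  by apply/imsetP => -[j]; rewrite !inE => /andP[ji _] [ij _]; rewrite ij eqxx in ji.
have i0A : i0 \notin A by move: io; rewrite inE.
have i1A : i1 \notin A.
  by apply/negP => /(subsetP A_base); rewrite inE.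
have AC : [disjoint A & C] by apply: mixed_A; exact: subD1set.
pose I0 G := conn (adj G) A && ~~ linked (adj G) A ((base :\: A) :\ i0).
have IE G : (is_comp A G)%:R = (I0 G)%:R - (I0 G && linked (adj G) A [set i0]%SET)%:R :> R.
  have lE : linked (adj G) A (base :\: A) =
      linked (adj G) A ((base :\: A) :\ i0) || linked (adj G) A [set i0]%SET.
    apply/idP/orP => [/linkedP[a [b [aA bb ab]]]|[]]; last 2 first.
    - by apply: linkedS => //; exact: subD1set.
    - by apply: linkedS => //; rewrite sub1set !inE i0A.
    have [bi|bi] := eqVneq b i0; [right|left]; apply/linkedP; exists a, b.
      by rewrite inE bi; split => //; rewrite -bi.
    by split => //; move: bb; rewrite !inE bi.
  rewrite /is_comp /I0 lE; case: (conn _ _) => /=; last by rewrite subr0.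
  by case: (linked _ _ _) => /=; [rewrite subr0|case: (linked _ _ _); rewrite ?subrr ?subr0].
have s_fix x : x != i0 -> x != i1 -> tperm i0 i1 x = x.
  by move=> x0 x1; rewrite tpermD// eq_sym.
have sA x : x \in A -> tperm i0 i1 x = x.
  by move=> xA; apply: s_fix; [apply: contraNneq i0A|apply: contraNneq i1A] => <-.
have sC B j : (B :&: [set i0; i1]%SET) = set0 -> j = i0 \/ j = i1 ->
    tperm i0 i1 @: (j |: B) = tperm i0 i1 j |: B.
  move=> Bi _; rewrite imsetU imset_set1; congr (_ |: _).
  rewrite -[RHS]imset_id; apply: eq_in_imset => x xB; apply: s_fix;
  by apply/negP => /eqP xi; move/setP : Bi => /(_ x); rewrite !inE xB xi eqxx ?orbT.
have Ci : C :&: [set i0; i1]%SET = set0.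
  apply/setP => x; rewrite !inE; apply/negbTE/andP => -[xC /orP[]] /eqP xi;
    by move: (iC false) (iC true); rewrite -/i0 -/i1 -xi xC.
(* The transposition of [i0] and [i1] fixes [A], [C] and every vertex seen by [I0], and carries
   [i0 |: C] to [i1 |: C]; exchangeability then makes the two expectations equal. *)
have swap0 : Ex (fun G => (I0 G)%:R * (H (i0 |: C) G - H (i1 |: C) G)) = 0.
  have h0 : Ex (fun G => (I0 G)%:R * H (i0 |: C) G) = Ex (fun G => (I0 G)%:R * H (i1 |: C) G).
    rewrite -(Ex_perm (tperm i0 i1)); apply: eq_Ex => G; congr (_%:R * h _.+1).
      rewrite /I0 (@eq_conn _ (adj (reindex_graph _ _)) (adj G)); last first.
        by move=> a b aA bA; rewrite adj_reindex !sA.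
      rewrite (@eq_linked _ (adj (reindex_graph _ _)) (adj G))//.
      move=> a b aA; rewrite !inE => /and3P[bi0 bA bb].
      rewrite adj_reindex sA// s_fix//.
      by apply: contraTneq bb => ->.
    rewrite -{2}[i1](tpermL i0 i1) -sC//; last by left.
    rewrite ncomps_imset//; last exact: perm_inj.
    by apply: eq_ncomps => a b _ _; rewrite adj_reindex.
  have e0 : (fun G => (I0 G)%:R * (H (i0 |: C) G - H (i1 |: C) G)) =1
     (fun G => (I0 G)%:R * H (i0 |: C) G - (I0 G)%:R * H (i1 |: C) G).
    by move=> G; rewrite mulrBr.
  by rewrite (eq_Ex w e0) ExB h0 subrr.
have e1 : (fun G => (is_comp A G)%:R * (H (mixed D others) G - H (mixed (i |: D) others) G)) =1
    (fun G => (I0 G)%:R * (H (i0 |: C) G - H (i1 |: C) G) -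
       (I0 G && linked (adj G) A [set i0]%SET)%:R * (H (i0 |: C) G - H (i1 |: C) G)).
  by move=> G; rewrite E0 E1 IE mulrBl.
rewrite (eq_Ex w e1) ExB swap0 sub0r normrN.
apply: le_trans (ler_norm_Ex _ _) _ => //.
pose Y a (G : graph T) : R := (conn (adj G) A)%:R * (adj G a i0)%:R.
pose pv j (G : graph T) : R := #|pivots (adj G) k j C|%:R.
have Y_ge0 a G : 0 <= Y a G by rewrite /Y mulr_ge0.
(* What remains requires some [a] in [A] adjacent to [i0]. The two counts are compared through [C],
   which brings in the pivots of [i0] and of [i1]. As [Y a] is local on [i0 |: A], disjoint from
   [C], the adjacency and pivot costs multiply. *)
apply: (@le_trans _ _ (Ex (fun G => \sum_(a in A) delta * (Y a G * pv i0 G + Y a G * pv i1 G)))).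
  apply: ler_Ex => // G; rewrite normrM normr_nat /I0.
  have t_ge0 a : 0 <= delta * (Y a G * pv i0 G + Y a G * pv i1 G).
    by rewrite mulr_ge0// -mulrDr mulr_ge0// addr_ge0.
  case: (boolP (conn (adj G) A)) => cA /=; last by rewrite mul0r sumr_ge0.
  case: (boolP (linked (adj G) A [set i0]%SET)) => lA; last first.
    by rewrite andbF mul0r sumr_ge0.
  rewrite andbT; case: (~~ _); last by rewrite mul0r sumr_ge0.
  rewrite mul1r; case/linkedP : lA => a [b [aA]]; rewrite inE => /eqP -> ab.
  have Ya : Y a G = 1 by rewrite /Y cA ab mulr1.
  rewrite (bigD1 a)//= Ya !mul1r.
  apply: ler_wpDr; first by apply: sumr_ge0 => ? _; exact: t_ge0.
  have := ler_distD (H C G) (H (i0 |: C) G) (H (i1 |: C) G) => /le_trans; apply.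
  rewrite mulrDr lerD//; first exact: h_pivots (iC false).
  by rewrite distrC; exact: h_pivots (iC true).
rewrite Ex_sum -mulrA mulr_natl -Ak -sumr_const; apply: ler_sum => a aA.
rewrite ExZ ExD mulrCA ler_wpM2l//.
have YE : Ex (Y a) <= rho * p.
  by rewrite -(Ex_conn_p Ak); apply: (Ex_adj (A := A)) => //; exact: local_on_conn.
have lY : local_on (i0 |: A) (Y a).
  apply: local_onM; last by apply: local_on_adj; rewrite !inE ?aA ?eqxx ?orbT.
  by apply: local_onS (@local_on_conn _ _ _); exact: subsetUr.
have dY : [disjoint i0 |: A & C].
  by rewrite -setI_eq0 setIUl setU_eq0 !setI_eq0 disjoints1 iC AC.
have piv b : Ex (fun G => Y a G * pv (i, b) G) <= kappa * (rho * p).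
  apply: le_trans (_ : kappa * Ex (Y a) <= _); last exact: ler_wpM2l.
  apply: (@Ex_pivots _ _ _ w_ge0 _ rho_ge0 Ex_adj _ _ k_gt0 nrho (i0 |: A)) => //.
  exact: mixed_card.
rewrite mulrCA [leRHS]mulrDl mul1r [rho * p * _]mulrC.
by apply: lerD; exact: piv.
Qed.

Let mixed_bound D : D \subset others ->
  `|Ex (fun G => (is_comp A G)%:R * (H (mixed set0 others) G - H (mixed D others) G))|
    <= #|D|%:R * (k%:R * (rho * p) * (delta * (2 * kappa))).
Proof.
move: {-2}#|D| (erefl #|D|) => s; elim: s D => [|s IHs] D /esym Ds Do.
  rewrite (cards0_eq Ds) mul0r; under eq_Ex do rewrite subrr mulr0.
  by rewrite Ex_cst// normr0.
have /set0Pn[i iD] : D != set0 by rewrite -card_gt0 Ds.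
have := cardsD1 i D; rewrite iD Ds add1n => -[Ds'].
have io := subsetP Do _ iD.
have e0 : (fun G => (is_comp A G)%:R * (H (mixed set0 others) G - H (mixed D others) G)) =1
  (fun G => (is_comp A G)%:R * (H (mixed set0 others) G - H (mixed (D :\ i) others) G) +
     (is_comp A G)%:R * (H (mixed (D :\ i) others) G - H (mixed (i |: (D :\ i)) others) G)).
  by move=> G; rewrite setD1K// -mulrDr addrA subrK.
rewrite (eq_Ex w e0) ExD; apply: le_trans (ler_normD _ _) _.
rewrite -natr1 mulrDl mul1r lerD//.
  by apply: IHs => //; apply: subset_trans Do; exact: subD1set.
by apply: mixed_step => //; rewrite !inE eqxx.
Qed.

(** After all replacements the count lives on the copies, hence is independent of [is_comp A];
    flipping the Boolean turns its mean into that over [base :\: A], and [Ex_add_vertices] puts [A]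
    back. The constant is 5 = 4 + 1: the replacements cost at most 2 p k delta kappa (as n rho <=
    1), with p at most twice the probability of [is_comp A], and putting [A] back costs k delta
    kappa. *)
Lemma stein_one_component :
  `|Ex (fun G => (is_comp A G)%:R * H (base :\: A) G) -
     Ex (fun G => (is_comp A G)%:R) * Ex (fun G => h (nbase G).+1)|
  <= 5 * k%:R * (delta * kappa) * Ex (fun G => (is_comp A G)%:R).
Proof.
pose EI := Ex (fun G => (is_comp A G)%:R).
have p0 := p_ge0 Ak.
have EI0 : 0 <= EI by apply: Ex_ge0.
have EIp : p <= 2 * EI.
  have : p * 2^-1 <= EI.
    apply: le_trans (Ex_is_comp_ge Ak); rewrite ler_wpM2l//.
    by move: nkrho; move: (n%:R * k%:R * rho) => x; lra.
  lra.
have indep : Ex (fun G => (is_comp A G)%:R * H (mixed others others) G) =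
    EI * Ex (H (mixed others others)).
  apply: (@Ex_indep base (mixed others others)); last 2 first.
  - exact: local_on_is_comp.
  - exact: (local_on_ncomps (A := mixed others others) k (fun m => h m.+1)).
  rewrite -setI_eq0; apply/eqP/setP => -[i b]; rewrite !inE /=.
  apply/negbTE/andP => -[b0 /imsetP[j jo [_ bj]]].
  by rewrite bj jo in b0.
have flip_inj : injective (fun x : T => (x.1, ~~ x.2)).
  by move=> [i b] [j c] [-> /negb_inj ->].
have flipE : Ex (H (mixed others others)) = Ex (H (base :\: A)).
  rewrite -(Ex_perm (perm flip_inj) (H (base :\: A))); apply: eq_Ex => G; congr (h _.+1).
  have -> : mixed others others = perm flip_inj @: (base :\: A).
    rewrite -mixed0 /mixed -imset_comp; apply: eq_in_imset => i io /=.
    by rewrite permE /= io in_set0.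
  rewrite ncomps_imset; last exact: perm_inj.
  by apply: eq_ncomps => a b _ _; rewrite adj_reindex.
have addA : `|Ex (H (base :\: A)) - Ex (fun G => h (nbase G).+1)| <= k%:R * (delta * kappa).
  have bE : A :|: (base :\: A) = base.
    by rewrite -[in RHS](setID base A) (setIidPr A_base).
  have dA : [disjoint A & base :\: A].
    by rewrite -setI_eq0 setIDA setIC -setIDA setDv setI0.
  by have := Ex_add_vertices dA; rewrite bE card_base Ak distrC; apply.
have := mixed_bound (subxx others); rewrite mixed0.
have e0 : (fun G => (is_comp A G)%:R * (H (base :\: A) G - H (mixed others others) G)) =1
    (fun G => (is_comp A G)%:R * H (base :\: A) G - (is_comp A G)%:R * H (mixed others others) G).
  by move=> G; rewrite mulrBr.
rewrite (eq_Ex w e0) ExB indep flipE => b1.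
rewrite -(subrKA (EI * Ex (H (base :\: A)))); apply: le_trans (ler_normD _ _) _.
rewrite -/EI -mulrBr normrM (ger0_norm EI0).
apply: (@le_trans _ _ (k%:R * (delta * kappa) * (2 * p) + EI * (k%:R * (delta * kappa)))).
  apply: lerD; last exact: ler_wpM2l.
  apply: le_trans b1 _.
  rewrite [leLHS](_ : _ = (#|others|%:R * rho) * (k%:R * (delta * kappa) * (2 * p))); last by ring.
  apply: ler_piMl; first by do !apply: mulr_ge0 => //.
  apply: le_trans nrho; rewrite ler_wpM2r// ler_nat.
  by rewrite -[leqRHS]card_ord max_card.
have c0 : 0 <= k%:R * (delta * kappa) by apply: mulr_ge0 => //; exact: mulr_ge0.
rewrite -(mulrA 5); have := ler_wpM2l c0 EIp.
by move: (k%:R * (delta * kappa)) c0 => c c0; lra.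
Qed.

End one_component.

Theorem stein_identity_nbase :
  `|Ex (fun G => (nbase G)%:R * h (nbase G)) -
     Ex (fun G => (nbase G)%:R) * Ex (fun G => h (nbase G).+1)|
  <= 5 * k%:R * (delta * kappa) * Ex (fun G => (nbase G)%:R).
Proof.
have e0 : (fun G => (nbase G)%:R * h (nbase G)) =1 (fun G => 
  \sum_(A : {set T} | (A \subset base) && (#|A| == k))
     (is_comp A G)%:R * h (ncomps (adj G) k (base :\: A)).+1).
  by move=> G; exact: nbase_mul.
rewrite (eq_Ex w e0) (eq_Ex w nbase_sum) !Ex_sum mulr_suml mulr_sumr -sumrB.
apply: le_trans (ler_norm_sum _ _ _) _; apply: ler_sum => A /andP[Ab /eqP Ak].
exact: stein_one_component.
Qed.

End stein_identity.

(** * The Poisson and the normal Stein equations *)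

Section poisson_stein_chen.
Local Open Scope classical_set_scope.
Variables (R : realType) (t : R).
Hypothesis t_gt0 : 0 < t.
Implicit Types (A : set nat) (j : nat).

Local Notation pmf := (poisson_pmf t).
Local Notation below j := [set i : nat | (i < j)%N].

Definition poisson_mass A : R := fine (poisson_prob t 0 A).
Local Notation q := poisson_mass.

Lemma poisson_pmf_gt0 j : 0 < pmf j.
Proof.
by rewrite /poisson_pmf t_gt0 !mulr_gt0 ?exprn_gt0 ?expR_gt0// invr_gt0 ltr0n.
Qed.

Lemma poisson_pmfS j : t * pmf j = j.+1%:R * pmf j.+1.
Proof.
rewrite /poisson_pmf t_gt0 exprS factS natrM.
have : j`!%:R != 0 :> R by rewrite pnatr_eq0 -lt0n fact_gt0.
have : j.+1%:R != 0 :> R by rewrite pnatr_eq0.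
by by move: (j.+1%:R) (j`!%:R) => a b a0 b0; field; rewrite a0 b0.
Qed.

Lemma poisson_mass_ge0 A : 0 <= q A.
Proof. exact: fine_ge0. Qed.

Lemma poisson_massU A B : A `&` B = set0 -> q (A `|` B) = q A + q B.
Proof.
by move=> AB; rewrite /q measureU// fineD// fin_num_measure.
Qed.

Lemma poisson_massT : q setT = 1.
Proof. by rewrite /q probability_setT. Qed.

Lemma poisson_mass0 : q set0 = 0.
Proof. by rewrite /q measure0. Qed.

Lemma le_poisson_mass A B : A `<=` B -> q A <= q B.
Proof.
by move=> AB; rewrite /q fine_le// ?fin_num_measure//; apply: le_measure; rewrite ?inE.
Qed.

Lemma poisson_mass1 j : q [set j] = pmf j.
Proof.
by rewrite /q /poisson_prob t_gt0 esum_set1// lee_fin ltW// poisson_pmf_gt0.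
Qed.

Lemma poisson_mass_belowS A j :
  q (A `&` below j.+1) = q (A `&` below j) + (j \in A)%:R * pmf j.
Proof.
have [jA|jA] := boolP (j \in A).
  rewrite mul1r -poisson_mass1 -poisson_massU.
    congr q; apply/seteqP; split => i /=.
      by rewrite ltnS leq_eqVlt => -[iA /orP[/eqP ->|ij]]; [right|left].
    by move=> [[iA /ltnW]//|->]; split => //; exact: set_mem.
  by apply/seteqP; split => i //= -[[_ ij] ji]; rewrite ji ltnn in ij.
rewrite mul0r addr0; congr q; apply/seteqP; split => i /= [iA ij]; split => //.
  rewrite ltnS leq_eqVlt in ij; case/orP : ij => // /eqP ij.
  by rewrite -ij mem_set in jA.
exact: ltnW.
Qed.

Lemma poisson_mass_below j : q (below j.+1) = q (below j) + pmf j.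
Proof.
by have := poisson_mass_belowS setT j; rewrite !setTI in_setT mul1r.
Qed.

Lemma poisson_mass_below0 : q (below 0) = 0.
Proof.
by rewrite (_ : below 0 = set0) ?poisson_mass0//; apply/seteqP; split.
Qed.

Lemma poisson_mass_below_cvg : q (below j) @[j --> \oo] --> (1 : R).
Proof.
apply: fine_cvg; rewrite -(@probability_setT _ _ _ (poisson_prob t 0)).
rewrite [X in _ --> X](_ : _ = poisson_prob t 0 (\bigcup_j below j)); last first.
  congr (poisson_prob _ _ _); apply/seteqP; split => // i _.
  by exists i.+1 => /=.
apply: nondecreasing_cvg_mu => //.
by move=> i j ij; apply/subsetPset => x /= xi; exact: leq_trans ij.
Qed.

(** Term by term, t pmf(i) = (i+1) pmf(i+1) <= j pmf(i+1) for i < j. This and the next lemma are the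
    tail estimates behind the bound 1/t on the increments of the Stein-Chen solution. *)
Lemma poisson_mass_below_le j : t * q (below j) <= j%:R * q (below j.+1).
Proof.
elim: j => [|j IHj]; first by rewrite poisson_mass_below0 mulr0 mul0r.
rewrite poisson_mass_below mulrDr poisson_pmfS (poisson_mass_below j.+1).
apply: le_trans (lerD IHj (lexx _)) _.
rewrite mulrDr lerD2r ler_wpM2r ?poisson_mass_ge0// ler_nat; exact: leqnSn.
Qed.

(** The upper tail analogue, from j pmf(i+1) <= (i+1) pmf(i+1) = t pmf(i) for i >= j; it is proved
    on finite windows, whose length then tends to infinity. *)
Lemma poisson_mass_above_le j :
  j%:R * (1 - q (below j.+1)) <= t * (1 - q (below j)).
Proof.
have step m : j%:R * (q (below (j + m).+1) - q (below j.+1)) <=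
    t * (q (below (j + m)) - q (below j)).
  elim: m => [|m IHm]; first by rewrite addn0 !subrr !mulr0.
  rewrite addnS (poisson_mass_below (j + m).+1) (poisson_mass_below (j + m)).
  have : j%:R * pmf (j + m).+1 <= t * pmf (j + m).
    by rewrite poisson_pmfS ler_wpM2r ?ltW ?poisson_pmf_gt0// ltr_nat ltnS leq_addr.
  by move: IHm; rewrite (poisson_mass_below (j + m)); lra.
apply: (@ler_cvg_to _ \oo _ R (fun m => j%:R * (q (below (j + m).+1) - q (below j.+1)))
  (fun m => t * (q (below (j + m)) - q (below j)))).
- have h : q (below (j + m).+1) @[m --> \oo] --> (1 : R).
    have := poisson_mass_below_cvg; rewrite -(cvg_shiftn j.+1).
    by under eq_fun do rewrite addnC addSn.
  exact: (cvgM (cvg_cst _) (cvgB h (cvg_cst _))).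
- have h : q (below (j + m)) @[m --> \oo] --> (1 : R).
    have := poisson_mass_below_cvg; rewrite -(cvg_shiftn j).
    by under eq_fun do rewrite addnC.
  exact: (cvgM (cvg_cst _) (cvgB h (cvg_cst _))).
- by apply: nearW => m; exact: step.
Qed.

(* The bounded solution of t h(j+1) - j h(j) = 1_A(j) - q A; its value at 0 is
   the junk value x / 0 = 0. *)
Definition stein_chen A j : R :=
  (q (A `&` below j) - q A * q (below j)) / (j%:R * pmf j).

Lemma stein_chen_eq A j :
  t * stein_chen A j.+1 - j%:R * stein_chen A j = (j \in A)%:R - q A.
Proof.
have p0 i : pmf i != 0 by rewrite gt_eqF ?poisson_pmf_gt0.
have t0 : t != 0 by rewrite gt_eqF.
rewrite /stein_chen -poisson_pmfS poisson_mass_belowS poisson_mass_below.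
case: j => [|j].
  rewrite (_ : A `&` below 0 = set0) ?poisson_mass0 ?poisson_mass_below0; last first.
    by apply/seteqP; split => i //= [].
  by rewrite !mul0r subr0; field; rewrite t0 p0.
have j0 : j.+1%:R != 0 :> R by rewrite pnatr_eq0.
move: (j.+1%:R) j0 (pmf j.+1) (p0 j.+1) => n n0 p p1.
by field; rewrite t0 n0 p1.
Qed.

(** [A] is split into its parts below j, at j and above j, of masses a, c and b. The identity t
    pmf(j) = (j+1) pmf(j+1) gives the increment the denominator t (j pmf(j)), and the numerator is
    linear in a, b, c. *)
Lemma stein_chen_lip A j : `|stein_chen A j.+1 - stein_chen A j| <= t^-1.
Proof.
have pj : 0 < pmf j := poisson_pmf_gt0 j.
have [Aj0 AjP] : 0 <= (j \in A)%:R * pmf j /\ (j \in A)%:R * pmf j <= pmf j.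
  by case: (j \in A); rewrite ?mul1r ?mul0r ?lexx ltW.
have a0 := poisson_mass_ge0 (A `&` below j).
have aP : q (A `&` below j) <= q (below j) by apply: le_poisson_mass.
have qE (B : set nat) : q B = q (B `&` below j.+1) + q (B `\` below j.+1).
  by rewrite -poisson_massU ?setUIDK//; apply/seteqP; split => i //= [[_ ?] []].
have b0 := poisson_mass_ge0 (A `\` below j.+1).
have bQ : q (A `\` below j.+1) <= 1 - q (below j.+1).
  rewrite -poisson_massT (qE setT) setTI addrAC subrr add0r.
  by apply: le_poisson_mass => i [].
have le1 := poisson_mass_below_le j; have le2 := poisson_mass_above_le j.
rewrite poisson_mass_below in le1 le2 bQ.
rewrite /stein_chen (qE A) -poisson_pmfS poisson_mass_belowS poisson_mass_below.
have P0 := poisson_mass_ge0 (below j).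
(* At j = 0 the solution takes the value 0 by the convention on division, and the increment is just
   (1_A(0) - q A) / t. *)
case: j pj Aj0 AjP a0 aP b0 bQ le1 le2 P0 {qE} => [|j] pj Aj0 AjP a0 aP b0 bQ le1 le2 P0.
  move: a0 aP b0 bQ; rewrite mul0r invr0 mulr0 subr0 poisson_mass_below0 add0r => a0 aP b0 bQ.
  have {aP}a0 : q (A `&` below 0) = 0 by apply/eqP; rewrite eq_le aP a0.
  rewrite a0 !add0r normrM normfV (@gtr0_norm _ (t * _)) ?mulr_gt0//.
  rewrite ler_pdivrMr ?mulr_gt0// mulKf ?gt_eqF// ler_norml.
  by move: (pmf 0) (_ * pmf 0) (q (A `\` _)) pj Aj0 AjP b0 bQ => p c b; nra.
(* The upper bound for arbitrary masses a, b, c subject to the tail estimates, so that it can also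
   be applied to the complement of [A]. *)
have h_up (a b c P p : R) : 0 <= a -> 0 <= b -> 0 <= c -> c <= p ->
    t * P <= j.+1%:R * (P + p) -> j.+1%:R * (1 - (P + p)) <= t * (1 - P) ->
    j.+1%:R * (a + c - (a + c + b) * (P + p)) - t * (a - (a + c + b) * P) <= j.+1%:R * p.
  move=> ha hb hc cp h1 h2.
  have k1 := ler_wpM2l ha h2; have k2 := ler_wpM2l hb h1.
  have k3 := ler_wpM2l hc h1; have k4 := ler_wpM2l (ler0n R j.+1) cp.
  lra.
move: (q (A `&` below j.+1)) (q (A `\` below j.+2)) (q (below j.+1)) (pmf j.+1)
  ((j.+1 \in A)%:R * pmf j.+1) pj Aj0 AjP a0 aP b0 bQ le1 le2 P0 => a b P p c.
move=> p0 c0 cp a0 aP b0 bQ le1 le2 P0.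
have jR : 0 < j.+1%:R :> R by rewrite ltr0n.
have up := h_up a b c P p a0 b0 c0 cp le1 le2.
have aP' : 0 <= P - a by rewrite subr_ge0.
have bQ' : 0 <= 1 - (P + p) - b by rewrite subr_ge0.
have cp' : 0 <= p - c by rewrite subr_ge0.
have cp'' : p - c <= p by rewrite gerBl.
(* Passing to the complement negates the numerator, so the same bound yields the lower estimate. *)
have dn := h_up _ _ _ P p aP' bQ' cp' cp'' le1 le2.
have -> : (a + c - (a + c + b) * (P + p)) / (t * p) -
   (a - (a + c + b) * P) / (j.+1%:R * p) =
   (j.+1%:R * (a + c - (a + c + b) * (P + p)) - t * (a - (a + c + b) * P)) /
     (t * (j.+1%:R * p)).
  by field; rewrite ?gt_eqF.
rewrite normrM normfV (@gtr0_norm _ (t * _)) ?mulr_gt0// ler_pdivrMr ?mulr_gt0//.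
rewrite mulKf ?gt_eqF// ler_norml up andbT.
lra.
Qed.

End poisson_stein_chen.

(** * The normal distribution function and the solution of its Stein equation *)

Section standard_normal.
Local Open Scope classical_set_scope.
Variable R : realType.
Implicit Types x y z w : R.

Definition gauss x : R := normal_pdf 0 1 x.
(** The reciprocal of the density, that is, the integrating factor of f' - w f up to a constant. *)
Definition gauss_inv x : R := (normal_peak 1)^-1 * expR (2^-1 * (x * x)).
Definition Phi x : R := fine (normal_prob 0 1 `]-oo, x]).

Lemma gaussE x : gauss x = normal_peak 1 * expR (- (2^-1 * (x * x))).
Proof.
rewrite /gauss normal_pdfE ?oner_eq0// /normal_fun; congr (_ * expR _).
by rewrite expr1n subr0 expr2; lra.
Qed.

Lemma normal_peak1_gt0 : 0 < normal_peak 1 :> R.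
Proof. by rewrite normal_peak_gt0// oner_eq0. Qed.

Lemma gauss_gt0 x : 0 < gauss x.
Proof. by rewrite gaussE mulr_gt0 ?expR_gt0 ?normal_peak1_gt0. Qed.

Lemma gaussN x : gauss (- x) = gauss x.
Proof. by rewrite !gaussE mulrNN. Qed.

Lemma gauss_invK x : gauss x * gauss_inv x = 1.
Proof.
rewrite gaussE /gauss_inv mulrACA divff ?gt_eqF ?normal_peak1_gt0// mul1r.
by rewrite expRN mulVf// gt_eqF// expR_gt0.
Qed.

Lemma gauss_inv_gt0 x : 0 < gauss_inv x.
Proof. by rewrite -(pmulr_rgt0 _ (gauss_gt0 x)) gauss_invK. Qed.

Lemma mean_value (f df : R -> R) a b : a <= b ->
  (forall x, is_derive x 1 f (df x)) ->
  exists c, [/\ a <= c, c <= b & f b - f a = df c * (b - a)].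
Proof.
move=> ab fdf; have [|c cab ->] := @MVT_segment R f df a b ab (fun x _ => fdf x).
  by apply: derivable_within_continuous => x _; exact: ex_derive.
by exists c; move: cab; rewrite in_itv => /andP[].
Qed.

Lemma is_derive_mul (f g : R -> R) x df dg : is_derive x 1 f df ->
  is_derive x 1 g dg -> is_derive x 1 (fun y => f y * g y) (df * g x + f x * dg).
Proof.
move=> hf hg; apply: (is_derive_eq (is_deriveM hf hg)).
by rewrite addrC mulrC.
Qed.

Lemma is_derive_add (f g : R -> R) x df dg : is_derive x 1 f df ->
  is_derive x 1 g dg -> is_derive x 1 (fun y => f y + g y) (df + dg).
Proof. exact: is_deriveD. Qed.

Lemma is_derive_opp (f : R -> R) x df : is_derive x 1 f df ->
  is_derive x 1 (fun y => - f y) (- df).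
Proof. exact: is_deriveN. Qed.

Lemma is_derive_subl c (f : R -> R) x df : is_derive x 1 f df ->
  is_derive x 1 (fun y => c - f y) (- df).
Proof.
move=> hf; apply: (is_derive_eq (is_derive_add (is_derive_cst c x 1) (is_derive_opp hf))).
by rewrite add0r.
Qed.

Lemma is_derive_scal c (f : R -> R) x df : is_derive x 1 f df ->
  is_derive x 1 (fun y => c * f y) (c * df).
Proof.
move=> hf; apply: (is_derive_eq (is_derive_mul (is_derive_cst c x 1) hf)).
by rewrite mul0r add0r.
Qed.

Lemma is_derive_half_sqr x : is_derive x 1 (fun y : R => 2^-1 * (y * y)) x.
Proof.
apply: (is_derive_eq (is_derive_scal _ (is_derive_mul (is_derive_id x 1) (is_derive_id x 1)))).
by rewrite mul1r mulr1; lra.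
Qed.

Lemma is_derive_gauss x : is_derive x 1 gauss (- x * gauss x).
Proof.
have -> : gauss = (fun y => normal_peak 1 * expR (- (2^-1 * (y * y)))).
  by apply/funext => y; rewrite gaussE.
apply: (is_derive_eq (is_derive_scal _ (is_derive1_comp (is_derive_expR _)
  (is_derive_opp (is_derive_half_sqr x))))).
by ring.
Qed.

Lemma is_derive_gauss_inv x : is_derive x 1 gauss_inv (x * gauss_inv x).
Proof.
apply: (is_derive_eq (is_derive_scal _ (is_derive1_comp (is_derive_expR _)
  (is_derive_half_sqr x)))).
by rewrite /gauss_inv; ring.
Qed.

Lemma is_derive_Phi x : is_derive x 1 Phi (gauss x).
Proof.
have xx1 : x < x + 1 by rewrite ltrDl.
have int_gauss : lebesgue_measure.-integrable `]-oo, x + 1] (EFin \o gauss).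
  by apply: integrableS (integrable_normal_pdf 0 1) => //; exact: measurable_itv.
have cont_gauss : {for x, continuous gauss}.
  by apply: continuous_normal_pdf; rewrite oner_eq0.
have [|d e] := continuous_FTC1 xx1 int_gauss _ cont_gauss.
  by rewrite ltNyr.
apply: DeriveDef; first exact: d.
by rewrite -derive1E.
Qed.

Lemma Phi_ge0 x : 0 <= Phi x.
Proof. exact: fine_ge0. Qed.

Lemma Phi_le1 x : Phi x <= 1.
Proof.
by rewrite -lee_fin fineK ?fin_num_measure// probability_le1.
Qed.

Let id_fun : measurableTypeR R -> R := idfun.

Let measurable_id_fun : measurable_fun setT id_fun.
Proof. exact: measurable_id. Qed.

Let normal_id : {RV (normal_prob (0 : R) 1) >-> R} :=
  mfun_Sub (mem_set measurable_id_fun).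

Lemma cvg_Phi_pinfty : Phi x @[x --> +oo] --> (1 : R).
Proof. by apply: fine_cvg; have := cvg_cdfy1 normal_id. Qed.

Lemma cvg_Phi_ninfty : Phi x @[x --> -oo] --> (0 : R).
Proof. by apply: fine_cvg; have := cvg_cdfNy0 normal_id. Qed.

(** The function gauss y + w F y has derivative (w - y) gauss y, so it decreases on [w, +oo);
    compare its value at w with its limit. [F] is abstract so that the reflection of [Phi] can be
    treated without knowing that it equals [Phi]. *)
Lemma mills_ratio (F : R -> R) w : (forall x, is_derive x 1 F (gauss x)) ->
  F x @[x --> +oo] --> (1 : R) -> 0 < w -> w * (1 - F w) <= gauss w.
Proof.
move=> dF F1 w0.
have h x : w <= x -> w * (F x - F w) <= gauss w.
  move=> wx.
  have [y|c [wc cx E]] := @mean_value (fun y => gauss y + w * F y)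
      (fun y => (w - y) * gauss y) w x wx.
    apply: (is_derive_eq (is_derive_add (is_derive_gauss y) (is_derive_scal w (dF y)))).
    by ring.
  have : (w - c) * gauss c * (x - w) <= 0.
    by rewrite mulr_le0_ge0 ?subr_ge0// mulr_le0_ge0 ?subr_le0// ltW// gauss_gt0.
  by rewrite -E; have := gauss_gt0 x; lra.
have cF : w * (F x - F w) @[x --> +oo] --> w * (1 - F w).
  by apply: cvgM; [exact: cvg_cst|exact: cvgB F1 (cvg_cst _)].
apply: (ler_cvg_to cF (cvg_cst (gauss w))).
by near=> x; apply: h; near: x; apply: nbhs_pinfty_ge; exact: num_real.
Unshelve. all: by end_near. Qed.

Lemma mills_right w : 0 < w -> w * ((1 - Phi w) * gauss_inv w) <= 1.
Proof.
move=> w0; rewrite mulrA -[leRHS](gauss_invK w) ler_pM2r ?gauss_inv_gt0//.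
exact: mills_ratio is_derive_Phi cvg_Phi_pinfty w0.
Qed.

Lemma mills_left w : w < 0 -> - w * (Phi w * gauss_inv w) <= 1.
Proof.
move=> w0; rewrite mulrA -[leRHS](gauss_invK w) ler_pM2r ?gauss_inv_gt0//.
rewrite -gaussN -[Phi w](subKr 1) -{2}[w]opprK.
apply: (mills_ratio (F := fun x => 1 - Phi (- x))); last by rewrite oppr_gt0.
  move=> x.
  have dPhiN : is_derive x 1 (fun y => Phi (- y)) (gauss (- x) * -1).
    apply: (@is_derive1_comp _ Phi (fun y => - y)); exact: is_derive_Phi.
  apply: (is_derive_eq (is_derive_subl 1 dPhiN)).
  by rewrite gaussN; ring.
rewrite -[X in _ --> X]subr0; apply: cvgB; first exact: cvg_cst.
by apply: (cvg_comp -%R Phi _ cvg_Phi_ninfty); rewrite ninfty.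
Qed.

(** Bounds the Stein solution on both ranges: [gauss_inv 1] covers |w| <= 1, and Mills' inequality
    gives 1 for |w| >= 1. *)
Definition stein_ub : R := 1 + gauss_inv 1.
Local Notation K := stein_ub.

Lemma gauss_inv_le_ub w : `|w| <= 1 -> gauss_inv w <= K.
Proof.
move=> w1; apply: le_trans (_ : gauss_inv 1 <= _); last by rewrite lerDr.
have c0 : 0 < (normal_peak 1)^-1 :> R by rewrite invr_gt0; exact: normal_peak1_gt0.
rewrite (ler_pM2l c0) ler_expR ler_wpM2l ?invr_ge0//.
by rewrite -expr2 -real_normK ?num_real// expr2 ler_pM.
Qed.

Lemma mills_bound a w : 0 <= a -> a <= 1 -> 0 <= w -> w * (a * gauss_inv w) <= 1 ->
  a * gauss_inv w <= K.
Proof.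
move=> a0 a1 w0 h; have g0 := gauss_inv_gt0 w.
have [w1|w1] := leP w 1.
  apply: le_trans (_ : gauss_inv w <= _); first by rewrite ler_piMl// ltW.
  by apply: gauss_inv_le_ub; rewrite ger0_norm.
have : a * gauss_inv w <= w * (a * gauss_inv w).
  by apply: ler_peMl; [rewrite mulr_ge0// ltW|exact: ltW].
by have := gauss_inv_gt0 1; rewrite /K; lra.
Qed.

Lemma gauss_invN w : gauss_inv (- w) = gauss_inv w.
Proof. by rewrite /gauss_inv mulrNN. Qed.

Section stein_solution.
Variable z : R.

Let f1 w := (1 - Phi z) * (Phi w * gauss_inv w).
Let f2 w := Phi z * ((1 - Phi w) * gauss_inv w).

(* The bounded solution of f'(w) - w f(w) = 1{w <= z} - Phi z. *)
Definition normal_stein w := if w <= z then f1 w else f2 w.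
Local Notation f := normal_stein.

Let f1_deriv w : is_derive w 1 f1 (w * f1 w + (1 - Phi z)).
Proof.
apply: (is_derive_eq (is_derive_scal _ (is_derive_mul (is_derive_Phi w)
  (is_derive_gauss_inv w)))).
by rewrite gauss_invK /f1; ring.
Qed.

Let f2_deriv w : is_derive w 1 f2 (w * f2 w - Phi z).
Proof.
apply: (is_derive_eq (is_derive_scal _ (is_derive_mul (is_derive_subl 1 (is_derive_Phi w)) (is_derive_gauss_inv w)))).
by rewrite mulNr gauss_invK /f2; ring.
Qed.

Let Phi_bounds w : 0 <= Phi w /\ 0 <= 1 - Phi w.
Proof. by rewrite Phi_ge0 subr_ge0 Phi_le1. Qed.

Lemma Phi_nondecreasing x y : x <= y -> Phi x <= Phi y.
Proof.
move=> xy; have [c [_ _ E]] := mean_value xy is_derive_Phi.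
by rewrite -subr_ge0 E mulr_ge0 ?subr_ge0// ltW// gauss_gt0.
Qed.

Let scaled_bounds (c a : R) w : 0 <= c -> c <= 1 -> 0 <= a -> a <= 1 ->
  `|w| * (a * gauss_inv w) <= 1 -> `|c * (a * gauss_inv w)| <= K /\
    `|w * (c * (a * gauss_inv w))| <= 1.
Proof.
move=> c0 c1 a0 a1 h; have g0 := gauss_inv_gt0 w.
have ag0 : 0 <= a * gauss_inv w by rewrite mulr_ge0// ltW.
rewrite (normrM w) (normrM c (a * _)) (ger0_norm c0) (ger0_norm ag0); split.
  apply: le_trans (_ : a * gauss_inv w <= _); first by rewrite ler_piMl.
  have gE : gauss_inv w = gauss_inv `|w|.
    by case: (ger0P w) => // _; rewrite gauss_invN.
  by rewrite gE; apply: mills_bound => //; rewrite -gE.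
by rewrite mulrCA; apply: le_trans h; rewrite ler_piMl// mulr_ge0.
Qed.

Let f1_bounds w : w <= z -> `|f1 w| <= K /\ `|w * f1 w| <= 1.
Proof.
move=> wz; have [p0 p1] := Phi_bounds w; have [q0 q1] := Phi_bounds z.
have [w0|w0] := ltP w 0.
  by apply: scaled_bounds => //; rewrite ?lerBlDl ?lerDr ?Phi_le1// ltr0_norm//; exact: mills_left.
have [->|w_neq0] := eqVneq w 0.
  apply: scaled_bounds; rewrite ?lerBlDl ?lerDr ?Phi_le1 ?Phi_ge0//.
  by rewrite normr0 mul0r.
(* For 0 < w <= z the left tail is no longer small; the factor 1 - Phi z is at most 1 - Phi w, to
   which the right Mills bound applies. *)
have [qw qp] : (1 - Phi z <= 1 - Phi w) /\ True.
  by rewrite lerD2l lerN2 Phi_nondecreasing.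
have w_gt0 : 0 < w by rewrite lt_def w_neq0.
have g0 := gauss_inv_gt0 w.
have [h1 h2] : `|Phi w * ((1 - Phi w) * gauss_inv w)| <= K /\
    `|w * (Phi w * ((1 - Phi w) * gauss_inv w))| <= 1.
  apply: scaled_bounds => //; rewrite ?lerBlDl ?lerDr ?Phi_le1//.
  by rewrite gtr0_norm//; exact: mills_right.
have h3 : `|f1 w| <= `|Phi w * ((1 - Phi w) * gauss_inv w)|.
  have g1 := ltW g0; rewrite /f1 (ger0_norm (mulr_ge0 q1 (mulr_ge0 p0 g1))) (ger0_norm (mulr_ge0 p0 (mulr_ge0 p1 g1))).
  by rewrite mulrCA ler_wpM2l// ler_wpM2r.
split; first exact: le_trans h3 h1.
by apply: le_trans h2; rewrite [leLHS]normrM [leRHS]normrM ler_wpM2l.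
Qed.

Let f2_bounds w : z <= w -> `|f2 w| <= K /\ `|w * f2 w| <= 1.
Proof.
move=> zw; have [p0 p1] := Phi_bounds w; have [q0 q1] := Phi_bounds z.
have [w0|w0] := ltP 0 w.
  by apply: scaled_bounds => //; rewrite ?lerBlDl ?lerDr ?Phi_le1// gtr0_norm//; exact: mills_right.
have [->|w_neq0] := eqVneq w 0.
  apply: scaled_bounds; rewrite ?lerBlDl ?lerDr ?Phi_le1 ?Phi_ge0//.
    by have [] := Phi_bounds 0.
  by rewrite normr0 mul0r.
have qw : Phi z <= Phi w by rewrite Phi_nondecreasing.
have w_lt0 : w < 0 by rewrite lt_neqAle w_neq0.
have g0 := gauss_inv_gt0 w.
have [h1 h2] : `|(1 - Phi w) * (Phi w * gauss_inv w)| <= K /\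
    `|w * ((1 - Phi w) * (Phi w * gauss_inv w))| <= 1.
  apply: scaled_bounds => //; rewrite ?lerBlDl ?lerDr ?Phi_le1//.
  by rewrite ltr0_norm//; exact: mills_left.
have h3 : `|f2 w| <= `|(1 - Phi w) * (Phi w * gauss_inv w)|.
  have g1 := ltW g0; rewrite /f2 (ger0_norm (mulr_ge0 q0 (mulr_ge0 p1 g1))) (ger0_norm (mulr_ge0 p1 (mulr_ge0 p0 g1))).
  by rewrite mulrCA ler_wpM2l// ler_wpM2r.
split; first exact: le_trans h3 h1.
by apply: le_trans h2; rewrite [leLHS]normrM [leRHS]normrM ler_wpM2l.
Qed.

Let f12z : f1 z = f2 z.
Proof. by rewrite /f1 /f2; ring. Qed.

Let K_ge0 : 0 <= K.
Proof. by rewrite addr_ge0// ltW// gauss_inv_gt0. Qed.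

Let piece_lip (g : R -> R) c a b : a <= b -> `|c| <= 1 ->
  (forall x, is_derive x 1 g (x * g x + c)) ->
  (forall x, a <= x -> x <= b -> `|g x| <= K /\ `|x * g x| <= 1) ->
  `|g b - g a| <= 2 * (b - a).
Proof.
move=> ab c1 dg gb; have [x [ax xb ->]] := mean_value ab dg.
have [_ h] := gb x ax xb.
rewrite normrM (@ger0_norm _ (b - a)) ?subr_ge0// ler_wpM2r ?subr_ge0//.
by apply: le_trans (ler_normD _ _) _; lra.
Qed.

Let piece_taylor (g : R -> R) c a b : a <= b -> `|c| <= 1 ->
  (forall x, is_derive x 1 g (x * g x + c)) ->
  (forall x, a <= x -> x <= b -> `|g x| <= K /\ `|x * g x| <= 1) ->
  `|g b - g a - (b - a) * (a * g a + c)| <= (b - a) ^+ 2 * (K + 2 * `|a|).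
Proof.
move=> ab c1 dg gb; have [x [ax xb ->]] := mean_value ab dg.
(* The derivative x g(x) + c is compared at x and a without a second derivative: bound g for the
   first summand, and use the Lipschitz estimate for the second. *)
have -> : (x * g x + c) * (b - a) - (b - a) * (a * g a + c) =
  (b - a) * ((x - a) * g x + a * (g x - g a)) by ring.
have ba0 : 0 <= b - a by rewrite subr_ge0.
rewrite normrM (ger0_norm ba0) expr2 -mulrA ler_wpM2l//.
apply: le_trans (ler_normD _ _) _; rewrite [leRHS]mulrDr !normrM.
have [h1 _] := gb x ax xb.
rewrite lerD//.
  by rewrite ler_pM// ger0_norm ?subr_ge0// lerD2r.
have h2 : `|g x - g a| <= 2 * (x - a).
  by apply: piece_lip => // y ay yx; apply: gb => //; exact: le_trans xb.
apply: le_trans (_ : `|a| * (2 * (x - a)) <= _); first exact: ler_wpM2l.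
rewrite mulrCA [(b - a) * _]mulrCA ler_wpM2l// [leRHS]mulrC ler_wpM2l//.
by rewrite lerD2r.
Qed.

Let Phi_z_le1 : `|- Phi z| <= 1 /\ `|1 - Phi z| <= 1.
Proof.
have [q0 q1] := Phi_bounds z; rewrite normrN !ger0_norm// Phi_le1.
by split => //; rewrite lerBlDr lerDl.
Qed.

Lemma normal_stein_bound w : `|f w| <= K /\ `|w * f w| <= 1.
Proof.
by rewrite /f; case: (leP w z) => [wz|/ltW zw]; [exact: f1_bounds|exact: f2_bounds].
Qed.

Lemma normal_stein_lip a b : a <= b -> `|f b - f a| <= 2 * (b - a).
Proof.
move=> ab; have [c1 c2] := Phi_z_le1; rewrite /f.
have [bz|zb] := leP b z.
  rewrite (le_trans ab bz); apply: (piece_lip (c := 1 - Phi z)) => // x ax xb.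
  by apply: f1_bounds; exact: le_trans bz.
have [az|za] := leP a z; last first.
  apply: (piece_lip (c := - Phi z)) => // x ax xb.
  by apply: f2_bounds; exact: le_trans (ltW za) ax.
rewrite -(subrKA (f2 z)) -{2}f12z; apply: le_trans (ler_normD _ _) _.
have h2 : `|f2 b - f2 z| <= 2 * (b - z).
  by apply: (piece_lip (c := - Phi z)) => //; [exact: ltW|move=> x zx _; exact: f2_bounds].
have h1 : `|f1 z - f1 a| <= 2 * (z - a).
  by apply: (piece_lip (c := 1 - Phi z)) => // x _; exact: f1_bounds.
lra.
Qed.

(** The derivative jumps by 1 at z. If z is not in [w, w + d) the expansion stays on one smooth
    piece; otherwise both the increment and its linear part are at most 2d, which gives 4d on this
    event. *)
Lemma normal_stein_taylor w d : 0 <= d ->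
  `|f (w + d) - f w - d * (w * f w + ((w <= z)%R%:R - Phi z))| <=
    d ^+ 2 * (K + 2 * `|w|) + 4 * d * ((w <= z) && (z < w + d))%R%:R.
Proof.
move=> d0; have [c1 c2] := Phi_z_le1.
have wd : w <= w + d by rewrite lerDl.
have dE : d = w + d - w by rewrite addrAC subrr add0r.
have [wz|zw] := leP w z; have [wdz|zwd] := leP (w + d) z => /=.
- have t : `|f1 (w + d) - f1 w - (w + d - w) * (w * f1 w + (1 - Phi z))| <=
      (w + d - w) ^+ 2 * (K + 2 * `|w|).
    apply: piece_taylor => // x wx xw.
    by apply: f1_bounds; exact: le_trans wdz.
  by rewrite mulr0 addr0 /f wz wdz; rewrite -dE in t.
- have [_ h1] := normal_stein_bound w.
  have h2 := normal_stein_lip wd; rewrite -dE in h2.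
  rewrite mulr1; apply: le_trans (ler_normB _ _) _.
  rewrite normrM (ger0_norm d0).
  have h3 : `|w * f w + (1 - Phi z)| <= 2.
    by apply: le_trans (ler_normD _ _) _; lra.
  have h4 := ler_wpM2l d0 h3.
  have h5 : 0 <= d ^+ 2 * (K + 2 * `|w|).
    by rewrite mulr_ge0 ?sqr_ge0// addr_ge0// mulr_ge0.
  lra.
- by have := lt_le_trans zw (le_trans wd wdz); rewrite ltxx.
- have t : `|f2 (w + d) - f2 w - (w + d - w) * (w * f2 w + - Phi z)| <=
      (w + d - w) ^+ 2 * (K + 2 * `|w|).
    apply: piece_taylor => // x wx xw.
    by apply: f2_bounds; exact: le_trans (ltW zw) wx.
  by rewrite mulr0 addr0 /f [w <= z]leNgt [w + d <= z]leNgt zw zwd /= sub0r; rewrite -dE in t.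
Qed.

End stein_solution.

Lemma normr_gauss_le x : `|x| * gauss x <= normal_peak 1.
Proof.
rewrite gaussE mulrCA; apply: ler_piMr; first exact: ltW normal_peak1_gt0.
rewrite expRN ler_pdivrMr ?expR_gt0// mul1r.
apply: le_trans (expR_ge1Dx _).
have -> : x * x = `|x| * `|x| by rewrite -normrM ger0_norm// -expr2 sqr_ge0.
by have := sqr_ge0 (`|x| - 1); rewrite expr2; lra.
Qed.

(** As s >= 1/2, the mean value point c between z and z s satisfies |z| <= 2 |c|, and |c| gauss(c)
    is bounded by the peak of the density. *)
Lemma Phi_scale z s : 2^-1 <= s ->
  `|Phi (z * s) - Phi z| <= 2 * normal_peak 1 * `|s - 1|.
Proof.
move=> s2.
have main c : `|z| <= 2 * `|c| -> gauss c * (`|z| * `|s - 1|) <= 2 * normal_peak 1 * `|s - 1|.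
  move=> zc; rewrite mulrA ler_wpM2r//.
  apply: le_trans (_ : gauss c * (2 * `|c|) <= _).
    by rewrite ler_wpM2l// ltW// gauss_gt0.
  by have := normr_gauss_le c; lra.
have zs : z * s - z = z * (s - 1) by ring.
have [zzs|/ltW zsz] := leP z (z * s).
  have [c [zc czs ->]] := mean_value zzs is_derive_Phi.
  rewrite normrM (gtr0_norm (gauss_gt0 c)) zs normrM; apply: main.
  have [z0|z0] := leP 0 z; first by rewrite !ger0_norm//; lra.
  have c0 : c <= z * 2^-1 by apply: le_trans czs _; rewrite ler_wnM2l// ltW.
  by rewrite !ltr0_norm//; lra.
have [c [zsc cz E]] := mean_value zsz is_derive_Phi.
rewrite distrC E normrM (gtr0_norm (gauss_gt0 c)) distrC zs normrM; apply: main.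
have [z0|z0] := leP 0 z.
  have c0 : z * 2^-1 <= c by apply: le_trans zsc; rewrite ler_wpM2l.
  by rewrite !ger0_norm//; lra.
by rewrite !ltr0_norm//; lra.
Qed.

End standard_normal.

(** * Consequences of an approximate Stein identity *)

Section stein_consequences.
Local Open Scope classical_set_scope.
Variables (R : realType) (T : finType) (w : graph T -> R) (W : graph T -> nat).
Local Notation Ex := (Ex w).
Hypothesis w_ge0 : forall G, 0 <= w G.
Hypothesis w_sum : \sum_G w G = 1.
Let lam := Ex (fun G => (W G)%:R).
Hypothesis lam_gt0 : 0 < lam.
Variable eps : R.
Hypothesis eps_le : eps <= 2^-1.
Hypothesis stein_id : forall (h : nat -> R) (delta : R),
  (forall j, `|h j.+1 - h j| <= delta) ->
  `|Ex (fun G => (W G)%:R * h (W G)) - lam * Ex (fun G => h (W G).+1)|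
     <= eps * delta * lam.

Let V := Ex (fun G => ((W G)%:R - lam) ^+ 2).

Lemma variance_approx : `|V - lam| <= eps * lam.
Proof.
have /stein_id : forall j, `|j.+1%:R - j%:R| <= 1 :> R.
  by move=> j; rewrite -natr1 addrAC subrr add0r normr1.
rewrite mulr1.
have e1 : (fun G => (W G).+1%:R) =1 (fun G => (W G)%:R + 1 : R).
  by move=> G; rewrite natr1.
have e2 : (fun G => ((W G)%:R - lam) ^+ 2) =1
    (fun G => (W G)%:R * (W G)%:R - (2 * lam * (W G)%:R - lam ^+ 2)).
  by move=> G; ring.
rewrite (eq_Ex w e1) ExD Ex_cst// -/lam /V (eq_Ex w e2) !ExB ExZ Ex_cst// -/lam.
by congr (`|_| <= _); ring.
Qed.

(** The increments of the Stein-Chen solution are at most 1/lam, which cancels the factor lam of the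
    error. *)
Lemma total_variation_approx (A : set nat) :
  `|Ex (fun G => (W G \in A)%:R) - poisson_mass lam A| <= eps.
Proof.
have /stein_id := stein_chen_lip lam_gt0 A.
rewrite -mulrA mulVf ?gt_eqF// mulr1 distrC -ExZ -ExB.
have e1 : (fun G => lam * stein_chen lam A (W G).+1 - (W G)%:R * stein_chen lam A (W G)) =1
    (fun G => (W G \in A)%:R - poisson_mass lam A).
  by move=> G; exact: stein_chen_eq.
by rewrite (eq_Ex w e1) ExB Ex_cst.
Qed.

Let d := (Num.sqrt lam)^-1.

Let sqrt_gt0 : 0 < Num.sqrt lam. Proof. by rewrite sqrtr_gt0. Qed.

Let d_gt0 : 0 < d. Proof. by rewrite invr_gt0. Qed.

Let lamd : lam * d * d = 1.
Proof.
rewrite -{1}(sqr_sqrtr (ltW lam_gt0)) expr2 /d.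
by rewrite mulfK ?gt_eqF// divff ?gt_eqF.
Qed.

Let u G := ((W G)%:R - lam) * d.

Let V_bounds : lam * (1 - eps) <= V <= lam * (1 + eps).
Proof. by have := variance_approx; rewrite ler_norml => /andP[]; lra. Qed.

Let Ex_u2 : Ex (fun G => u G ^+ 2) = V * d ^+ 2.
Proof. by rewrite mulrC -ExZ; apply: eq_Ex => G; rewrite /u exprMn mulrC. Qed.

Let Ex_u2_le : Ex (fun G => u G ^+ 2) <= 2.
Proof.
rewrite Ex_u2; have /andP[_ h] := V_bounds.
have d2 : 0 <= d ^+ 2 by exact: sqr_ge0.
apply: le_trans (ler_wpM2r d2 h) _.
rewrite expr2 [leLHS](_ : _ = lam * d * d * (1 + eps)); last by ring.
by rewrite lamd mul1r; move: eps_le; lra.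
Qed.

Let Ex_normu_le : Ex (fun G => `|u G|) <= 3.
Proof.
apply: (@le_trans _ _ (Ex (fun G => 1 + u G ^+ 2))).
  apply: ler_Ex => // G; rewrite -(@real_normK _ (u G)) ?num_real//.
  move: (normr_ge0 (u G)); move: (`|u G|) => x x0.
  by have := sqr_ge0 (x - 1); rewrite !expr2; lra.
by rewrite ExD Ex_cst//; move: Ex_u2_le; move: (Ex _) => x; lra.
Qed.

(** Take h(j) = 1{j > m}: the identity compares lam P(W = m) with E[(W - lam) 1{W > m}], up to eps
    lam. The latter is at most E|W - lam| <= 3 sqrt(lam). This controls the jump term of
    [normal_stein_taylor]. *)
Lemma concentration m : Ex (fun G => (W G == m)%:R) <= 3 * d + eps.
Proof.
have /stein_id : forall j, `|(m < j.+1)%N%:R - (m < j)%N%:R| <= 1 :> R.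
  move=> j; rewrite ltnS; case: (ltngtP m j) => _;
  by rewrite ?subrr ?subr0 ?normr0 ?normr1.
rewrite mulr1 -ExZ distrC -ExB => h.
have e1 : (fun G => lam * (m < (W G).+1)%N%:R - (W G)%:R * (m < W G)%N%:R) =1
    (fun G => lam * (W G == m)%:R - ((W G)%:R - lam) * (m < W G)%N%:R).
  move=> G; rewrite ltnS (leq_eqVlt m) (eq_sym m); case: eqP => [->|_] /=.
    by rewrite ltnn !mulr0.
  by ring.
rewrite (eq_Ex w e1) ExB ExZ in h.
have h2 : Ex (fun G => ((W G)%:R - lam) * (m < W G)%N%:R) <= 3 * (lam * d).
  apply: (@le_trans _ _ (Ex (fun G => (lam * d) * `|u G|))).
    apply: ler_Ex => // G; have -> : (W G)%:R - lam = lam * d * u G.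
      by rewrite /u mulrCA lamd mulr1.
    have ld : 0 <= lam * d by rewrite mulr_ge0// ltW.
    rewrite -[leLHS]mulrA ler_wpM2l//; case: (m < W G)%N; rewrite ?mulr1 ?mulr0//.
    exact: ler_norm.
  by rewrite ExZ mulrC ler_wpM2r// mulr_ge0// ltW.
rewrite -(ler_pM2l lam_gt0).
by move: h; rewrite ler_norml => /andP[_]; move: h2; lra.
Qed.

(** With lam d^2 = 1, the identity multiplied by d gives the claim. Here 6 eps = 2 eps + 4 eps, from
    the Stein error with delta = 2d and from the jump; 18 = 6 + 12, from 2 E|u| <= 6 in the Taylor
    remainder and from 4 times the 3d of [concentration]. *)
Lemma clt_scaled z : `|Ex (fun G => (u G <= z)%R%:R) - Phi z|
  <= 6 * eps + (stein_ub R + 18) * d.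
Proof.
pose f := normal_stein z.
pose h (j : nat) := f ((j%:R - lam) * d).
have hS j : h j.+1 = f ((j%:R - lam) * d + d).
  by rewrite /h -natr1 -[in RHS](mul1r d) mulrA mulr1 -mulrDl addrAC.
have /stein_id : forall j, `|h j.+1 - h j| <= 2 * d.
  move=> j; rewrite hS; apply: le_trans (normal_stein_lip _ _) _.
    by rewrite lerDl ltW.
  by rewrite [_ + d]addrC addrK.
rewrite -ExZ distrC -ExB => h1.
pose r G := h (W G).+1 - h (W G) - d * (u G * f (u G) + ((u G <= z)%R%:R - Phi z)).
have e1 : (fun G => lam * h (W G).+1 - (W G)%:R * h (W G)) =1
    (fun G => lam * d * ((u G <= z)%R%:R - Phi z) + lam * r G).
  move=> G; rewrite /r -[h (W G)]/(f (u G)).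
  have -> : (W G)%:R = lam + lam * d * u G by rewrite /u mulrCA lamd mulr1 addrC subrK.
  by ring.
rewrite (eq_Ex w e1) ExD !ExZ ExB Ex_cst// in h1.
have rG G : `|r G| <= d ^+ 2 * (stein_ub R + 2 * `|u G|) +
    4 * d * ((u G <= z)%R && (z < u G + d)%R)%:R.
  by rewrite /r hS; apply: normal_stein_taylor; exact: ltW.
have conc : Ex (fun G => ((u G <= z)%R && (z < u G + d)%R)%:R) <= 3 * d + eps.
  have eps0 : 0 <= eps.
    have := le_trans (normr_ge0 _) variance_approx.
    by rewrite pmulr_lge0.
  (* The values of u lie on a lattice of mesh d, so the condition u <= z < u + d determines W: the
     event has the form W = m or is empty. *)
  case: (pselect (exists G, (u G <= z)%R && (z < u G + d)%R)) => [[G0 /andP[a0 b0]]|nG].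
    apply: le_trans (concentration (W G0)); apply: ler_Ex => // G.
    case: (boolP (_ && _)) => // /andP[a b]; rewrite ler_nat lt0b.
    have uE G' : u G' + d = ((W G').+1%:R - lam) * d.
      by rewrite /u -natr1; ring.
    have : u G < u G0 + d by apply: le_lt_trans b0.
    rewrite uE ltr_pM2r// ltrD2r ltr_nat ltnS => l1.
    have : u G0 < u G + d by apply: le_lt_trans b.
    rewrite uE ltr_pM2r// ltrD2r ltr_nat ltnS => l2.
    by rewrite eqn_leq l1 l2.
  have e0 : (fun G => ((u G <= z)%R && (z < u G + d)%R)%:R) =1 (fun=> 0 : R).
    by move=> G; case: (boolP (_ && _)) => // h0; case: nG; exists G.
  by rewrite (eq_Ex w e0) Ex_cst// addr_ge0// mulr_ge0// ltW.
have rE : lam * d * `|Ex r| <= d * (stein_ub R + 6) * (lam * d * d) +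
     4 * (lam * d * d) * (3 * d + eps).
  have ld : 0 <= lam * d by rewrite mulr_ge0// ltW.
  rewrite [leRHS](_ : _ = (lam * d) * (d ^+ 2 * (stein_ub R + 2 * 3) + 4 * d * (3 * d + eps))); last by ring.
  apply: ler_wpM2l => //; apply: le_trans (ler_norm_Ex _ _) _ => //.
  apply: le_trans (ler_Ex w_ge0 rG) _.
  rewrite ExD !ExZ ExD Ex_cst// ExZ; apply: lerD.
    by rewrite ler_wpM2l ?sqr_ge0// lerD2l ler_wpM2l.
  by rewrite ler_wpM2l// mulr_ge0// ltW.
rewrite lamd !mulr1 in rE.
have h2 : lam * d * `|Ex (fun G => (u G <= z)%R%:R) - Phi z| <=
    eps * (2 * d) * lam + lam * `|Ex r|.
  have ld : 0 < lam * d by rewrite mulr_gt0.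
  have n1 x : lam * d * `|x| = `|lam * d * x| by rewrite normrM (gtr0_norm ld).
  have n2 x : lam * `|x| = `|lam * x| by rewrite normrM (gtr0_norm lam_gt0).
  rewrite n1 n2 -(addrK (lam * Ex r) (lam * d * _)).
  by apply: le_trans (ler_normB _ _) _; rewrite lerD2r.
have h3 := ler_wpM2r (ltW d_gt0) h2.
move: h3 rE; move: (`|Ex r|) (`|_ - Phi z|) => a b.
have -> : lam * d * b * d = (lam * d * d) * b by ring.
have -> : (eps * (2 * d) * lam + lam * a) * d = 2 * eps * (lam * d * d) + lam * d * a by ring.
by rewrite lamd; lra.
Qed.

(** Changing the scale from sqrt(lam) to the standard deviation multiplies the threshold by s with
    |s - 1| <= |s^2 - 1| <= eps; [Phi_scale] absorbs this. *)
Lemma clt_standardized z :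
  `|Ex (fun G => ((Num.sqrt V)^-1 * ((W G)%:R - lam) <= z)%R%:R) - Phi z|
  <= (6 + 2 * normal_peak 1) * eps + (stein_ub R + 18) * d.
Proof.
have /andP[V1 V2] := V_bounds.
have V_gt0 : 0 < V by apply: lt_le_trans V1; rewrite mulr_gt0//; move: eps_le; lra.
pose s := Num.sqrt V * d.
have sV : 0 < Num.sqrt V by rewrite sqrtr_gt0.
have s_gt0 : 0 < s by rewrite mulr_gt0.
have s2 : s ^+ 2 = V * d ^+ 2 by rewrite exprMn sqr_sqrtr// ltW.
have d2 : lam * d ^+ 2 = 1 by rewrite expr2 mulrA.
have s2_bound : `|s ^+ 2 - 1| <= eps.
  rewrite s2 -d2 -mulrBl normrM (@ger0_norm _ (d ^+ 2)) ?sqr_ge0//.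
  apply: le_trans (ler_wpM2r (sqr_ge0 d) variance_approx) _.
  by rewrite -mulrA d2 mulr1.
have s_bound : `|s - 1| <= eps.
  apply: le_trans s2_bound; rewrite (_ : s ^+ 2 - 1 = (s - 1) * (s + 1)); last by ring.
  by rewrite normrM ler_peMr// (@gtr0_norm _ (s + 1)); lra.
have s_half : 2^-1 <= s.
  by move: s_bound eps_le; rewrite ler_norml => /andP[]; lra.
have e1 : (fun G => ((Num.sqrt V)^-1 * ((W G)%:R - lam) <= z)%R%:R) =1
    (fun G => (u G <= z * s)%R%:R : R).
  move=> G; rewrite /u /s mulrA ler_pM2r// [_^-1 * _]mulrC ler_pdivrMr//.
rewrite (eq_Ex w e1) -(subrKA (Phi (z * s))); apply: le_trans (ler_normD _ _) _.
have h1 := clt_scaled (z * s); have h2 := Phi_scale z s_half.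
have h3 : 2 * normal_peak 1 * `|s - 1| <= 2 * normal_peak 1 * eps.
  by rewrite ler_wpM2l// mulr_ge0// ltW// normal_peak1_gt0.
lra.
Qed.

End stein_consequences.

(** * Random geometric graphs as weighted graphs *)

Section independence.
Local Open Scope classical_set_scope.
Context {R : realType} {dO : measure_display} {Omega : measurableType dO}.
Variable P : probability Omega R.

(** Uniqueness of measures on a pi-system, used twice: first with A in [G] fixed, then with B in the
    sigma-algebra of [H] fixed. P restricted to one event is compared with P scaled by its mass. *)
Lemma independent_sigma_algebras (G H : set (set Omega)) :
  G `<=` measurable -> H `<=` measurable -> setI_closed G -> setI_closed H ->
  G setT -> H setT ->
  (forall A B, G A -> H B -> P (A `&` B) = (P A * P B)%E) ->
  forall A B, <<s G >> A -> <<s H >> B -> P (A `&` B) = (P A * P B)%E.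
Proof.
move=> Gm Hm GI HI GT HT GH.
have cover : \bigcup_(k : nat) [set: Omega] = setT.
  by apply/seteqP; split => // x _; exists 0%N.
have sHm := smallest_sub (@sigma_algebra_measurable _ Omega) Hm.
have scaleE A (mA : measurable A) B : mscale (NngNum (fine_ge0 (measure_ge0 P A))) P B
    = (P A * P B)%E.
  by rewrite /mscale /= fineK// fin_num_measure.
have half A B : G A -> <<s H >> B -> P (A `&` B) = (P A * P B)%E.
  move=> GA; have mA := Gm _ GA; rewrite -scaleE// setIC.
  apply: (@g_sigma_algebra_measure_unique _ _ _ H Hm (fun=> setT) (fun=> HT) cover
    (mrestr P mA) _ HI) => [B' HB'|_].
    by rewrite -[LHS]/(P (B' `&` A)) setIC GH// -scaleE.
  by rewrite /= /mrestr setTI ltey_eq fin_num_measure.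
move=> A B GA HB; have mB := sHm _ HB; rewrite muleC -scaleE//.
move: A GA; apply: (@g_sigma_algebra_measure_unique _ _ _ G Gm (fun=> setT) (fun=> GT) cover
    (mrestr P mB) _ GI) => [A' GA'|_].
  by rewrite -[LHS]/(P (A' `&` B)) half// muleC -scaleE.
by rewrite /= /mrestr setTI ltey_eq fin_num_measure.
Qed.

Context {dT : measure_display} {T : measurableType dT}.
Variable X : nat -> {RV P >-> T}.
Hypothesis Xindep : mutually_independent P X.
Implicit Types A B : {fset nat}.

Definition cylinders A : set (set Omega) :=
  [set E | exists2 C : nat -> set T, (forall i, measurable (C i)) &
    E = \bigcap_(i in [set` A]) (X i @^-1` C i)].

Lemma cylinders_measurable A : cylinders A `<=` measurable.
Proof.
move=> _ [C mC ->]; apply: fin_bigcap_measurable; first exact: finite_fset.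
by move=> i _; exact: measurable_funPTI.
Qed.

Lemma cylindersT A : cylinders A setT.
Proof.
by exists (fun=> setT) => //; apply/seteqP; split.
Qed.

Lemma cylindersI A : setI_closed (cylinders A).
Proof.
move=> _ _ [C mC ->] [C' mC' ->]; exists (fun i => C i `&` C' i).
  by move=> i; exact: measurableI.
apply/seteqP; split => [w [Cw C'w] i iA|w h]; first by split; [exact: Cw|exact: C'w].
by split => i iA; have [] := h i iA.
Qed.

Lemma cylinders_indep A B E F : [disjoint A & B]%fset -> cylinders A E -> cylinders B F ->
  P (E `&` F) = (P E * P F)%E.
Proof.
move=> AB [C mC ->] [C' mC' ->].
pose D i := if i \in A then C i else C' i.
have DA i : i \in A -> D i = C i by rewrite /D => ->.
have DB i : i \in B -> D i = C' i.
  move=> iB; rewrite /D; case: ifPn => // iA.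
  by have /fdisjointP/(_ i iA) := AB; rewrite iB.
rewrite (Xindep A mC) (Xindep B mC').
have -> : \bigcap_(i in [set` A]) (X i @^-1` C i) `&`
    \bigcap_(i in [set` B]) (X i @^-1` C' i) =
    \bigcap_(i in [set` (A `|` B)%fset]) (X i @^-1` D i).
  apply/seteqP; split => [w [CA CB] i /=|w CD].
    rewrite in_fsetU => /orP[iA|iB]; first by rewrite /preimage /= DA//; exact: CA.
    by rewrite /preimage /= DB//; exact: CB.
  split => i /= iA.
    by rewrite -DA//; apply: CD; rewrite /= in_fsetU iA.
  by rewrite -DB//; apply: CD; rewrite /= in_fsetU iA orbT.
rewrite (Xindep (A `|` B)%fset (A := D)); last by move=> i; rewrite /D; case: ifP.
have pAB : perm_eq (A `|` B)%fset (enum_fset A ++ enum_fset B).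
  apply: uniq_perm; [exact: fset_uniq| |by move=> i; rewrite in_fsetU mem_cat].
  rewrite cat_uniq !fset_uniq andbT /=; apply/hasPn => i iB.
  by apply/negP => iA; have /fdisjointP/(_ i iA) := AB; rewrite iB.
rewrite (perm_big _ pAB) big_cat /=; congr (_ * _)%E.
  by apply: eq_big_seq => i iA; rewrite DA.
by apply: eq_big_seq => i iB; rewrite DB.
Qed.

Definition sigma_cyl A := <<s cylinders A >>.

Lemma sigma_cyl_indep A B E F : [disjoint A & B]%fset -> sigma_cyl A E -> sigma_cyl B F ->
  P (E `&` F) = (P E * P F)%E.
Proof.
move=> AB; apply: independent_sigma_algebras => //.
- exact: cylinders_measurable.
- exact: cylinders_measurable.
- exact: cylindersI.
- exact: cylindersI.
- exact: cylindersT.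
- exact: cylindersT.
- by move=> E' F'; exact: cylinders_indep.
Qed.

Lemma sigma_cyl_measurable A : sigma_cyl A `<=` measurable.
Proof. exact: (smallest_sub (@sigma_algebra_measurable _ Omega) (@cylinders_measurable A)). Qed.

Lemma sigma_cyl_preimage A i (C : set T) : i \in A -> measurable C ->
  sigma_cyl A (X i @^-1` C).
Proof.
move=> iA mC; apply: sub_sigma_algebra.
exists (fun j => if j == i then C else setT); first by move=> j; case: ifP.
apply/seteqP; split => [w Cw j jA|w h] /=; last by have := h i iA; rewrite eqxx.
by rewrite /preimage; case: eqP => [->|].
Qed.

Let OmegaA A := g_sigma_algebraType (cylinders A).

Lemma measurable_fun_sigma_cyl A i : i \in A ->
  measurable_fun [set: OmegaA A] (X i : OmegaA A -> T).
Proof. by move=> iA _ C mC; rewrite setTI; exact: sigma_cyl_preimage. Qed.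

(* Fubini for the law of ((X i) for i in A, X b). *)
Lemma fresh_relation_le A a b (S : set (T * T)) (rho : R) E :
  measurable S -> a \in A -> b \notin A ->
  (forall x, (P (X b @^-1` xsection S x) <= rho%:E)%E) ->
  sigma_cyl A E ->
  (P (E `&` [set w | S (X a w, X b w)]) <= rho%:E * P E)%E.
Proof.
move=> mS aA bA Sle sE.
(* The identity into Omega with the smaller sigma-algebra acts as one random element that records
   all X i with i in [A]; by independence its joint law with X b is a product. *)
pose idA : Omega -> OmegaA A := fun w => w.
have midA : measurable_fun setT idA.
  by move=> _ C sC; rewrite setTI; exact: sigma_cyl_measurable sC.
pose idA' : {RV P >-> OmegaA A} := mfun_Sub (mem_set midA).
have mpair : measurable_fun setT (fun w => (idA w, X b w) : OmegaA A * T).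
  by apply: measurable_fun_pair => //; exact: measurable_funPT.
pose pr : {RV P >-> (OmegaA A * T)%type} := mfun_Sub (mem_set mpair).
have law_pr Q : measurable Q ->
    (distribution P idA' \x distribution P (X b))%E Q = distribution P pr Q.
  apply: product_measure_unique => C D mC mD.
  rewrite /distribution /pushforward -[LHS]/(P (idA' @^-1` C `&` X b @^-1` D)).
  apply: (@sigma_cyl_indep A [fset b]%fset) => //.
    by rewrite fdisjointX1.
  by apply: sigma_cyl_preimage => //; rewrite inE.
pose Q : set (OmegaA A * T) := (E `*` setT) `&` [set p | S (X a p.1, p.2)].
have mQ : measurable Q.
  apply: measurableI; first exact: measurableX.
  have mf : measurable_fun setT (fun p : OmegaA A * T => (X a p.1, p.2)).
    apply: measurable_fun_pair => //.
    by apply: measurableT_comp => //; exact: measurable_fun_sigma_cyl.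
  by rewrite -[X in measurable X]setTI; exact: mf.
have -> : P (E `&` [set w | S (X a w, X b w)]) = distribution P pr Q.
  rewrite /distribution /pushforward; congr (P _); apply/seteqP; split => w //=.
    by move=> [].
  by move=> [[]].
rewrite -law_pr// /product_measure1.
have mE : measurable (E : set (OmegaA A)) := sE.
have rho0 : 0 <= rho by rewrite -lee_fin; apply: le_trans (Sle point).
have -> : (rho%:E * P E)%E =
    (\int[distribution P idA']_w (rho%:E * (\1_(E : set (OmegaA A)) w)%:E))%E.
  rewrite ge0_integralZl//; first by rewrite integral_indic// setIT.
  by apply/measurable_EFinP; exact: measurable_indic.
apply: ge0_le_integral => //.
- exact: measurable_fun_xsection.
- apply/measurable_EFinP; apply: measurable_funM => //.
move=> w _; rewrite indicE; case: (boolP (w \in E)) => [/set_mem wE|wE].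
  rewrite mule1; apply: le_trans (Sle (X a w)); rewrite /= /distribution /pushforward.
  apply: le_measure; rewrite ?inE.
  - by apply: measurable_funPTI; exact: measurable_xsection.
  - by apply: measurable_funPTI; exact: measurable_xsection.
  by move=> w' /=; rewrite /xsection /= !inE => -[_].
have Q0 : xsection Q w = set0.
  apply/seteqP; split => // y; rewrite /xsection /= inE => -[[wE' _] _].
  by rewrite mem_set in wE.
by rewrite /= Q0 measure0 mule0.
Qed.

End independence.

(** * Exchangeability of an independent, identically distributed sample *)

Section exchangeability.
Local Open Scope classical_set_scope.
Context {R : realType} {dO : measure_display} {Omega : measurableType dO}.
Variable P : probability Omega R.
Context {dT : measure_display} {T : measurableType dT}.
Variable X : nat -> {RV P >-> T}.
Hypothesis Xindep : mutually_independent P X.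
Hypothesis Xid : forall i j C, measurable C -> P (X i @^-1` C) = P (X j @^-1` C).
Variable n : nat.

Definition sample_tuple (i : 'I_n -> nat) (w : Omega) : n.-tuple T :=
  [tuple X (i j) w | j < n].

Lemma measurable_sample_tuple i : measurable_fun setT (sample_tuple i).
Proof.
apply/measurable_fun_tnthP => j.
rewrite (_ : _ \o _ = X (i j) :> (Omega -> T)); first exact: measurable_funPT.
by apply/funext => w /=; rewrite tnth_mktuple.
Qed.

Definition boxes : set (set (n.-tuple T)) :=
  [set E | exists2 C : 'I_n -> set T, (forall i, measurable (C i)) &
    E = [set x | forall i, C i (tnth x i)]].

Lemma measurable_boxes : measurable = <<s boxes >>.
Proof.
apply/seteqP; split.
  apply: smallest_sub; first exact: smallest_sigma_algebra.
  move=> E; rewrite -bigcup_seq => -[i _ [C mC <-]]; apply: sub_sigma_algebra.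
  exists (fun j => if j == i then C else setT); first by move=> j; case: ifP.
  apply/seteqP; split => [x [_ Cx] j|x h]; first by case: eqP => [->|].
  by split => //; have := h i; rewrite eqxx.
apply: smallest_sub; first exact: sigma_algebra_measurable.
move=> _ [C mC ->]; rewrite [X in measurable X](_ : _ =
    \bigcap_(i in [set: 'I_n]) ((@tnth n _)^~ i @^-1` C i)); last first.
  by apply/seteqP; split => [x Cx i _|x Cx i]; exact: Cx.
apply: fin_bigcap_measurable => // i _.
by rewrite -[X in measurable X]setTI; exact: measurable_tnth.
Qed.

Lemma sample_tuple_box i C : injective i -> (forall j, measurable (C j)) ->
  P (sample_tuple i @^-1` [set x | forall j, C j (tnth x j)]) =
  (\prod_(j < n) P (X 0 @^-1` C j))%E.
Proof.
move=> i_inj mC.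
(* Extends the sets along the injection [i] to a family indexed by all naturals, as mutual
   independence requires; indices outside the image get the full set. *)
pose D k := if [pick j | i j == k] is Some j then C j else setT.
have Di j : D (i j) = C j.
  rewrite /D; case: pickP => [j' /eqP/i_inj -> //|/(_ j)].
  by rewrite eqxx.
have mD k : measurable (D k) by rewrite /D; case: pickP.
have := Xindep [fset i j | j in 'I_n]%fset mD.
have -> : \bigcap_(k in [set` [fset i j | j in 'I_n]%fset]) (X k @^-1` D k) =
    sample_tuple i @^-1` [set x | forall j, C j (tnth x j)].
  apply/seteqP; split => [w Dw j /=|w Cw _ /= /imfsetP[j _ ->]].
    rewrite tnth_mktuple -Di; apply: Dw => /=.
    by apply/imfsetP; exists j.
  by have := Cw j; rewrite /= tnth_mktuple -Di.
move=> ->; have pm : perm_eq [fset i j | j in 'I_n]%fset (map i (enum 'I_n)).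
  apply: uniq_perm; [exact: fset_uniq|by rewrite map_inj_uniq ?enum_uniq|].
  move=> k; apply/imfsetP/mapP => -[j _ ->]; exists j => //; by rewrite mem_enum.
rewrite (perm_big _ pm) big_map big_enum /=; apply: eq_bigr => j _.
by rewrite Di; exact: Xid.
Qed.

Lemma sample_tuple_law i j S : injective i -> injective j -> measurable S ->
  P (sample_tuple i @^-1` S) = P (sample_tuple j @^-1` S).
Proof.
move=> i_inj j_inj mS.
pose Yi : {RV P >-> n.-tuple T} := mfun_Sub (mem_set (measurable_sample_tuple i)).
pose Yj : {RV P >-> n.-tuple T} := mfun_Sub (mem_set (measurable_sample_tuple j)).
have boxT : boxes setT.
  by exists (fun=> setT) => //; apply/seteqP; split.
apply: (@measure_unique _ _ _ boxes (fun=> setT) measurable_boxes _ (fun=> boxT) _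
  (distribution P Yi) (distribution P Yj)) => //.
- move=> _ _ [C mC ->] [C' mC' ->]; exists (fun i => C i `&` C' i).
    by move=> k; exact: measurableI.
  by apply/seteqP; split => [x [Cx C'x] k|x h]; [split|split => k; have [] := h k].
- by apply/seteqP; split => // x _; exists 0%N.
- move=> _ [C mC ->]; rewrite /distribution /pushforward.
  by rewrite [LHS]sample_tuple_box// [RHS]sample_tuple_box.
- by move=> _; rewrite ltey_eq fin_num_measure.
Qed.

End exchangeability.

Lemma finite_event_measurable d (O : measurableType d) (T : finType) (g : O -> graph T)
    (Q : pred (graph T)) :
  (forall p, measurable [set w | g w p]%classic) -> measurable [set w | Q (g w)]%classic.
Proof.
move=> mg.
rewrite [X in measurable X](_ : _ = \bigcup_(G in [set` Q])
    \bigcap_(p in [set: T * T]) [set w | g w p = G p])%classic; last first.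
  apply/seteqP; split => [w /= Qw|w [G /= QG gG]].
    by exists (g w).
  have -> : g w = G by apply/ffunP => p; exact: gG.
  exact: QG.
apply: fin_bigcup_measurable; first exact: finite_finset.
move=> G _; apply: fin_bigcap_measurable => // p _.
case: (G p); first exact: mg.
rewrite [X in measurable X](_ : _ = ~` [set w | g w p])%classic; first exact: measurableC.
by apply/seteqP; split => w /=; case: (g w p).
Qed.

Section point_graph.
Local Open Scope classical_set_scope.
Context {R : realType} {d : nat}.
Implicit Types (x y : Rd R d) (r : R).

Lemma eucl_dist_sym x y : eucl_dist x y = eucl_dist y x.
Proof.
rewrite /eucl_dist; congr Num.sqrt; apply: eq_bigr => i _.
by rewrite -sqrrN opprB.
Qed.

Lemma eucl_dist0 x : eucl_dist x x = 0.
Proof.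
by rewrite /eucl_dist big1 ?sqrtr0// => i _; rewrite subrr expr0n.
Qed.

Definition close_pairs r : set (Rd R d * Rd R d) := [set p | eucl_dist p.1 p.2 <= r].

Lemma measurable_close_pairs r : measurable (close_pairs r).
Proof.
have mdist : measurable_fun setT (fun p : Rd R d * Rd R d => eucl_dist p.1 p.2).
  apply: (@measurableT_comp _ _ _ _ _ _ (@Num.sqrt R)).
    by apply: continuous_measurable_fun; exact: sqrt_continuous.
  apply: measurable_sum => i; apply: measurable_funX; apply: measurable_funB.
    by apply: (measurableT_comp (measurable_tnth i)); exact: measurable_fst.
  by apply: (measurableT_comp (measurable_tnth i)); exact: measurable_snd.
rewrite -[X in measurable X]setTI.
rewrite (_ : close_pairs r = (fun p => eucl_dist p.1 p.2) @^-1` `]-oo, r]).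
  by apply: mdist => //; exact: measurable_itv.
by apply/seteqP; split => p; rewrite /close_pairs /preimage /= in_itv.
Qed.

Definition point_graph (T : finType) r (x : T -> Rd R d) : graph T :=
  [ffun p => eucl_dist (x p.1) (x p.2) <= r].

Lemma adj_point_graph (T : finType) r (x : T -> Rd R d) a b :
  adj (point_graph r x) a b = (eucl_dist (x a) (x b) <= r).
Proof. by rewrite /adj !ffunE /= (eucl_dist_sym (x b)) orbb. Qed.

Lemma reindex_point_graph (T T' : finType) (j : T -> T') r (x : T' -> Rd R d) :
  reindex_graph j (point_graph r x) = point_graph r (x \o j).
Proof. by apply/ffunP => p; rewrite !ffunE. Qed.

End point_graph.

Section geometric_random_graph.
Local Open Scope classical_set_scope.
Context {R : realType} {d : nat} {dO : measure_display} {Omega : measurableType dO}.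
Variable P : probability Omega R.
Variable X : nat -> {RV P >-> Rd R d}.
Hypothesis Xindep : mutually_independent P X.
Hypothesis Xid : forall i j C, measurable C -> P (X i @^-1` C) = P (X j @^-1` C).
Variable r : R.

Section fixed_vertices.
Variables (T : finType) (i : T -> nat).

Definition sample_graph (w : Omega) : graph T := point_graph r (fun a => X (i a) w).

Definition graph_weight (G : graph T) : R := fine (P [set w | sample_graph w = G]).

Local Notation Ex := (Ex graph_weight).

Lemma measurable_sample_graph (Q : pred (graph T)) :
  measurable [set w | Q (sample_graph w)].
Proof.
apply: finite_event_measurable => p.
have mf : measurable_fun setT (fun w => (X (i p.1) w, X (i p.2) w)).
  by apply: measurable_fun_pair; exact: measurable_funPT.
rewrite -[X in measurable X]setTI (_ : [set w | _] =
    (fun w => (X (i p.1) w, X (i p.2) w)) @^-1` close_pairs r).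
  by apply: mf => //; exact: measurable_close_pairs.
by apply/seteqP; split => w /=; rewrite /preimage /close_pairs /= ffunE.
Qed.

Let measurable_sample_graph1 G : measurable [set w | sample_graph w = G].
Proof.
rewrite (_ : mkset _ = [set w | pred1 G (sample_graph w)]).
  exact: (measurable_sample_graph (pred1 G)).
by apply/seteqP; split => w /= /eqP.
Qed.

Lemma integral_sample_graph (F : graph T -> R) : (forall G, 0 <= F G) ->
  (\int[P]_w (F (sample_graph w))%:E = (Ex F)%:E)%E.
Proof.
move=> F0.
have FE w : (F (sample_graph w))%:E =
    (\sum_(G : graph T) (F G)%:E * (\1_[set w | sample_graph w = G] w)%:E)%E.
  rewrite (bigD1 (sample_graph w))//= big1 ?adde0.
    by rewrite indicE mem_set// mule1.
  move=> G nG; rewrite indicE memNset ?mule0// => /= GE.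
  by rewrite GE eqxx in nG.
under eq_integral do rewrite FE.
rewrite ge0_integral_sum//; last 2 first.
- move=> G; apply/measurable_EFinP; apply: measurable_funM => //.
- by move=> G w _; rewrite mule_ge0// lee_fin.
rewrite /Ex -sumEFin; apply: eq_bigr => G _.
rewrite ge0_integralZl//; last 2 first.
- by apply/measurable_EFinP; exact: measurable_indic.
- by rewrite lee_fin.
rewrite integral_indic// setIT EFinM muleC /graph_weight fineK//.
exact: fin_num_measure.
Qed.

Lemma prob_sample_graph (Q : pred (graph T)) :
  P [set w | Q (sample_graph w)] = (Ex (fun G => (Q G)%:R))%:E.
Proof.
rewrite -integral_sample_graph//.
have mQ := measurable_sample_graph Q.
rewrite -[X in P X]setIT -(integral_indic P measurableT mQ).
apply: eq_integral => w _; rewrite indicE.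
suff -> : (w \in [set w | Q (sample_graph w)]) = Q (sample_graph w) by [].
by apply/idP/idP => [/set_mem//|h]; rewrite mem_set.
Qed.

Lemma graph_weight_ge0 G : 0 <= graph_weight G.
Proof. exact: fine_ge0. Qed.

Lemma graph_weight_sum : \sum_G graph_weight G = 1.
Proof.
have := prob_sample_graph predT; rewrite [X in P X](_ : _ = setT); last first.
  by apply/seteqP.
rewrite probability_setT => -[->]; rewrite /Ex.
by apply: eq_bigr => G _; rewrite mulr1.
Qed.

(** A canonical representative of the subgraph on [A]: a function local on [A] takes the same value
    on it as on [G], and its level sets lie in the sigma-algebra of the points indexed by [A]. *)
Definition restrict_graph (A : {set T}) (G : graph T) : graph T :=
  [ffun p => [&& p.1 \in A, p.2 \in A & adj G p.1 p.2]].

Lemma local_on_restrict (A : {set T}) (F : graph T -> R) G : local_on A F ->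
  F (restrict_graph A G) = F G.
Proof.
move=> lF; apply: lF => a b aA bA.
by rewrite /adj !ffunE /= aA bA /= (adj_sym G b a) orbb.
Qed.

Lemma sigma_cyl_restrict (A : {set T}) H :
  sigma_cyl X [fset i a | a in A]%fset [set w | restrict_graph A (sample_graph w) = H].
Proof.
pose OA := g_sigma_algebraType (cylinders X [fset i a | a in A]%fset).
suff : measurable ([set w | restrict_graph A (sample_graph w) == H] : set OA).
  rewrite (_ : mkset _ = [set w | restrict_graph A (sample_graph w) = H]); first by [].
  by apply/seteqP; split => w /= /eqP.
apply: (@finite_event_measurable _ OA _ (fun w => restrict_graph A (sample_graph w)) (pred1 H)).
move=> [a b]; case: (boolP ((a \in A) && (b \in A))) => [/andP[aA bA]|nab]; last first.
  rewrite (_ : mkset _ = set0); first exact: measurable0.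
  by apply/seteqP; split => w //=; rewrite ffunE /= andbA (negbTE nab).
have mf : measurable_fun setT (fun w : OA => (X (i a) w, X (i b) w)).
  apply: measurable_fun_pair; apply: measurable_fun_sigma_cyl.
    by apply/imfsetP; exists a.
  by apply/imfsetP; exists b.
rewrite -[X in measurable X]setTI (_ : mkset _ =
    (fun w => (X (i a) w, X (i b) w)) @^-1` close_pairs r).
  by apply: mf => //; exact: measurable_close_pairs.
by apply/seteqP; split => w /=; rewrite /preimage /close_pairs ffunE /= aA bA /= adj_point_graph.
Qed.

(** Conditioning on the subgraph on [A], written as a finite sum; it reduces the adjacency and
    independence properties to single events. *)
Lemma Ex_restrict (A : {set T}) (F Y : graph T -> R) : local_on A F ->
  Ex (fun G => F G * Y G) = \sum_H F H * Ex (fun G => (restrict_graph A G == H)%:R * Y G).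
Proof.
move=> lF; under [in RHS]eq_bigr do rewrite -ExZ.
rewrite -Ex_sum; apply: eq_Ex => G; rewrite (bigD1 (restrict_graph A G))//=.
rewrite eqxx mul1r local_on_restrict// big1 ?addr0// => H HG.
by rewrite eq_sym (negbTE HG) mul0r mulr0.
Qed.

Hypothesis i_inj : injective i.

Let vertices (A : {set T}) := [fset i a | a in A]%fset.

Let mem_vertices (A : {set T}) a : (i a \in vertices A) = (a \in A).
Proof.
by apply/imfsetP/idP => [[b bA /i_inj ->]//|aA]; exists a.
Qed.

Lemma Ex_adj_sample (rho : R) (A : {set T}) (F : graph T -> R) a b :
  (forall j x, P (X j @^-1` xsection (close_pairs r) x) <= rho%:E)%E ->
  local_on A F -> (forall G, 0 <= F G) -> a \in A -> b \notin A ->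
  Ex (fun G => F G * (adj G a b)%:R) <= rho * Ex F.
Proof.
move=> rhoP lF F0 aA bA.
have e1 : F =1 (fun G => F G * 1) by move=> G; rewrite mulr1.
rewrite (Ex_restrict _ lF) (eq_Ex _ e1) (Ex_restrict _ lF) mulr_sumr.
apply: ler_sum => H _; rewrite mulrCA ler_wpM2l//.
have := @fresh_relation_le _ _ _ P _ _ X Xindep (vertices A) (i a) (i b) (close_pairs r) rho
  [set w | restrict_graph A (sample_graph w) = H] (measurable_close_pairs r).
rewrite !mem_vertices => /(_ aA bA (rhoP _) (@sigma_cyl_restrict A H)).
have -> : [set w | restrict_graph A (sample_graph w) = H] `&`
    [set w | close_pairs r (X (i a) w, X (i b) w)] =
    [set w | (restrict_graph A (sample_graph w) == H) && adj (sample_graph w) a b].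
  apply/seteqP; split => w /=; rewrite adj_point_graph /close_pairs /=.
    by move=> [/eqP-> ->].
  by move=> /andP[/eqP].
rewrite (_ : [set w | restrict_graph A (sample_graph w) = H] =
    [set w | restrict_graph A (sample_graph w) == H]); last first.
  by apply/seteqP; split => w /= /eqP.
rewrite (prob_sample_graph (fun G => (restrict_graph A G == H) && adj G a b)).
rewrite (prob_sample_graph (fun G => restrict_graph A G == H)) -EFinM lee_fin.
have e2 : (fun G => (restrict_graph A G == H)%:R * 1 : R) =1 (fun G => (restrict_graph A G == H)%:R).
  by move=> G; rewrite mulr1.
have e3 : (fun G => (restrict_graph A G == H)%:R * (adj G a b)%:R : R) =1
    (fun G => ((restrict_graph A G == H) && adj G a b)%:R).
  by move=> G; rewrite -natrM mulnb.
by rewrite (eq_Ex _ e2) (eq_Ex _ e3).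
Qed.

Lemma Ex_indep_sample (A B : {set T}) (F H : graph T -> R) :
  fintype.disjoint (mem A) (mem B) -> local_on A F -> local_on B H ->
  Ex (fun G => F G * H G) = Ex F * Ex H.
Proof.
move=> AB lF lH.
have eF : F =1 (fun G => F G * 1) by move=> G; rewrite mulr1.
have eH : H =1 (fun G => H G * 1) by move=> G; rewrite mulr1.
rewrite (Ex_restrict _ lF) (eq_Ex _ eF) (Ex_restrict _ lF) mulr_suml.
apply: eq_bigr => f _; rewrite -mulrA; congr (_ * _).
have e1 : (fun G => (restrict_graph A G == f)%:R * H G) =1
    (fun G => H G * (restrict_graph A G == f)%:R).
  by move=> G; rewrite mulrC.
rewrite (eq_Ex _ e1) (Ex_restrict _ lH) (eq_Ex _ eH) (Ex_restrict _ lH) mulr_sumr.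
apply: eq_bigr => h _; rewrite mulrCA; congr (_ * _).
have dis : [disjoint vertices A & vertices B]%fset.
  apply/fdisjointP => j /imfsetP[a aA ->]; rewrite mem_vertices.
  by rewrite (disjointFr AB).
have := sigma_cyl_indep Xindep dis (@sigma_cyl_restrict A f) (@sigma_cyl_restrict B h).
have -> : [set w | restrict_graph A (sample_graph w) = f] `&`
    [set w | restrict_graph B (sample_graph w) = h] =
    [set w | (restrict_graph B (sample_graph w) == h) && (restrict_graph A (sample_graph w) == f)].
  apply/seteqP; split => w /=; first by move=> [/eqP-> /eqP->].
  by move=> /andP[/eqP h1 /eqP h2].
rewrite (_ : [set w | restrict_graph A (sample_graph w) = f] =
    [set w | restrict_graph A (sample_graph w) == f]); last first.
  by apply/seteqP; split => w /= /eqP.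
rewrite (_ : [set w | restrict_graph B (sample_graph w) = h] =
    [set w | restrict_graph B (sample_graph w) == h]); last first.
  by apply/seteqP; split => w /= /eqP.
rewrite (prob_sample_graph (fun G => (restrict_graph B G == h) && (restrict_graph A G == f))).
rewrite (prob_sample_graph (fun G => restrict_graph A G == f)).
rewrite (prob_sample_graph (fun G => restrict_graph B G == h)) -EFinM => -[].
have e2 (C : {set T}) f' : (fun G => (restrict_graph C G == f')%:R * 1 : R) =1
    (fun G => (restrict_graph C G == f')%:R).
  by move=> G; rewrite mulr1.
have e3 : (fun G => (restrict_graph B G == h)%:R * (restrict_graph A G == f)%:R : R) =1
    (fun G => ((restrict_graph B G == h) && (restrict_graph A G == f))%:R).
  by move=> G; rewrite -natrM mulnb.
by rewrite !(eq_Ex _ (e2 _ _)) (eq_Ex _ e3).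
Qed.

End fixed_vertices.

Lemma Ex_reindex (T T' : finType) (j : T' -> T) (i : T -> nat) (F : graph T' -> R) :
  Ex (graph_weight i) (fun G => F (reindex_graph j G)) = Ex (graph_weight (i \o j)) F.
Proof.
have wE G' : graph_weight (i \o j) G' =
    Ex (graph_weight i) (fun G => (reindex_graph j G == G')%:R).
  have := prob_sample_graph i (fun G => reindex_graph j G == G').
  rewrite /graph_weight => /(congr1 fine) /= <-; congr (fine (P _)).
  by apply/seteqP; split => w /=; rewrite /sample_graph reindex_point_graph => /eqP.
rewrite [RHS]/Ex; under [RHS]eq_bigr do rewrite wE mulrC -ExZ.
rewrite -Ex_sum; apply: eq_Ex => G.
rewrite (bigD1 (reindex_graph j G))//= eqxx mulr1 big1 ?addr0// => G' nG.
by rewrite eq_sym (negbTE nG) mulr0.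
Qed.

Lemma graph_weight_inj (T : finType) (i i' : T -> nat) : injective i -> injective i' ->
  graph_weight i =1 graph_weight i'.
Proof.
move=> i_inj i'_inj G; rewrite /graph_weight; congr fine.
(* Enumerating [T] expresses the graph as a function of a tuple of sample points, whose law does not
   depend on the injection. *)
pose S := [set x : #|T|.-tuple (Rd R d) |
  (point_graph r (fun a => tnth x (enum_rank a)) : graph T) == G].
have eS (l : T -> nat) : [set w | sample_graph l w = G] =
    sample_tuple X (l \o enum_val) @^-1` S.
  have gE w : point_graph r (fun a => tnth (sample_tuple X (l \o enum_val) w) (enum_rank a)) =
      sample_graph l w.
    apply/ffunP => p; rewrite !ffunE.
    by rewrite !tnth_mktuple /= !enum_rankK.
  by apply/seteqP; split => w; rewrite /S /= gE => /eqP.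
rewrite !eS; apply: sample_tuple_law => //.
- by apply: inj_comp => //; exact: enum_val_inj.
- by apply: inj_comp => //; exact: enum_val_inj.
apply: (@finite_event_measurable _ _ _ (fun x : #|T|.-tuple (Rd R d) =>
  point_graph r (fun a => tnth x (enum_rank a))) (pred1 G)) => p.
have mf : measurable_fun setT (fun x : #|T|.-tuple (Rd R d) =>
    (tnth x (enum_rank p.1), tnth x (enum_rank p.2))).
  by apply: measurable_fun_pair; exact: measurable_tnth.
rewrite -[X in measurable X]setTI (_ : mkset _ =
    (fun x : #|T|.-tuple (Rd R d) => (tnth x (enum_rank p.1), tnth x (enum_rank p.2))) @^-1`
      close_pairs r).
  by apply: mf => //; exact: measurable_close_pairs.
by apply/seteqP; split => x /=; rewrite /preimage /close_pairs /= ffunE.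
Qed.

Lemma Ex_exchangeable (T T' : finType) (j : T' -> T) (i : T -> nat) (i' : T' -> nat)
    (F : graph T' -> R) : injective j -> injective i -> injective i' ->
  Ex (graph_weight i) (fun G => F (reindex_graph j G)) = Ex (graph_weight i') F.
Proof.
move=> j_inj i_inj i'_inj; rewrite Ex_reindex /Ex; apply: eq_bigr => G _.
by rewrite (graph_weight_inj (inj_comp i_inj j_inj) i'_inj).
Qed.

End geometric_random_graph.

(** * Agreement with the components counted in the statement *)

Section components_of_connect.
Import fintype boot.finset fingraph.
Variables (T : finType) (e : rel T).
Hypothesis e_sym : symmetric e.

Let c_sym : connect_sym e := sym_connect_sym e_sym.

Let unlinked_closed (A : {set T}) : ~~ linked e A (~: A) -> closed e (mem A).
Proof.
move=> nA; apply: (intro_closed c_sym) => x y exy xA.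
apply: contraNT nA => yA; apply/linkedP; exists x, y; split => //.
by rewrite inE; exact: yA.
Qed.

Lemma comps_connect k : (0 < k)%N -> comps e k setT =
  [set C in equivalence_partition (connect e) setT | #|C| == k]%SET.
Proof.
move=> k0; apply/setP => A; rewrite !inE subsetT /=.
case: (boolP (#|A| == k)) => [Ak|]; last by rewrite andbF.
rewrite andbT setTD /=; apply/andP/imsetP => [[/connP[/set0Pn[x xA] cA] iA]|[x _ ->]].
  exists x => //; apply/setP => y; rewrite !inE /=.
  have clA := unlinked_closed iA.
  have sub z : connect e x z -> z \in A.
    by move=> xz; have <- : (x \in A) = (z \in A) := closed_connect clA xz.
  apply/idP/idP => [yA|]; last exact: sub.
  (* If y in [A] were unreachable from x, the class [B] of x would be a proper cut of [A]; its
     crossing edge would prolong a path out of the class. *)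
  apply/negPn/negP => nxy; pose B : {set T} := [set z | connect e x z]%SET.
  have BA : B \subset A by apply/subsetP => z; rewrite inE; exact: sub.
  have B0 : B != set0 by apply/set0Pn; exists x; rewrite inE connect0.
  have BnA : B != A by apply: contraNneq nxy => BA'; rewrite -BA' inE in yA.
  have /linkedP[a [b [aB bB eab]]] := cA B BA B0 BnA.
  move: aB bB; rewrite !inE => xa /andP[/negP[]].
  exact: connect_trans xa (connect1 eab).
set C := [set y in setT | connect e x y]%SET.
split.
  apply/connP; split=> [|B BC /set0Pn[b bB] BnC].
    by apply/set0Pn; exists x; rewrite !inE connect0.
  apply: contraNT BnC => nB; have nB' : ~~ linked e B (~: B).
    apply: contra nB => /linkedP[a [c [aB cB eac]]]; apply/linkedP; exists a, c.
    split => //; rewrite !inE; rewrite inE in cB; rewrite cB /=.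
    have := subsetP BC _ aB; rewrite !inE => xa.
    exact: connect_trans xa (connect1 eac).
  have clB := unlinked_closed nB'.
  rewrite eqEsubset BC; apply/subsetP => y; rewrite !inE /= => xy.
  have := subsetP BC _ bB; rewrite !inE /= c_sym => bx.
  by have <- : (b \in B) = (y \in B) := closed_connect clB (connect_trans bx xy).
apply/linkedP => -[a [b []]]; rewrite !inE /= => xa /negP nb eab; apply: nb.
exact: connect_trans xa (connect1 eab).
Qed.

End components_of_connect.

Section loops.
Import fintype boot.finset fingraph.
Variables (T : finType) (e e' : rel T).
Hypothesis ee' : forall a b, a != b -> e a b = e' a b.

Let eq_linked_disjoint (A B : {set T}) : [disjoint A & B] -> linked e A B = linked e' A B.
Proof.
move=> AB; apply: eq_linked => a b aA bB; apply: ee'.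
by apply: contraTneq bB => <-; rewrite (disjointFr AB).
Qed.

Let disjoint_setD (A B : {set T}) : [disjoint A & B :\: A].
Proof. by rewrite -setI_eq0 setIDA setIC -setIDA setDv setI0. Qed.

Lemma ncomps_loops k C : ncomps e k C = ncomps e' k C.
Proof.
rewrite /ncomps; apply: eq_card => A; rewrite !inE; congr [&& _, _, (_ && _) & ~~ _].
  by apply: eq_forallb => B; rewrite eq_linked_disjoint.
exact: eq_linked_disjoint.
Qed.

End loops.

Section nb_components_points.
Context {R : realType} {d : nat}.

Lemma eucl_dist_le0 (x y : Rd R d) : (eucl_dist x y <= 0) = (x == y).
Proof.
apply/idP/eqP => [|->]; last by rewrite eucl_dist0.
rewrite /eucl_dist => h; have s0 : \sum_(i < d) ((tnth x i : R) - tnth y i) ^+ 2 = 0.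
  apply/eqP; rewrite eq_le sumr_ge0 ?andbT => [|i _]; last exact: sqr_ge0.
  by rewrite leNgt; apply/negP => s_gt0; move: h; rewrite leNgt sqrtr_gt0 s_gt0.
apply: eq_from_tnth => i; apply/eqP; rewrite -subr_eq0 -sqrf_eq0; apply/eqP.
by apply: (psumr_eq0P _ s0) => // j _; exact: sqr_ge0.
Qed.

Lemma nb_components_ncomps (T : finType) (x : T -> Rd R d) (V : {set T})
    (F : {fset Rd R d}) r k : (0 < k)%N ->
  {in V &, injective x} -> F = [fset x a | a in V]%fset ->
  nb_components F r k = ncomps (adj (point_graph r x)) k V.
Proof.
move=> k0 x_inj FV.
(* Each point of the set gets a vertex of [V] that carries it; injectivity on [V] makes this a
   bijection, along which components are transported. *)
have sel (v : F) : {a : T | a \in V & x a = val v}.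
  apply: cid2; have := valP v; rewrite [X in _ \in X -> _]FV.
  by move=> /imfsetP[a aV ->]; exists a.
pose h v := s2val (sel v).
have hV v : h v \in V := s2valP (sel v).
have hx v : x (h v) = val v := s2valP' (sel v).
have h_inj : injective h by move=> u v uv; apply: val_inj; rewrite -!hx uv.
have VE : V = (h @: [set: F])%SET.
  apply/setP => a; apply/idP/imsetP => [aV|[v _ ->]]; last exact: hV.
  have xaF : x a \in F by rewrite FV; apply/imfsetP; exists a.
  exists [` xaF]%fset; first by rewrite inE.
  by apply: x_inj => //; rewrite hx.
rewrite VE ncomps_imset//.
rewrite (@ncomps_loops _ _ (geom_edge r)); last first.
  move=> a b ab; rewrite adj_point_graph !hx /geom_edge ab.
  by [].
rewrite /ncomps comps_connect// => a b; rewrite /geom_edge eq_sym eucl_dist_sym.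
by [].
Qed.

(* Meant for a graph of radius 0, where adjacency is equality of the sampled points, so that
   these are the first occurrences of the sampled values. *)
Definition first_occ n (G0 : graph 'I_n) : {set 'I_n} :=
  [set i : 'I_n | [forall j : 'I_n, (j < i)%N ==> ~~ adj G0 j i]]%SET.

(** Holds at every outcome, ties included, since repeated points are represented by their first
    occurrence. This gives measurability everywhere; the tie-free version below identifies the
    law. *)
Lemma nb_components_sample dO (O : measurableType dO) (Y : nat -> O -> Rd R d) n (w : O) r k :
  (0 < k)%N -> nb_components (sample Y n w) r k =
  ncomps (adj (point_graph r (fun i : 'I_n => Y i w))) k
    (first_occ (point_graph 0 (fun i : 'I_n => Y i w))).
Proof.
move=> k0; apply: nb_components_ncomps => //.
  move=> i j; rewrite !inE => /forallP iV /forallP jV Yij.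
  apply/val_inj/eqP; rewrite eqn_leq; apply/andP; split; rewrite leqNgt; apply/negP => ij.
    by have := implyP (iV j) ij; rewrite adj_point_graph eucl_dist_le0 Yij eqxx.
  by have := implyP (jV i) ij; rewrite adj_point_graph eucl_dist_le0 Yij eqxx.
apply/fsetP => x; apply/imfsetP/imfsetP => [[i /=]|[i _ ->]]; last first.
  by exists (val i) => //=; rewrite mem_iota add0n ltn_ord.
rewrite mem_iota /= add0n => i_n ->.
have ex : exists m, (m < n)%N && (Y m w == Y i w) by exists i; rewrite i_n eqxx.
case: (ex_minnP ex) => m /andP[mn /eqP mE] m_min.
exists (Ordinal mn) => //=; rewrite inE; apply/forallP => j; apply/implyP => /= jm.
rewrite adj_point_graph eucl_dist_le0 /=; apply/negP => /eqP jE.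
by have := m_min j; rewrite ltn_ord jE mE eqxx leqNgt jm => /(_ isT).
Qed.

Lemma nb_components_sample_inj dO (O : measurableType dO) (Y : nat -> O -> Rd R d) n (w : O) r k :
  (0 < k)%N -> injective (fun i : 'I_n => Y i w) ->
  nb_components (sample Y n w) r k =
  ncomps (adj (point_graph r (fun i : 'I_n => Y i w))) k [set: 'I_n].
Proof.
move=> k0 Y_inj; apply: nb_components_ncomps => //; first by move=> i j _ _ /Y_inj.
apply/fsetP => x; apply/imfsetP/imfsetP => [[i /=]|[i _ ->]]; last first.
  by exists (val i) => //=; rewrite mem_iota add0n ltn_ord.
by rewrite mem_iota /= add0n => i_n ->; exists (Ordinal i_n) => //=; rewrite inE.
Qed.

(** [O] is arbitrary so that the lemma also applies to Omega with the sigma-algebra generated by the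
    sample, where it yields independence from the Poisson variable. *)
Lemma measurable_nb_components dO (O : measurableType dO) (Y : nat -> O -> Rd R d) n r k
    (B : set nat) :
  (0 < k)%N -> (forall i, measurable_fun setT (Y i)) ->
  measurable [set w | B (nb_components (sample Y n w) r k)]%classic.
Proof.
move=> k0 mY.
have mG s (Q : pred (graph 'I_n)) :
    measurable [set w | Q (point_graph s (fun i : 'I_n => Y i w))]%classic.
  apply: finite_event_measurable => p.
  have mf : measurable_fun setT (fun w => (Y (p.1 : 'I_n) w, Y (p.2 : 'I_n) w)).
    exact: measurable_fun_pair.
  rewrite -[X in measurable X]setTI (_ : mkset _ =
      (fun w => (Y (p.1 : 'I_n) w, Y (p.2 : 'I_n) w)) @^-1` close_pairs s)%classic.
    by apply: mf => //; exact: measurable_close_pairs.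
  by apply/seteqP; split => w /=; rewrite /preimage /close_pairs /= ffunE.
rewrite [X in measurable X](_ : _ = \bigcup_(G0 in [set: graph 'I_n])
   ([set w | pred1 G0 (point_graph 0 (fun i : 'I_n => Y i w))] `&`
    [set w | (fun G => ncomps (adj G) k (first_occ G0) \in B)
               (point_graph r (fun i : 'I_n => Y i w))]))%classic; last first.
  apply/seteqP; split => [w /= Bw|w [G0 _ [/eqP]]] /=.
    exists (point_graph 0 (fun i : 'I_n => Y i w)) => //; split => /=; first by rewrite eqxx.
    by rewrite -nb_components_sample// mem_set.
  by move=> <-; rewrite -nb_components_sample// => /set_mem.
apply: fin_bigcup_measurable; first exact: finite_finset.
by move=> G0 _; apply: measurableI; [exact: (mG 0 (pred1 G0))|exact: (mG r (fun G => ncomps (adj G) k (first_occ G0) \in B))].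
Qed.

End nb_components_points.

(** * Bounds from the density *)

Section density_bounds.
Local Open Scope classical_set_scope.
Context {R : realType} {d : nat} {dO : measure_display} {Omega : measurableType dO}.
Variable P : probability Omega R.
Variable X : nat -> {RV P >-> Rd R d}.
Variables (f : Rd R d -> R) (M : R).
Hypothesis Xdensity : forall i, has_density P (X i) f.
Hypothesis f_le : forall x, f x <= M.

Lemma same_law i j C : measurable C -> P (X i @^-1` C) = P (X j @^-1` C).
Proof.
by move=> mC; have [_ _ ->//] := Xdensity i; have [_ _ ->] := Xdensity j.
Qed.

Let M_ge0 : 0 <= M.
Proof. by have [_ f0 _] := Xdensity 0; apply: le_trans (f_le point); exact: f0. Qed.

Lemma prob_le_lebesgue i A : measurable A ->
  (P (X i @^-1` A) <= M%:E * lebesgue_tuple d A)%E.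
Proof.
move=> mA; have [mf f0 ->//] := Xdensity i.
rewrite -integral_cst//; apply: ge0_le_integral => //.
- by move=> x _; rewrite lee_fin.
- by apply/measurable_EFinP; exact: measurable_funTS.
- by move=> x _; rewrite lee_fin.
Qed.

(** The ball lies in a cube of side 2r. The case r = 0 is included and yields the absence of
    ties. *)
Lemma prob_close_le r i x : 0 <= r ->
  (P (X i @^-1` xsection (close_pairs r) x) <= (M * (2 * r) ^+ d)%:E)%E.
Proof.
move=> r0; pose C (j : 'I_d) : set (measurableTypeR R) := `[tnth x j - r, tnth x j + r].
have mC j : measurable (C j) by exact: measurable_itv.
have sub : xsection (close_pairs r) x `<=` [set y | forall j, C j (tnth y j)].
  move=> y; rewrite /xsection /= inE /close_pairs /= => xy j.
  have : `|(tnth x j : R) - tnth y j| <= r.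
    apply: le_trans xy; rewrite -sqrtr_sqr /eucl_dist ler_sqrt; last first.
      by apply: sumr_ge0 => l _; exact: sqr_ge0.
    rewrite (bigD1 j)//= lerDl; apply: sumr_ge0 => l _; exact: sqr_ge0.
  by rewrite /C /= in_itv /= ler_norml => /andP[]; lra.
have mbox : measurable [set y : Rd R d | forall j, C j (tnth y j)].
  rewrite [X in measurable X](_ : _ = \bigcap_(j in [set: 'I_d]) ((@tnth d _)^~ j @^-1` C j)).
    apply: fin_bigcap_measurable => // j _.
    by rewrite -[X in measurable X]setTI; exact: measurable_tnth.
  by apply/seteqP; split => [y Cy j _|y Cy j]; exact: Cy.
apply: (@le_trans _ _ (P (X i @^-1` [set y : Rd R d | forall j, C j (tnth y j)]))).
  apply: le_measure; rewrite ?inE.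
  - apply: measurable_funPTI; apply: measurable_xsection; exact: measurable_close_pairs.
  - exact: measurable_funPTI.
  - by move=> w; exact: sub.
apply: le_trans (prob_le_lebesgue i mbox) _.
rewrite lebesgue_tuple_box// (eq_bigr (fun=> (2 * r)%:E)); last first.
  move=> j _; rewrite /C lebesgue_measure_itv /= lte_fin.
  case: ltP => [_|h]; first by rewrite -EFinB; congr (_%:E); lra.
  by congr (_%:E); lra.
by rewrite prodEFin prodr_const card_ord -EFinM.
Qed.

End density_bounds.

(** * A lower bound for the probability that k points are connected *)

Section connectivity_lower_bound.
Local Open Scope classical_set_scope.
Context {R : realType} {d : nat} {dO : measure_display} {Omega : measurableType dO}.
Variable P : probability Omega R.
Variable X : nat -> {RV P >-> Rd R d}.
Hypothesis Xindep : mutually_independent P X.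
Hypothesis Xid : forall i j C, measurable C -> P (X i @^-1` C) = P (X j @^-1` C).

Lemma measurable_tuple_box (C : 'I_d -> set (measurableTypeR R)) :
  (forall j, measurable (C j)) -> measurable [set y : Rd R d | forall j, C j (tnth y j)].
Proof.
move=> mC; rewrite [X in measurable X](_ : _ =
    \bigcap_(j in [set: 'I_d]) ((@tnth d _)^~ j @^-1` C j)).
  apply: fin_bigcap_measurable => // j _.
  by rewrite -[X in measurable X]setTI; exact: measurable_tnth.
by apply/seteqP; split => [y Cy j _|y Cy j]; exact: Cy.
Qed.

Definition half_open_cube (L : R) : set (Rd R d) :=
  [set y | forall j, `[- L, L[%classic (tnth y j : R)].

Lemma measurable_half_open_cube L : measurable (half_open_cube L).
Proof.
apply: (@measurable_tuple_box (fun=> `[- L, L[%classic)) => j.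
exact: measurable_itv.
Qed.

Let measurable_in_cube i L : measurable (X i @^-1` half_open_cube L).
Proof. exact: (measurable_funPTI (X i) (measurable_half_open_cube L)). Qed.

Lemma half_mass_cube : exists2 L : R, 0 < L & (2^-1%:E <= P (X 0 @^-1` half_open_cube L))%E.
Proof.
have cv : P (X 0 @^-1` half_open_cube n%:R) @[n --> \oo] --> (1%:E : \bar R).
  rewrite -(@probability_setT _ _ _ P).
  rewrite [X in _ --> P X](_ : _ = \bigcup_n (X 0 @^-1` half_open_cube n%:R)).
    apply: nondecreasing_cvg_mu.
    - by move=> n; exact: measurable_in_cube.
    - by apply: bigcup_measurable => n _; exact: measurable_in_cube.
    - move=> m n mn; apply/subsetPset => w /= h j; have := h j.
      have : m%:R <= n%:R :> R by rewrite ler_nat.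
      by rewrite /= !in_itv /=; move=> mn' /andP[h1 h2]; apply/andP; split; lra.
  apply/seteqP; split => // w _; pose x := X 0 w.
  exists (\sum_(j < d) (Num.truncn `|tnth x j : R|).+1)%N => // j /=.
  have h : `|tnth x j : R| < (\sum_(j < d) (Num.truncn `|tnth x j : R|).+1)%N%:R.
    apply: lt_le_trans (truncnS_gt _) _.
    by rewrite ler_nat (bigD1 j)//= leq_addr.
  by rewrite /= in_itv /=; move: h; rewrite ltr_norml => /andP[/ltW -> ->].
have /fine_cvgP[_ cvf] : P (X 0 @^-1` half_open_cube n%:R) @[n --> \oo] --> (1 : R)%:E := cv.
have : \forall n \near \oo, 2^-1 <= (fine \o (fun n => P (X 0 @^-1` half_open_cube n%:R))) n.
  by apply: (cvgr_ge _ cvf); lra.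
case=> n _ /(_ n.+1 (leqnSn n)) /= h; exists n.+1%:R; first by rewrite ltr0n.
by rewrite -[leRHS]fineK ?lee_fin// fin_num_measure//; exact: measurable_in_cube.
Qed.

Section grid.
Variables (L : R) (m : nat).
Hypotheses (L_gt0 : 0 < L) (m_gt0 : (0 < m)%N).
Let s := 2 * L / m%:R.

Let s_gt0 : 0 < s.
Proof. by rewrite divr_gt0 ?ltr0n// mulr_gt0. Qed.

Definition grid_cell (c : {ffun 'I_d -> 'I_m}) : set (Rd R d) :=
  [set y | forall j, `[- L + (c j)%:R * s, - L + (c j).+1%:R * s[%classic (tnth y j : R)].

Lemma measurable_grid_cell c : measurable (grid_cell c).
Proof.
apply: (@measurable_tuple_box (fun j =>
  `[- L + (c j)%:R * s, - L + (c j).+1%:R * s[%classic)) => j.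
exact: measurable_itv.
Qed.

Lemma grid_cell_inj c c' y : grid_cell c y -> grid_cell c' y -> c = c'.
Proof.
move=> cy c'y; apply/ffunP => j; apply/val_inj/eqP => /=.
have := cy j; have := c'y j; rewrite /= !in_itv /= => /andP[h1 h2] /andP[h3 h4].
have l1 : (c j)%:R < (c' j).+1%:R :> R by rewrite -(ltr_pM2r s_gt0); lra.
have l2 : (c' j)%:R < (c j).+1%:R :> R by rewrite -(ltr_pM2r s_gt0); lra.
by move: l1 l2; rewrite !ltr_nat !ltnS eqn_leq => -> ->.
Qed.

Lemma grid_cell_cover y : half_open_cube L y -> exists c, grid_cell c y.
Proof.
move=> Ly.
have t_bounds j : 0 <= ((tnth y j : R) + L) / s /\ ((tnth y j : R) + L) / s < m%:R.
  have := Ly j; rewrite /= in_itv /= => /andP[h1 h2]; split.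
    by apply: divr_ge0; [lra|exact: ltW].
  rewrite ltr_pdivrMr// /s mulrC divfK ?pnatr_eq0 -?lt0n//; lra.
have lt_m j : (Num.truncn (((tnth y j : R) + L) / s) < m)%N.
  have [h1 h2] := t_bounds j.
  by rewrite -(ltr_nat R); apply: le_lt_trans h2; rewrite truncn_le.
exists [ffun j => Ordinal (lt_m j)] => j; rewrite /= in_itv /= ffunE /=.
have [h1 h2] := t_bounds j.
have /andP[h3 h4] := truncn_itv h1.
move: h3 h4; rewrite ler_pdivlMr// ltr_pdivrMr//; move: (_ %:R * s) (_%:R * s) => a b; lra.
Qed.

Lemma grid_cell_dist c x y : grid_cell c x -> grid_cell c y ->
  eucl_dist x y <= Num.sqrt (d%:R * s ^+ 2).
Proof.
move=> cx cy; rewrite /eucl_dist ler_sqrt; last by rewrite mulr_ge0// sqr_ge0.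
apply: (@le_trans _ _ (\sum_(j < d) s ^+ 2)); last first.
  by rewrite sumr_const card_ord mulr_natl.
apply: ler_sum => j _.
have := cx j; have := cy j; rewrite /= !in_itv /= -natr1 mulrDl mul1r => /andP[h1 h2] /andP[h3 h4].
rewrite -[leLHS]real_normK ?num_real// ler_sqr ?nnegrE//; last exact: ltW.
rewrite ler_norml.
by apply/andP; split; lra.
Qed.

End grid.

(** The power function lies above its tangent at t. Summed over the cells with t below the average
    mass, the linear terms are nonnegative in total, which is the power mean inequality. *)
Lemma power_tangent (a t : R) k : 0 <= a -> 0 <= t ->
  t ^+ k + k%:R * t ^+ k.-1 * (a - t) <= a ^+ k.
Proof.
move=> a0 t0; elim: k => [|k IHk]; first by rewrite !expr0 !mul0r addr0.
have [->|k0] := eqVneq k 0%N; first by rewrite !expr1 expr0 !mul1r addrC subrK.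
have h := ler_wpM2l a0 IHk; rewrite -exprS in h; apply: le_trans h.
have tk : t ^+ k = t * t ^+ k.-1 by rewrite -exprS prednK// lt0n.
rewrite -subr_ge0 /= exprS tk -natr1.
rewrite (_ : _ - _ = k%:R * t ^+ k.-1 * (a - t) ^+ 2); last by ring.
by rewrite mulr_ge0 ?sqr_ge0// mulr_ge0// exprn_ge0.
Qed.

Lemma power_mean_sum (I : finType) (a : I -> R) k (t : R) : 0 <= t -> (forall i, 0 <= a i) ->
  #|I|%:R * t <= \sum_i a i -> #|I|%:R * t ^+ k <= \sum_i a i ^+ k.
Proof.
move=> t0 a0 h; apply: (@le_trans _ _ (\sum_i (t ^+ k + k%:R * t ^+ k.-1 * (a i - t)))).
  rewrite big_split /= -mulr_sumr sumr_const -[X in _ <= X + _]mulr_natl lerDl.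
  rewrite mulr_ge0 ?mulr_ge0 ?exprn_ge0// sumrB sumr_const -[_ *+ _]mulr_natl subr_ge0//.
by apply: ler_sum => i _; exact: power_tangent.
Qed.

Lemma conn_complete (T : finType) (G : graph T) : (0 < #|T|)%N ->
  (forall a b, adj G a b) -> conn (adj G) [set: T]%SET.
Proof.
move=> T0 h; apply/connP; split=> [|B _ /set0Pn[b bB] BT].
  by rewrite -card_gt0 cardsT.
have : ~: B != finset.set0 by apply: contra BT => /eqP h0; rewrite -[B]finset.setCK h0 finset.setC0.
move=> /set0Pn[a aB]; apply/linkedP; exists b, a; split => //.
by rewrite finset.setTD.
Qed.

Lemma conn_prob_lower_bound k : (0 < k)%N -> (0 < d)%N ->
  exists2 c : R, 0 < c & forall r, 0 < r -> r <= 1 -> c * (r ^+ d) ^+ k.-1 <=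
    Ex (graph_weight X r (fun i : 'I_k => i : nat))
      (fun G => (conn (adj G) [set: 'I_k]%SET)%:R).
Proof.
move=> k0 d0; have [L L0 hL] := half_mass_cube.
(* [K] is chosen so that m <= K / r for r <= 1: the summand 1 pays for rounding 2 L d / r up. *)
pose K := 2 * L * d%:R + 1.
have K_gt0 : 0 < K by rewrite ltr_wpDl// !mulr_ge0// ltW.
exists (2^-1 ^+ k * (K ^- d) ^+ k.-1).
  by rewrite mulr_gt0 ?exprn_gt0 ?invr_gt0// exprn_gt0.
move=> r r0 r1.
(* With m > 2 L d / r cells per axis, the cell side s satisfies d s <= r, so the diameter sqrt(d) s
   is at most r. *)
pose m := (Num.truncn (2 * L * d%:R / r)).+1.
have mr : m%:R <= K / r.
  have -> : m%:R = (Num.truncn (2 * L * d%:R / r))%:R + 1 :> R by rewrite natr1.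
  have -> : K / r = 2 * L * d%:R / r + r^-1 by rewrite /K mulrDl mul1r.
  apply: lerD; last by rewrite invf_ge1.
  by rewrite truncn_le// divr_ge0 ?(ltW r0)// !mulr_ge0// ltW.
have m_gt : 2 * L * d%:R / r < m%:R by exact: truncnS_gt.
have m0 : (0 < m)%N by [].
pose s := 2 * L / m%:R.
have mR : 0 < m%:R :> R by rewrite ltr0n.
have sr : Num.sqrt (d%:R * s ^+ 2) <= r.
  have dR : 1 <= d%:R :> R by rewrite ler1n.
  have s0 : 0 <= s by rewrite divr_ge0// mulr_ge0// ltW.
  have ds : d%:R * s <= r.
    rewrite /s mulrA ler_pdivrMr//; move: m_gt; rewrite ltr_pdivrMr// => /ltW.
    by rewrite mulrC [r * _]mulrC.
  rewrite -(ger0_norm (ltW r0)) -sqrtr_sqr ler_sqrt ?sqr_ge0//.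
  apply: le_trans (_ : (d%:R * s) ^+ 2 <= _).
    have -> : (d%:R * s) ^+ 2 = d%:R * d%:R * s ^+ 2 by ring.
    by rewrite ler_wpM2r ?sqr_ge0// ler_peMl.
  by rewrite ler_sqr ?nnegrE ?mulr_ge0//; exact: ltW.
pose C := @grid_cell L m.
have mC c : measurable (C c) by exact: measurable_grid_cell.
pose N : R := #|{ffun 'I_d -> 'I_m}|%:R.
have NE : N = m%:R ^+ d by rewrite /N card_ffun !card_ord natrX.
have N0 : 0 < N by rewrite NE exprn_gt0.
pose a c := fine (P (X 0 @^-1` C c)).
have aE c : P (X 0 @^-1` C c) = (a c)%:E.
  by rewrite /a fineK// fin_num_measure//; exact: measurable_funPTI.
have sum_a : 2^-1 <= \sum_c a c.
  rewrite -lee_fin; apply: le_trans hL _.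
  rewrite -sumEFin; under eq_bigr do rewrite -aE.
  have mI B : measurable B -> P (X 0 @^-1` B) = (\int[P]_w (\1_(X 0 @^-1` B) w)%:E)%E.
    by move=> mB; rewrite integral_indic ?setIT//; exact: measurable_funPTI.
  rewrite mI; last exact: measurable_half_open_cube.
  under eq_bigr do rewrite mI//.
  rewrite -ge0_integral_sum//; last first.
    by move=> c; apply/measurable_EFinP; apply: measurable_indic; exact: measurable_funPTI.
  apply: ge0_le_integral => //.
  - apply/measurable_EFinP; apply: measurable_indic.
    exact: measurable_in_cube.
  - apply: emeasurable_sum => c.
    by apply/measurable_EFinP; apply: measurable_indic; exact: measurable_funPTI.
  move=> w _; rewrite indicE; case: (boolP (w \in _)) => [/set_mem /= wL|_]; last first.
    by apply: sume_ge0 => c _; rewrite lee_fin.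
  have [c wc] := grid_cell_cover L0 m0 wL.
  by rewrite (bigD1 c)//= indicE mem_set//= leeDl// sume_ge0.
have mean : N * (2^-1 / N) <= \sum_c a c by rewrite mulrC divfK// gt_eqF.
have tN : 0 <= 2^-1 / N by rewrite divr_ge0 ?(ltW N0).
have := power_mean_sum k tN (fun c => fine_ge0 (measure_ge0 P (X 0 @^-1` C c))) mean.
rewrite -/N => lower.
have conn_ge : \sum_c a c ^+ k <= Ex (graph_weight X r (fun i : 'I_k => i : nat))
      (fun G => (conn (adj G) [set: 'I_k]%SET)%:R).
  pose E c := \bigcap_(i in [set` [fset i | i in iota 0 k]%fset]) (X i @^-1` C c).
  have mE c : measurable (E c).
    by apply: fin_bigcap_measurable => [|i _]; [exact: finite_fset|exact: measurable_funPTI].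
  have PE c : P (E c) = (a c ^+ k)%:E.
    rewrite /E (Xindep _ (A := fun=> C c))//.
    rewrite (eq_bigr (fun=> (a c)%:E)); last by move=> i _; rewrite (Xid _ 0) ?aE.
    rewrite prodEFin; congr (_%:E); rewrite big_const_seq count_predT.
    rewrite (_ : size _ = k) ?iter_mulr_1//.
    have pm : perm_eq [fset i | i in iota 0 k]%fset (iota 0 k).
      apply: uniq_perm; [exact: fset_uniq|exact: iota_uniq|].
      by move=> i; apply/imfsetP/idP => [[j /= ? ->]//|? ]; exists i.
    by rewrite (perm_size pm) size_iota.
  rewrite -lee_fin -integral_sample_graph// -sumEFin.
  have -> : (\sum_c (a c ^+ k)%:E = \sum_c \int[P]_w (\1_(E c) w)%:E)%E.
    by apply: eq_bigr => c _; rewrite -PE integral_indic ?setIT.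
  rewrite -ge0_integral_sum//; last by move=> c; apply/measurable_EFinP; exact: measurable_indic.
  apply: ge0_le_integral => //.
  - by move=> w _; apply: sume_ge0 => c _; rewrite lee_fin.
  - by apply: emeasurable_sum => c; apply/measurable_EFinP; exact: measurable_indic.
  - have mg := @measurable_sample_graph _ _ _ _ P X r _ (fun i : 'I_k => i : nat)
      (fun G => conn (adj G) [set: 'I_k]%SET).
    rewrite (_ : (fun w => _) = (fun w => (\1_[set w | conn (adj (sample_graph X r
      (fun i : 'I_k => i : nat) w)) [set: 'I_k]%SET] w)%:E)).
      by apply/measurable_EFinP; exact: measurable_indic.
    apply/funext => w; rewrite indicE; congr (_%:R%:E); congr nat_of_bool.
    by apply/idP/idP => [h|/set_mem//]; rewrite mem_set.
  move=> w _.
  have [[c wc]|nE] := pselect (exists c, E c w); last first.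
    rewrite big1 ?lee_fin// => c _; rewrite indicE memNset// => Ec.
    by apply: nE; exists c.
  rewrite (bigD1 c)//= big1 ?adde0; last first.
    move=> c' c'c; rewrite indicE memNset// => wc'.
    case/negP : c'c; apply/eqP.
    have i0 : [set` [fset i | i in iota 0 k]%fset] 0%N.
      by rewrite /=; apply/imfsetP; exists 0%N => //=; rewrite mem_iota.
    exact: (grid_cell_inj L0 m0 (wc' 0%N i0) (wc 0%N i0)).
  rewrite indicE mem_set// lee_fin (_ : conn _ _)//.
  apply: conn_complete => [|i j]; first by rewrite card_ord.
  rewrite adj_point_graph; apply: le_trans sr.
  have iE (i' : 'I_k) : C c (X i' w).
    by apply: wc; rewrite /=; apply/imfsetP; exists (val i') => //=; rewrite mem_iota add0n ltn_ord.
  exact: grid_cell_dist (iE i) (iE j).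
apply: le_trans conn_ge; apply: le_trans lower.
(* The N cells have average mass at least 1/(2N), so the k-th powers sum to at least 2^-k N^-(k-1);
   finally N <= (K / r)^d. *)
have -> : N * (2^-1 / N) ^+ k = 2^-1 ^+ k * (N^-1) ^+ k.-1.
  rewrite exprMn -[in (N^-1) ^+ k](prednK k0) exprS mulrCA; congr (_ * _).
  by rewrite mulrA divff ?mul1r// gt_eqF.
rewrite -mulrA ler_wpM2l ?exprn_ge0// -exprMn; case: (k.-1) => [|l]; first by rewrite !expr0.
rewrite ler_pXn2r// ?nnegrE ?invr_ge0 ?(ltW N0)//; last first.
  by rewrite mulr_ge0 ?invr_ge0 ?exprn_ge0// ltW.
rewrite -exprVn -exprMn NE -exprVn ler_pXn2r// ?nnegrE ?invr_ge0 ?mulr_ge0 ?invr_ge0 ?(ltW K_gt0) ?(ltW r0)//.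
by rewrite -[leLHS]invrK invfM invrK lef_pV2 ?posrE ?divr_gt0.
Qed.

End connectivity_lower_bound.

(** * The law of the component count *)

Section law_of_component_count.
Local Open Scope classical_set_scope.
Context {R : realType} {d : nat} {dO : measure_display} {Omega : measurableType dO}.
Variable P : probability Omega R.
Variable X : nat -> {RV P >-> Rd R d}.
Variables (f : Rd R d -> R) (M : R).
Hypothesis d_gt0 : (0 < d)%N.
Hypothesis Xindep : mutually_independent P X.
Hypothesis Xdensity : forall i, has_density P (X i) f.
Hypothesis f_le : forall x, f x <= M.

Let Xid := same_law Xdensity.

Let coincident n (G : graph 'I_n) := [exists a, exists b, (a != b) && adj G a b].

(** At radius 0 the adjacency bound is M * 0^d = 0, because d > 0, and a union bound over pairs of
    indices finishes. *)
Let prob_coincident n :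
  P [set w | coincident (sample_graph X 0 (fun i : 'I_n => i : nat) w)] = 0%E.
Proof.
rewrite (prob_sample_graph X 0 (fun i : 'I_n => i : nat) (@coincident n)).
set w := graph_weight _ _ _; congr (_%:E); apply/eqP; rewrite eq_le; apply/andP; split; last first.
  by apply: Ex_ge0 => // G; exact: graph_weight_ge0.
have w0 G : 0 <= w G by exact: graph_weight_ge0.
apply: (@le_trans _ _ (Ex w (fun G => \sum_a \sum_(b | b != a) 1 * (adj G a b)%:R))).
  apply: ler_Ex => // G; rewrite /coincident.
  have s0 a : 0 <= \sum_(b | b != a) 1 * (adj G a b)%:R :> R.
    by apply: sumr_ge0 => b _; rewrite mul1r.
  case: existsP => [[a /existsP[b /andP[ab Gab]]]|_]; last exact: sumr_ge0.
  by rewrite (bigD1 a)//= (bigD1 b) ?(eq_sym b)//= Gab mul1r -addrA lerDl addr_ge0 ?sumr_ge0.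
rewrite Ex_sum sumr_le0// => a _; rewrite Ex_sum sumr_le0// => b ba.
have i_inj : injective (fun i : 'I_n => i : nat) by exact: ord_inj.
have := @Ex_adj_sample _ _ _ _ P X Xindep 0 _ _ i_inj (M * (2 * 0) ^+ d) [set a]%SET (fun=> 1) a b.
rewrite mulr0 expr0n eqn0Ngt d_gt0 mulr0 mul0r; apply => //.
- move=> j x; have := prob_close_le Xdensity f_le j x (lexx 0).
  by rewrite mulr0 expr0n eqn0Ngt d_gt0 mulr0.
- by rewrite inE.
- by rewrite inE.
Qed.

Variables (n k : nat) (r : R).
Hypothesis k_gt0 : (0 < k)%N.

(** The independent copies are the next n points of the same sequence. *)
Definition doubled_index (p : 'I_n * bool) : nat := if p.2 then (n + p.1)%N else p.1.

Lemma doubled_index_inj : injective doubled_index.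
Proof.
move=> [a [|]] [b [|]]; rewrite /doubled_index /=.
- by move=> /addnI/ord_inj ->.
- by move=> h; have := ltn_ord b; rewrite -h ltnNge leq_addr.
- by move=> h; have := ltn_ord a; rewrite h ltnNge leq_addr.
- by move=> /ord_inj ->.
Qed.

Definition count (w : Omega) : nat := nb_components (sample X n w) r k.

Local Notation weight := (graph_weight X r doubled_index).

Let count_nbase w : ~ coincident (sample_graph X 0 (fun i : 'I_n => i : nat) w) ->
  count w = nbase k (sample_graph X r doubled_index w).
Proof.
move=> nc; rewrite /count nb_components_sample_inj//; last first.
  move=> a b ab; apply/eqP/negPn/negP => nab; apply: nc.
  apply/existsP; exists a; apply/existsP; exists b.
  by rewrite nab adj_point_graph eucl_dist_le0 ab eqxx.
rewrite /nbase.
have -> : base n = ((fun j : 'I_n => (j, false)) @: [set: 'I_n])%SET.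
  apply/setP => -[a b]; rewrite !inE; apply/idP/imsetP => [/=|[j _ [_ ->//]]].
  by case: b => // _; exists a; rewrite ?inE.
rewrite ncomps_imset; last by move=> a b [].
by apply: eq_ncomps => a b _ _; rewrite !adj_point_graph.
Qed.

Lemma measurable_count (B : set nat) : measurable [set w | B (count w)].
Proof. by apply: measurable_nb_components => // i; exact: measurable_funPT. Qed.

Lemma integral_count (F : nat -> R) : (forall m, 0 <= F m) ->
  (\int[P]_w (F (count w))%:E = (Ex weight (fun G => F (nbase k G)))%:E)%E.
Proof.
move=> F0; rewrite -(integral_sample_graph X r doubled_index (F := fun G => F (nbase k G)))//.
apply: ge0_ae_eq_integral => //.
- move=> _ Y mY; rewrite setTI; exact: (measurable_count (fun m => Y (F m)%:E)).
- move=> _ Y mY; rewrite setTI.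
  have := @measurable_sample_graph _ _ _ _ P X r _ doubled_index
    (fun G => (F (nbase k G))%:E \in Y).
  congr measurable; apply/seteqP; split => w /=; first by move=> /set_mem.
  by move=> h; rewrite mem_set.
- by move=> w _; rewrite lee_fin.
- by move=> w _; rewrite lee_fin.
exists [set w | coincident (sample_graph X 0 (fun i : 'I_n => i : nat) w)]; split.
- exact: measurable_sample_graph.
- exact: prob_coincident.
move=> w /= nF; apply: contrapT => nc; apply: nF => _.
by rewrite count_nbase.
Qed.

Lemma prob_count (B : set nat) :
  P [set w | B (count w)] = (Ex weight (fun G => (nbase k G \in B)%:R))%:E.
Proof.
rewrite -(integral_count (F := fun m => (m \in B)%:R))//.
rewrite -[X in P X]setIT -(integral_indic P measurableT (measurable_count B)).
apply: eq_integral => w _; rewrite indicE.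
suff -> : (w \in [set w | B (count w)]) = (count w \in B) by [].
by apply/idP/idP => /set_mem h; rewrite mem_set.
Qed.

Lemma mean_count : mean P (fun w => (count w)%:R) = Ex weight (fun G => (nbase k G)%:R).
Proof. by rewrite /mean unlock integral_count. Qed.

Lemma var_count : var P (fun w => (count w)%:R) =
  Ex weight (fun G => ((nbase k G)%:R - Ex weight (fun G => (nbase k G)%:R)) ^+ 2).
Proof.
rewrite /var /variance unlock -mean_count -/(mean P _) unlock.
rewrite -[RHS]/(fine (_%:E)); congr fine.
rewrite -(integral_count (F := fun m => (m%:R - mean P (fun w => (count w)%:R)) ^+ 2)).
  by rewrite [in LHS]unlock; apply: eq_integral => w _; rewrite /mean unlock expr2.
by move=> m; exact: sqr_ge0.
Qed.

End law_of_component_count.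

(** * Mixtures over a Poisson sample size *)

Section poisson_mixture.
Local Open Scope classical_set_scope.
Context {R : realType} {dO : measure_display} {Omega : measurableType dO}.
Variable P : probability Omega R.

Lemma integral_indep_count (A : set Omega) (Y : Omega -> nat) : measurable A ->
  (forall j, measurable [set w | Y w = j]) ->
  (forall j, P (A `&` [set w | Y w = j]) = (P A * P [set w | Y w = j])%E) ->
  (\int[P]_w (\1_A w * (Y w)%:R)%:E = P A * \int[P]_w (Y w)%:R%:E)%E.
Proof.
move=> mA mY indep.
have YE w : ((Y w)%:R%:E = \sum_(0 <= j <oo) (j%:R * \1_[set w | Y w = j] w)%:E :> \bar R)%E.
  rewrite (@nneseriesD1 _ _ (Y w))//.
  rewrite indicE mem_set// mulr1 eseries0 ?adde0// => j _ jY.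
  by rewrite indicE memNset ?mulr0// => /= h; rewrite h eqxx in jY.
have mind j : measurable_fun setT (fun w => (j%:R * \1_[set w | Y w = j] w : R)).
  by apply: measurable_funM => //; exact: measurable_indic.
have L : (\int[P]_w (Y w)%:R%:E = \sum_(0 <= j <oo) j%:R%:E * P [set w | Y w = j])%E.
  under eq_integral do rewrite YE.
  rewrite integral_nneseries//; last by move=> j; apply/measurable_EFinP.
  apply: eq_eseriesr => j _; under eq_integral do rewrite EFinM.
  rewrite ge0_integralZl//; first by rewrite integral_indic ?setIT.
  by apply/measurable_EFinP; exact: measurable_indic.
have PA : P A = (fine (P A))%:E by rewrite fineK// fin_num_measure.
rewrite L PA -nneseriesZl; last by move=> j _; rewrite mule_ge0// lee_fin.
have AYE w : ((\1_A w * (Y w)%:R)%:E =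
    \sum_(0 <= j <oo) (j%:R * \1_(A `&` [set w | Y w = j]) w)%:E :> \bar R)%E.
  rewrite EFinM YE -nneseriesZl; last by move=> j _; rewrite lee_fin.
  apply: eq_eseriesr => j _; rewrite -EFinM; congr (_%:E).
  by rewrite indicI /=; ring.
under eq_integral do rewrite AYE.
have mAY j : measurable (A `&` [set w | Y w = j]) by exact: measurableI.
rewrite integral_nneseries//; last first.
  move=> j; apply/measurable_EFinP; apply: measurable_funM => //; exact: measurable_indic.
apply: eq_eseriesr => j _; under eq_integral do rewrite EFinM.
rewrite ge0_integralZl//.
  by rewrite -PA muleCA -indep (integral_indic P measurableT (mAY j)) setIT.
by apply/measurable_EFinP; exact: measurable_indic.
Qed.

Lemma integral_mixture (N : Omega -> nat) (Y : nat -> Omega -> nat) :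
  (forall m, measurable [set w | N w = m]) ->
  (forall m j, measurable [set w | Y m w = j]) ->
  (forall m j, P ([set w | N w = m] `&` [set w | Y m w = j]) =
     (P [set w | N w = m] * P [set w | Y m w = j])%E) ->
  (\int[P]_w (Y (N w) w)%:R%:E =
     \sum_(0 <= m <oo) P [set w | N w = m] * \int[P]_w (Y m w)%:R%:E)%E.
Proof.
move=> mN mY indep.
have YE w : ((Y (N w) w)%:R%:E =
    \sum_(0 <= m <oo) (\1_[set w | N w = m] w * (Y m w)%:R)%:E :> \bar R)%E.
  rewrite (@nneseriesD1 _ _ (N w))//.
  rewrite indicE mem_set// mul1r eseries0 ?adde0// => j _ jY.
  by rewrite indicE memNset ?mul0r// => /= h; rewrite h eqxx in jY.
under eq_integral do rewrite YE.
rewrite integral_nneseries//; last first.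
  move=> m; apply/measurable_EFinP; apply: measurable_funM; first exact: measurable_indic.
  move=> _ B mB; rewrite setTI (_ : _ @^-1` _ =
      \bigcup_(j in [set j | B j%:R]) [set w | Y m w = j]).
    exact: bigcup_measurable.
  by apply/seteqP; split => [w Bw|w [j Bj YE']]; [exists (Y m w)|rewrite /preimage /= YE'].
by apply: eq_eseriesr => m _; exact: integral_indep_count.
Qed.

End poisson_mixture.

Section poisson_moments.
Variables (R : realType) (t : R).
Hypothesis t_gt0 : 0 < t.

Lemma poisson_prob1 j : poisson_prob t 0 [set j]%classic = (poisson_pmf t j)%:E.
Proof. by rewrite /poisson_prob t_gt0 esum_set1// lee_fin ltW// poisson_pmf_gt0. Qed.

(** 'C(m, k) pmf(m) = (t^k / k!) pmf(m - k), and the masses sum to 1. *)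
Lemma poisson_binomial_moment k :
  (\sum_(0 <= m <oo) (poisson_pmf t m * 'C(m, k)%:R)%:E = (t ^+ k / k`!%:R)%:E)%E.
Proof.
have ge0 m : (0 <= (poisson_pmf t m * 'C(m, k)%:R)%:E)%E.
  by rewrite lee_fin mulr_ge0// poisson_pmf_ge0.
rewrite (nneseries_split 0 k)// add0n big1_seq ?add0e; last first.
  by move=> m /andP[_]; rewrite mem_index_iota => /andP[_ mk]; rewrite bin_small// mulr0.
rewrite -(@nneseries_addn _ (fun m => (poisson_pmf t m * 'C(m, k)%:R)%:E))//.
have e j : ((poisson_pmf t (j + k) * 'C(j + k, k)%:R)%:E =
    (t ^+ k / k`!%:R)%:E * (poisson_pmf t j)%:E)%E.
  rewrite -EFinM; congr (_%:E); rewrite /poisson_pmf t_gt0.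
  have fk i : i`!%:R != 0 :> R by rewrite pnatr_eq0 -lt0n fact_gt0.
  have := bin_fact (leq_addl j k); rewrite addnK => bf.
  have -> : (j + k)`!%:R = 'C(j + k, k)%:R * k`!%:R * j`!%:R :> R.
    by rewrite -bf !natrM mulrA.
  have c0 : 'C(j + k, k)%:R != 0 :> R by rewrite pnatr_eq0 -lt0n bin_gt0 leq_addl.
  rewrite exprD; field.
  by rewrite !fk c0.
under eq_eseriesr do rewrite e.
rewrite nneseriesZl; last by move=> j _; rewrite lee_fin; exact: poisson_pmf_ge0.
have -> : (\sum_(0 <= j <oo) (poisson_pmf t j)%:E = 1)%E.
  rewrite nneseries_esumT; last by move=> j; rewrite lee_fin; exact: poisson_pmf_ge0.
  have : poisson_prob t 0 setT = 1%E by exact: probability_setT.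
  by rewrite /poisson_prob t_gt0.
by rewrite mule1.
Qed.

End poisson_moments.

Lemma normr_sup_le (R : realType) (A : set R) (e : R) :
  (A !=set0)%classic -> (forall x, A x -> 0 <= x <= e) -> `|sup A| <= e.
Proof.
move=> [x Ax] Ae; have /andP[x0 _] := Ae x Ax.
rewrite ger0_norm; first by apply: ge_sup => [|y /Ae/andP[]//]; exists x.
by apply: le_trans x0 (ub_le_sup _ Ax); exists e => y /Ae/andP[].
Qed.

(** * The bounds for a fixed sample size *)

Section fixed_sample_size.
Local Open Scope classical_set_scope.
Context {R : realType} {d : nat} {dO : measure_display} {Omega : measurableType dO}.
Variable P : probability Omega R.
Variable X : nat -> {RV P >-> Rd R d}.
Variables (f : Rd R d -> R) (M : R).
Hypothesis d_gt0 : (0 < d)%N.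
Hypothesis Xindep : mutually_independent P X.
Hypothesis Xdensity : forall i, has_density P (X i) f.
Hypothesis f_le : forall x, f x <= M.
Hypothesis M_ge0 : 0 <= M.
Variables (k : nat) (r : R).
Hypothesis k_gt0 : (0 < k)%N.
Hypothesis r_gt0 : 0 < r.

Definition conn_prob : R := Ex (graph_weight X r (fun i : 'I_k => i : nat))
  (fun G => (conn (adj G) [set: 'I_k]%SET)%:R).

Let p := conn_prob.
Let rho := M * (2 * r) ^+ d.

Let rho_ge0 : 0 <= rho.
Proof. by rewrite mulr_ge0// exprn_ge0// mulr_ge0// ltW. Qed.

Lemma conn_prob_ge0 : 0 <= conn_prob.
Proof. by apply: Ex_ge0 => // G; exact: graph_weight_ge0. Qed.

Variable n : nat.

Local Notation T := ('I_n * bool)%type.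
Local Notation weight := (graph_weight X r (@doubled_index n)).
Local Notation lam := (Ex weight (fun G => (nbase k G)%:R)).

Let weight_ge0 G : 0 <= weight G. Proof. exact: graph_weight_ge0. Qed.
Let weight_sum : \sum_G weight G = 1. Proof. exact: graph_weight_sum. Qed.

Let Ex_adj_weight (A : {set T}) (F : graph T -> R) a b :
  local_on A F -> (forall G, 0 <= F G) -> a \in A -> b \notin A ->
  Ex weight (fun G => F G * (adj G a b)%:R) <= rho * Ex weight F.
Proof.
apply: (Ex_adj_sample Xindep (@doubled_index_inj n)) => j x.
exact: (prob_close_le Xdensity f_le j x (ltW r_gt0)).
Qed.

Let Ex_conn_weight (A : {set T}) : #|A| = k -> Ex weight (fun G => (conn (adj G) A)%:R) = p.
Proof.
move=> Ak; pose j (i : 'I_k) : T := enum_val (cast_ord (esym Ak) i).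
have j_inj : injective j by move=> a b /enum_val_inj/cast_ord_inj.
have AE : A = (j @: [set: 'I_k])%SET.
  apply/setP => a; apply/idP/imsetP => [aA|[i _ ->]]; last exact: enum_valP.
  exists (cast_ord Ak (enum_rank_in aA a)); first by rewrite inE.
  by rewrite /j cast_ordK enum_rankK_in.
apply: etrans (Ex_exchangeable Xindep (same_law Xdensity) r
  (fun G => (conn (adj G) [set: 'I_k]%SET)%:R) j_inj (@doubled_index_inj n) (@ord_inj k)).
apply: eq_Ex => G; rewrite AE conn_imset//; congr (_%:R); congr nat_of_bool.
by apply: eq_conn => a b _ _; rewrite adj_reindex.
Qed.

Let mean_countE : mean P (fun w => (count X n k r w)%:R) = lam.
Proof. exact: (mean_count d_gt0 Xindep Xdensity f_le). Qed.

(** Available for every n, also where the lower bound is negative: the Poisson mixture sums it over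
    all sample sizes. *)
Lemma mean_count_bounds : 'C(n, k)%:R * p * (1 - n%:R * k%:R * rho) <=
  mean P (fun w => (count X n k r w)%:R) <= 'C(n, k)%:R * p.
Proof.
rewrite mean_countE.
exact: (Ex_nbase_bounds weight_ge0 rho_ge0 Ex_adj_weight Ex_conn_weight).
Qed.

Hypothesis nkrho : n%:R * k%:R * rho <= 2^-1.

Let eps : R := 5 * k%:R * ((k`!.*2)%:R * (n%:R * rho) ^+ k.-1).

Hypothesis eps_le : eps <= 2^-1.
Hypothesis lam_gt0 : 0 < mean P (fun w => (count X n k r w)%:R).

Let lam_gt0' : 0 < lam. Proof. by rewrite -mean_countE. Qed.

Let stein_id (h : nat -> R) (delta : R) : (forall j, `|h j.+1 - h j| <= delta) ->
  `|Ex weight (fun G => (nbase k G)%:R * h (nbase k G)) -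
     lam * Ex weight (fun G => h (nbase k G).+1)| <= eps * delta * lam.
Proof.
move=> h_lip.
have Ex_indep (A B : {set T}) (F H : graph T -> R) : [disjoint A & B]%B -> local_on A F -> local_on B H ->
    Ex weight (fun G => F G * H G) = Ex weight F * Ex weight H.
  by apply: (Ex_indep_sample Xindep); exact: doubled_index_inj.
have Ex_perm (s : {perm T}) (F : graph T -> R) :
    Ex weight (fun G => F (reindex_graph s G)) = Ex weight F.
  by apply: (Ex_exchangeable Xindep (same_law Xdensity) r _ (@perm_inj _ s));
    exact: doubled_index_inj.
have := stein_identity_nbase weight_ge0 weight_sum k_gt0 rho_ge0 Ex_adj_weight Ex_indep
  Ex_perm Ex_conn_weight nkrho h_lip.
by congr (_ <= _ * _); rewrite /eps; ring.
Qed.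

Lemma var_count_approx : `|var P (fun w => (count X n k r w)%:R) -
    mean P (fun w => (count X n k r w)%:R)| <= eps * mean P (fun w => (count X n k r w)%:R).
Proof.
rewrite mean_countE (var_count d_gt0 Xindep Xdensity f_le)//.
exact: (variance_approx (W := @nbase n k) weight_sum stein_id).
Qed.

Lemma d_TV_count : `|d_TV (law P (fun w => (count X n k r w)%:R))
  (poisson_law (mean P (fun w => (count X n k r w)%:R)))| <= eps.
Proof.
apply: normr_sup_le.
  by exists `|fine (law P (fun w => (count X n k r w)%:R) set0) -
    fine (poisson_law (mean P (fun w => (count X n k r w)%:R)) set0)|; exists set0.
move=> _ [E mE <-]; rewrite normr_ge0/= mean_countE /law /poisson_law /pushforward.
pose A := [set j : nat | E j%:R].
rewrite -[_ @^-1` E]/[set w | A (count X n k r w)].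
rewrite (prob_count d_gt0 Xindep Xdensity f_le n r k_gt0)/=.
exact: (total_variation_approx (W := @nbase n k) weight_sum lam_gt0' stein_id).
Qed.

Lemma d_K_count :
  `|d_K (law P (standardize P (fun w => (count X n k r w)%:R))) (@std_normal_law R)| <=
  (6 + 2 * normal_peak 1) * eps +
    (stein_ub R + 18) * (Num.sqrt (mean P (fun w => (count X n k r w)%:R)))^-1.
Proof.
set V := var P (fun w => (count X n k r w)%:R).
apply: normr_sup_le.
  by exists `|fine (law P (standardize P (fun w => (count X n k r w)%:R)) `]-oo, 0]) -
    fine ((@std_normal_law R) `]-oo, 0])|; exists 0.
move=> _ [z _ <-]; rewrite normr_ge0/= mean_countE /law /pushforward.
pose A := [set j : nat | (Num.sqrt V)^-1 * (j%:R - lam) <= z].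
rewrite (_ : _ @^-1` `]-oo, z] = [set w | A (count X n k r w)]); last first.
  by apply/seteqP; split => w; rewrite /preimage /standardize mean_countE /A /= in_itv.
rewrite (prob_count d_gt0 Xindep Xdensity f_le n r k_gt0)/=.
have e1 : (fun G => (nbase k G \in A)%:R) =1
    (fun G : graph T => ((Num.sqrt V)^-1 * ((nbase k G)%:R - lam) <= z)%R%:R : R).
  move=> G; congr (_%:R); congr nat_of_bool.
  by apply/idP/idP => [/set_mem//|h]; rewrite mem_set.
rewrite (eq_Ex _ e1) /V (var_count d_gt0 Xindep Xdensity f_le)//.
exact: (clt_standardized (W := @nbase n k) weight_ge0 weight_sum lam_gt0' eps_le stein_id).
Qed.

End fixed_sample_size.

(** * Poissonized sample size *)

Section poissonized_mean.
Local Open Scope classical_set_scope.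
Context {R : realType} {d : nat} {dO : measure_display} {Omega : measurableType dO}.
Variable P : probability Omega R.
Variable X : nat -> {RV P >-> Rd R d}.
Variables (f : Rd R d -> R) (M : R).
Hypothesis d_gt0 : (0 < d)%N.
Hypothesis Xindep : mutually_independent P X.
Hypothesis Xdensity : forall i, has_density P (X i) f.
Hypothesis f_le : forall x, f x <= M.
Hypothesis M_ge0 : 0 <= M.
Variables (k : nat) (r : R).
Hypothesis k_gt0 : (0 < k)%N.
Hypothesis r_gt0 : 0 < r.
Variables (N : {RV P >-> nat}) (t : R).
Hypothesis t_gt0 : 0 < t.
Hypothesis N_poisson : poisson_distributed P N t.
Hypothesis N_indep : independent_of_family P N X.

Let p := conn_prob X k r.
Let rho := M * (2 * r) ^+ d.
Let s m := mean P (fun w => (count X m k r w)%:R).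

Let rho_ge0 : 0 <= rho.
Proof. by rewrite mulr_ge0// exprn_ge0// mulr_ge0// ltW. Qed.

Let p_ge0 : 0 <= p. Proof. exact: conn_prob_ge0. Qed.

Let s_ge0 m : 0 <= s m.
Proof. by rewrite /s /mean fine_ge0// unlock integral_ge0// => w _; rewrite lee_fin. Qed.

Let s_bounds m := mean_count_bounds d_gt0 Xindep Xdensity f_le M_ge0 k_gt0 r_gt0 m.

Lemma sigma_of_family_count m j : sigma_of_family X [set w | count X m k r w = j].
Proof.
pose O := g_sigma_algebraType (\bigcup_i preimage_set_system setT (X i) measurable).
have mX i : measurable_fun setT (X i : O -> Rd R d).
  move=> _ C mC; rewrite setTI; apply: sub_sigma_algebra.
  by exists i => //; exists C => //; rewrite setTI.
exact: (@measurable_nb_components R d _ O (fun i => X i : O -> Rd R d) m r k [set j] k_gt0 mX).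
Qed.

Lemma integral_poissonized : (\int[P]_w (count X (N w) k r w)%:R%:E =
  \sum_(0 <= m <oo) (poisson_pmf t m * s m)%:E)%E.
Proof.
rewrite (integral_mixture (N := N) (Y := fun m w => count X m k r w)).
- apply: eq_eseriesr => m _; rewrite EFinM; congr (_ * _)%E.
    by rewrite -poisson_prob1// -N_poisson.
  rewrite /s (mean_count d_gt0 Xindep Xdensity f_le)//.
  exact: (integral_count d_gt0 Xindep Xdensity f_le m r k_gt0 (F := fun j => j%:R)).
- by move=> m; rewrite -[[set w | _]]/(N @^-1` [set m]); exact: measurable_funPTI.
- by move=> m j; exact: (measurable_count X m r k_gt0 [set j]).
move=> m j; rewrite -[[set w | N w = m]]/(N @^-1` [set m]); apply: N_indep => //.
exact: sigma_of_family_count.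
Qed.

(** Average the fixed-size bounds over the Poisson size. The correction needs the mean of m 'C(m,
    k), which is (t + k) t^k / k! because m 'C(m, k) = (k+1) 'C(m, k+1) + k 'C(m, k). *)
Lemma poissonized_mean_bounds :
  p * (t ^+ k / k`!%:R) * (1 - k%:R * rho * (t + k%:R)) <=
    mean P (fun w => (count X (N w) k r w)%:R) <= p * (t ^+ k / k`!%:R).
Proof.
rewrite /mean unlock integral_poissonized.
have pi_ge0 m : 0 <= poisson_pmf t m by exact: poisson_pmf_ge0.
have term_ge0 m : (0 <= (poisson_pmf t m * s m)%:E)%E by rewrite lee_fin mulr_ge0.
have kf : k`!%:R != 0 :> R by rewrite pnatr_eq0 -lt0n fact_gt0.
have upper : (\sum_(0 <= m <oo) (poisson_pmf t m * s m)%:E <= (p * (t ^+ k / k`!%:R))%:E)%E.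
  rewrite EFinM -poisson_binomial_moment// -nneseriesZl; last first.
    by move=> m _; rewrite lee_fin mulr_ge0.
  apply: lee_nneseries => // m _; rewrite -EFinM lee_fin.
  have /andP[_ h] := s_bounds m.
  by apply: le_trans (ler_wpM2l (pi_ge0 m) h) _; rewrite mulrA mulrC.
(* Finiteness is needed before [fine] may be compared with the series. *)
have fin : (\sum_(0 <= m <oo) (poisson_pmf t m * s m)%:E)%E \is a fin_num.
  rewrite ge0_fin_numE; first exact: le_lt_trans upper (ltry _).
  exact: nneseries_ge0.
apply/andP; split; last by rewrite -lee_fin fineK.
pose c : R := k%:R * rho * p.
have c_ge0 : 0 <= c by apply: mulr_ge0 => //; exact: mulr_ge0.
(* The correction is moved to the right, so that all series have nonnegative terms and no
   subtraction of extended reals occurs. *)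
have lower : ((p * (t ^+ k / k`!%:R))%:E <=
   \sum_(0 <= m <oo) (poisson_pmf t m * s m)%:E +
     (c * k.+1%:R)%:E * (t ^+ k.+1 / k.+1`!%:R)%:E +
     (c * k%:R)%:E * (t ^+ k / k`!%:R)%:E)%E.
  have q_ge0 l m : (0 <= (poisson_pmf t m * 'C(m, l)%:R)%:E)%E.
    by rewrite lee_fin mulr_ge0.
  have cq_ge0 l m (x : nat) : (0 <= (c * x%:R)%:E * (poisson_pmf t m * 'C(m, l)%:R)%:E)%E.
    by rewrite mule_ge0// lee_fin mulr_ge0.
  rewrite EFinM -!poisson_binomial_moment// -!nneseriesZl => [|m _|m _|m _]; rewrite ?q_ge0//.
  rewrite -!nneseriesD => [|m _ _|m _ _|m _ _|m _ _]; rewrite ?adde_ge0 ?cq_ge0 ?term_ge0//.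
  apply: lee_nneseries => [m _|m _]; first by rewrite mule_ge0// lee_fin.
  rewrite -!EFinM -!EFinD lee_fin.
  have /andP[h _] := s_bounds m.
  have binE : m%:R * 'C(m, k)%:R = k.+1%:R * 'C(m, k.+1)%:R + k%:R * 'C(m, k)%:R :> R.
    rewrite -!natrM -natrD; congr (_%:R).
    rewrite mul_bin_left -mulnDl.
    have [km|mk] := leqP k m; first by rewrite subnK.
    by rewrite bin_small// !muln0.
  have h2 : 'C(m, k)%:R * p <= s m + c * k.+1%:R * 'C(m, k.+1)%:R + c * k%:R * 'C(m, k)%:R.
    rewrite -addrA -!(mulrA c) -mulrDr -binE /c; move: h; rewrite -/p -/rho -/(s m) => h.
    apply: le_trans (_ : 'C(m, k)%:R * p * (1 - m%:R * k%:R * rho) +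
      k%:R * rho * p * (m%:R * 'C(m, k)%:R) <= _); last by rewrite lerD2r.
    by rewrite le_eqVlt; apply/orP; left; apply/eqP; ring.
  have h3 := ler_wpM2l (pi_ge0 m) h2.
  rewrite [leLHS](_ : _ = poisson_pmf t m * ('C(m, k)%:R * p)); last by ring.
  apply: le_trans h3 _; rewrite !mulrDr !(mulrCA (poisson_pmf t m)).
  by rewrite le_eqVlt; apply/orP; left; apply/eqP; ring.
have := lower; rewrite -(fineK fin) -!EFinM -!EFinD lee_fin.
have kS : k.+1`!%:R = k.+1%:R * k`!%:R :> R by rewrite factS natrM.
have k1 : k.+1%:R != 0 :> R by rewrite pnatr_eq0.
have -> : c * k.+1%:R * (t ^+ k.+1 / k.+1`!%:R) = c * t * (t ^+ k / k`!%:R).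
  rewrite kS exprS; field.
  by rewrite kf nat1r.
rewrite /c; move: (t ^+ k / k`!%:R) (fine _) => b I h.
suff -> : p * b * (1 - k%:R * rho * (t + k%:R)) =
    p * b - (k%:R * rho * p * t * b + k%:R * rho * p * k%:R * b) by rewrite lerBlDr addrA.
by ring.
Qed.

End poissonized_mean.

(** * Asymptotics in n and the theorem *)

Lemma binomial_bounds (R : realFieldType) n k : (0 < n)%N -> (k <= n)%N ->
  ((n%:R : R) ^+ k / k`!%:R) * (1 - k%:R / n%:R) ^+ k <= ('C(n, k)%:R : R) <= n%:R ^+ k / k`!%:R.
Proof.
move=> n0 kn.
have kf : 0 < k`!%:R :> R by rewrite ltr0n fact_gt0.
have nR : n%:R != 0 :> R by rewrite pnatr_eq0 -lt0n.
(* Each of the k factors of the falling factorial lies between n - k and n. *)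
have ffactE : 'C(n, k)%:R * k`!%:R = \prod_(i < k) (n - i)%:R :> R.
  by rewrite -natrM bin_ffact ffact_prod natr_prod.
rewrite mulrAC ler_pdivrMr// ler_pdivlMr// ffactE -exprMn mulrBr mulr1 mulrCA divff// mulr1.
have cst (x : R) : x ^+ k = \prod_(i < k) x by rewrite prodr_const card_ord.
rewrite !cst; apply/andP; split; apply: ler_prod => i _.
  by rewrite -natrB// ler0n ler_nat leq_sub2l// ltnW.
by rewrite ler0n ler_nat leq_subr.
Qed.

Local Open Scope classical_set_scope.
Local Open Scope ring_scope.

Theorem mainTheorem11 (R : realType) (d : nat) (d_gt0 : (0 < d)%N)
    (dO : measure_display) (Omega : measurableType dO)
    (P : probability Omega R)
    (X : nat -> {RV P >-> Rd R d}) (f : Rd R d -> R)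
    (Xindep : mutually_independent P X)
    (Xdensity : forall i, has_density P (X i) f)
    (f_bounded : has_ubound (range f))
    (N : nat -> {RV P >-> nat})
    (N_poisson : forall n, (0 < n)%N -> poisson_distributed P (N n) n%:R)
    (N_indep : forall n, (0 < n)%N -> independent_of_family P (N n) X)
    (r : nat -> R) (r_gt0 : forall n, (0 < n)%N -> 0 < r n)
    (k : nat) (k_gt0 : (0 < k)%N)
    (nrd_to0 : n%:R * r n ^+ d @[n --> \oo] --> (0 : R))
    (nnrd_toy : n%:R * (n%:R * r n ^+ d) ^+ (k - 1) @[n --> \oo] --> +oo) :
  let S := S_ X r k in
  let I n := mean P (S'_ X N r k n) in
  let g n := (n%:R * r n ^+ d) ^+ (k - 1) in
  (mean P (S n) / I n @[n --> \oo] --> (1 : R)) /\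
  ((2 <= k)%N ->
   [/\ exists2 e : nat -> R, e =O_\oo g &
         \forall n \near \oo, var P (S n) = mean P (S n) * (1 + e n),
       (fun n => d_TV (law P (S n)) (poisson_law (mean P (S n)))) =O_\oo g &
       (fun n => d_K (law P (standardize P (S n))) std_normal_law) =O_\oo
         (fun n => Num.max (g n) (Num.sqrt (n%:R * g n))^-1)]).
Proof.
move=> S I g.
have [M hM] := f_bounded.
have f_le x : f x <= M by apply: hM; exists x.
have M_ge0 : 0 <= M.
  by have [_ f0 _] := Xdensity 0; apply: le_trans (f_le point); exact: f0.
pose x n : R := n%:R * r n ^+ d.
pose c1 : R := M * 2 ^+ d.
have c1_ge0 : 0 <= c1 by rewrite mulr_ge0// exprn_ge0.
have nrhoE n : n%:R * (M * (2 * r n) ^+ d) = c1 * x n.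
  by rewrite exprMn /c1 /x; ring.
pose a n : R := k%:R * c1 * x n.
have nkrhoE n : n%:R * k%:R * (M * (2 * r n) ^+ d) = a n.
  by rewrite mulrAC nrhoE /a; ring.
have x_ge0 n : 0 <= x n.
  by case: n => [|n]; rewrite /x ?mul0r// mulr_ge0// exprn_ge0// ltW// r_gt0.
have a_ge0 n : 0 <= a n by rewrite mulr_ge0// mulr_ge0.
have a_cvg : a n @[n --> \oo] --> (0 : R).
  by rewrite -[X in _ --> X](mulr0 (k%:R * c1)); apply: cvgM; first exact: cvg_cst.
have [c c_gt0 c_le] := conn_prob_lower_bound Xindep (same_law Xdensity) k_gt0 d_gt0.
pose p n : R := conn_prob X k (r n).
(* Needed for the grid bound: if r_n > 1 with n >= 1, then n r_n^d would be at least 1. *)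
have r_le1 : \forall n \near \oo, r n <= 1.
  near=> n; rewrite leNgt; apply/negP => r1.
  have n0 : (0 < n)%N by near: n; exists 1%N.
  have : x n < 1 by near: n; apply: (cvgr_lt (0 : R)) => //; exact: ltr01.
  apply/negP; rewrite -leNgt /x -[leLHS]mul1r ler_pM//; first by rewrite ler1n.
  by rewrite exprn_ege1// ltW.
have p_lower : \forall n \near \oo, c * (r n ^+ d) ^+ k.-1 <= p n.
  near=> n; apply: c_le; last by near: n.
  by apply: r_gt0; near: n; exists 1%N.
have p_gt0 : \forall n \near \oo, 0 < p n.
  near=> n; have : c * (r n ^+ d) ^+ k.-1 <= p n by near: n.
  apply: lt_le_trans; rewrite mulr_gt0// !exprn_gt0// r_gt0//.
  by near: n; exists 1%N.
have lam_bounds n : (0 < n)%N -> 'C(n, k)%:R * p n * (1 - a n) <= mean P (S n) <=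
    'C(n, k)%:R * p n.
  move=> n0.
  have := mean_count_bounds d_gt0 Xindep Xdensity f_le M_ge0 k_gt0 (r_gt0 n n0) n.
  by rewrite nkrhoE.
pose D n : R := n%:R ^+ k / k`!%:R.
have D_gt0 n : (0 < n)%N -> 0 < D n.
  by move=> n0; rewrite divr_gt0 ?exprn_gt0 ?ltr0n// fact_gt0.
(* With t = n the correction is k rho (n + k) <= (1 + k) n k rho, because n >= 1. *)
have I_bounds n : (0 < n)%N -> p n * D n * (1 - (1 + k%:R) * a n) <= I n <= p n * D n.
  move=> n0; have nR : 0 < n%:R :> R by rewrite ltr0n.
  have /andP[h1 h2] := poissonized_mean_bounds d_gt0 Xindep Xdensity f_le M_ge0 k_gt0
    (r_gt0 n n0) nR (N_poisson n n0) (N_indep n n0).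
  rewrite h2 andbT; apply: le_trans h1; rewrite ler_wpM2l//.
    by rewrite mulr_ge0 ?conn_prob_ge0// ltW// D_gt0.
  rewrite lerD2l lerN2 -nkrhoE -subr_ge0.
  have rho_ge0 : 0 <= M * (2 * r n) ^+ d.
    by rewrite mulr_ge0// exprn_ge0// mulr_ge0// ltW// r_gt0.
  move: (M * _) rho_ge0 => rho rho_ge0.
  rewrite [leRHS](_ : _ = k%:R * rho * (k%:R * (n%:R - 1))); last by ring.
  by rewrite !mulr_ge0// subr_ge0 ler1n.
have kn_cvg : k%:R / n%:R @[n --> \oo] --> (0 : R).
  rewrite -[X in _ --> X](mulr0 (k%:R : R)); apply: cvgM; first exact: cvg_cst.
  apply/(gtr0_cvgV0 (f := fun n : nat => n%:R : R)); last exact: cvgr_idn.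
  by near=> n; rewrite ltr0n; near: n; exists 1%N.
have cvgX (u : nat -> R) (l : R) m : u n @[n --> \oo] --> l -> u n ^+ m @[n --> \oo] --> l ^+ m.
  move=> ul; elim: m => [|m IH]; first by under eq_fun do rewrite expr0; exact: cvg_cst.
  by under eq_fun do rewrite exprS; rewrite exprS; exact: cvgM.
split.
  (* Lower envelope of the ratio: the binomial loss (1 - k/n)^k times the loss 1 - a_n of the
     fixed-size mean. The upper envelope is the inverse loss of the Poissonized mean. *)
  have low_cvg : (1 - k%:R / n%:R) ^+ k * (1 - a n) @[n --> \oo] --> (1 : R).
    have one : (1 - 0) ^+ k * (1 - 0) = 1 :> R by rewrite subr0 expr1n mulr1.
    rewrite -[X in _ --> X]one; apply: cvgM; last exact: (cvgB (cvg_cst _) a_cvg).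
    by apply: cvgX; exact: (cvgB (cvg_cst _) kn_cvg).
  have up_cvg : (1 - (1 + k%:R) * a n)^-1 @[n --> \oo] --> (1 : R).
    rewrite -[X in _ --> X]invr1; apply: cvgV; first exact: oner_neq0.
    rewrite -[X in _ --> X]subr0 -(mulr0 (1 + k%:R : R)); apply: cvgB; first exact: cvg_cst.
    by apply: cvgM => //; exact: cvg_cst.
  apply: (squeeze_cvgr _ low_cvg up_cvg).
  near=> n.
  have n0 : (0 < n)%N by near: n; exists 1%N.
  have kn : (k <= n)%N by near: n; exists k.
  have pn : 0 < p n by near: n.
  have Dn := D_gt0 n n0.
  have an : (1 + k%:R) * a n < 1.
    have : a n < (1 + k%:R)^-1.
      by near: n; apply: (cvgr_lt (0 : R)) => //; rewrite invr_gt0 addr_gt0// ltr0n.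
    by rewrite -(@ltr_pM2l _ (1 + k%:R)) ?divff ?gt_eqF ?addr_gt0 ?ltr0n.
  have a1 : a n <= 1.
    by apply: le_trans (ltW an); rewrite ler_peMl// lerDl.
  have /andP[l1 l2] := lam_bounds n n0; have /andP[i1 i2] := I_bounds n n0.
  have /andP[b1 b2] := binomial_bounds R n0 kn; rewrite -/(D n) in b1 b2.
  have sub_gt0 : 0 < 1 - (1 + k%:R) * a n by rewrite subr_gt0.
  have I_gt0 : 0 < I n by exact: lt_le_trans (mulr_gt0 (mulr_gt0 pn Dn) sub_gt0) i1.
  apply/andP; split.
    rewrite ler_pdivlMr//; apply: le_trans l1.
    apply: le_trans (_ : (1 - k%:R / n%:R) ^+ k * (1 - a n) * (p n * D n) <= _).
      apply: ler_wpM2l => //; apply: mulr_ge0; last by rewrite subr_ge0.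
      by rewrite exprn_ge0// subr_ge0 ler_pdivrMr ?mul1r ?ler_nat// ltr0n.
    rewrite [leLHS](_ : _ = D n * (1 - k%:R / n%:R) ^+ k * (p n * (1 - a n))); last by ring.
    rewrite -[leRHS]mulrA ler_wpM2r//; apply: mulr_ge0; first exact: ltW.
    by rewrite subr_ge0.
  rewrite ler_pdivrMr// mulrC ler_pdivlMr//.
  apply: le_trans i1; rewrite ler_wpM2r ?(ltW sub_gt0)//.
  by apply: le_trans l2 _; rewrite mulrC ler_wpM2l// ltW.
move=> k2.
have gE n : g n = x n ^+ k.-1 by rewrite /g subn1.
have g_ge0 n : 0 <= g n by rewrite gE exprn_ge0.
pose C0 : R := 5 * k%:R * ((k`!.*2)%:R * c1 ^+ k.-1).
have C0_ge0 : 0 <= C0 by rewrite !mulr_ge0// exprn_ge0.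
have epsE n : 5 * k%:R * ((k`!.*2)%:R * (n%:R * (M * (2 * r n) ^+ d)) ^+ k.-1) = C0 * g n.
  by rewrite nrhoE exprMn gE /C0; ring.
have g_cvg : g n @[n --> \oo] --> (0 : R).
  have -> : (0 : R) = 0 ^+ k.-1 by rewrite expr0n; case: (k) k2 => [|[|]].
  under eq_fun do rewrite gE.
  exact: cvgX.
(* The factors are 1 - a_n >= 1/2, (1 - k/n)^k >= 2^-k for n >= 2k, the k! of the binomial
   coefficient, and the connectivity constant c. *)
pose c2 : R := 2^-1 * 2^-1 ^+ k / k`!%:R * c.
have c2_gt0 : 0 < c2.
  by rewrite !mulr_gt0 ?exprn_gt0 ?invr_gt0// ltr0n fact_gt0.
have a_half : \forall n \near \oo, a n <= 2^-1.
  by near=> n; apply/ltW; near: n; apply: (cvgr_lt (0 : R)) => //; rewrite invr_gt0.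
have lam_lower : \forall n \near \oo, c2 * (n%:R * g n) <= mean P (S n).
  near=> n.
  have n0 : (0 < n)%N by near: n; exists 1%N.
  have nR : 0 < n%:R :> R by rewrite ltr0n.
  have kn2 : (2 * k <= n)%N by near: n; exists (2 * k)%N.
  have kn : (k <= n)%N by apply: leq_trans kn2; rewrite leq_pmull.
  have /andP[l1 _] := lam_bounds n n0; apply: le_trans l1.
  have /andP[b1 _] := binomial_bounds R n0 kn; rewrite -/(D n) in b1.
  have a2 : a n <= 2^-1 by near: n.
  have pl : c * (r n ^+ d) ^+ k.-1 <= p n by near: n.
  have rd0 : 0 <= c * (r n ^+ d) ^+ k.-1.
    by rewrite mulr_ge0 ?(ltW c_gt0)// !exprn_ge0// ltW// r_gt0.
  have half : 2^-1 <= 1 - k%:R / n%:R :> R.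
    have : k%:R / n%:R <= 2^-1 :> R.
      rewrite ler_pdivrMr// mulrC ler_pdivlMr// -natrM ler_nat mulnC //.
    lra.
  have b3 : D n * 2^-1 ^+ k <= 'C(n, k)%:R.
    apply: le_trans b1; rewrite ler_wpM2l ?(ltW (D_gt0 n n0))//.
    by apply: lerXn2r => //; rewrite nnegrE ?invr_ge0//; apply: le_trans half; rewrite invr_ge0.
  have -> : c2 * (n%:R * g n) = D n * 2^-1 ^+ k * (c * (r n ^+ d) ^+ k.-1) * 2^-1.
    rewrite /c2 gE /x /D exprMn.
    have -> : n%:R ^+ k = n%:R * n%:R ^+ k.-1 :> R by rewrite -exprS prednK.
    by ring.
  have D2 : 0 <= D n * 2^-1 ^+ k.
    by rewrite mulr_ge0 ?exprn_ge0 ?invr_ge0// ltW// D_gt0.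
  apply: ler_pM => //; first by rewrite mulr_ge0.
    exact: ler_pM.
  lra.
have ng_large : \forall n \near \oo, 0 < n%:R * g n.
  exact: (cvgry_gt nnrd_toy 0).
have good : \forall n \near \oo, [/\ (0 < n)%N, a n <= 2^-1, C0 * g n <= 2^-1 &
    0 < mean P (S n) /\ c2 * (n%:R * g n) <= mean P (S n)].
  near=> n.
  have l1 : c2 * (n%:R * g n) <= mean P (S n) by near: n.
  have l2 : 0 < n%:R * g n by near: n.
  split; [by near: n; exists 1%N|by near: n| |split => //].
    apply: ltW; near: n; apply: (cvgr_lt (0 : R)); last by rewrite invr_gt0.
    by rewrite -[X in _ --> X](mulr0 C0); apply: cvgM => //; exact: cvg_cst.
  by apply: lt_le_trans l1; rewrite mulr_gt0.
split.
- exists (fun n => var P (S n) / mean P (S n) - 1).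
    (* The 1 is added because the witness must be positive and only [C0_ge0] is at hand; the same
       holds for the constants below. *)
    apply/eqO_exP; exists (C0 + 1); first by rewrite ltr_wpDl.
    near=> n; have [n0 an eps_le [l0 _]] : [/\ (0 < n)%N, a n <= 2^-1, C0 * g n <= 2^-1 &
      0 < mean P (S n) /\ c2 * (n%:R * g n) <= mean P (S n)] by near: n.
    rewrite -epsE in eps_le; rewrite -nkrhoE in an.
    have := var_count_approx d_gt0 Xindep Xdensity f_le M_ge0 k_gt0 (r_gt0 n n0) an.
    rewrite epsE => h.
    have -> : var P (S n) / mean P (S n) - 1 = (var P (S n) - mean P (S n)) / mean P (S n).
      by rewrite mulrBl divff// gt_eqF.
    rewrite normrM normfV (gtr0_norm l0) ler_pdivrMr//; apply: le_trans h _.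
    by rewrite ler_wpM2r ?(ltW l0)// (ger0_norm (g_ge0 n)) mulrDl mul1r lerDl.
  near=> n; have [n0 an eps_le [l0 _]] : [/\ (0 < n)%N, a n <= 2^-1, C0 * g n <= 2^-1 &
      0 < mean P (S n) /\ c2 * (n%:R * g n) <= mean P (S n)] by near: n.
  by rewrite addrC subrK mulrC divfK// gt_eqF.
- apply/eqO_exP; exists (C0 + 1); first by rewrite ltr_wpDl.
  near=> n; have [n0 an eps_le [l0 _]] : [/\ (0 < n)%N, a n <= 2^-1, C0 * g n <= 2^-1 &
      0 < mean P (S n) /\ c2 * (n%:R * g n) <= mean P (S n)] by near: n.
  rewrite -nkrhoE in an.
  have := d_TV_count d_gt0 Xindep Xdensity f_le M_ge0 k_gt0 (r_gt0 n n0) an l0.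
  rewrite epsE => h.
  apply: le_trans h _.
  by rewrite (ger0_norm (g_ge0 n)) mulrDl mul1r lerDl.
(* The two terms of [d_K_count], each at most a constant times the maximum; 1 / sqrt(c2) comes from
   E[W] >= c2 n g_n. *)
pose C3 : R := (6 + 2 * normal_peak 1) * C0 + (stein_ub R + 18) / Num.sqrt c2.
have peak0 := @normal_peak1_gt0 R.
have ub0 : 0 <= stein_ub R by rewrite addr_ge0// ltW// gauss_inv_gt0.
have C3_ge0 : 0 <= C3.
  apply: addr_ge0; apply: mulr_ge0; rewrite ?invr_ge0//; apply: addr_ge0 => //.
  by apply: mulr_ge0 => //; exact: ltW.
apply/eqO_exP; exists (C3 + 1); first by rewrite ltr_wpDl.
near=> n; have [n0 an eps_le [l0 l1]] : [/\ (0 < n)%N, a n <= 2^-1, C0 * g n <= 2^-1 &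
    0 < mean P (S n) /\ c2 * (n%:R * g n) <= mean P (S n)] by near: n.
rewrite -nkrhoE in an; rewrite -epsE in eps_le.
have := d_K_count d_gt0 Xindep Xdensity f_le M_ge0 k_gt0 (r_gt0 n n0) an eps_le l0.
rewrite epsE => h.
have ng0 : 0 < n%:R * g n by near: n.
set m := Num.max _ _.
have gm : g n <= m by rewrite le_max lexx.
have sm : (Num.sqrt (n%:R * g n))^-1 <= m by rewrite le_max lexx orbT.
have m0 : 0 <= m by apply: le_trans gm.
rewrite (ger0_norm m0); apply: le_trans h _.
apply: (@le_trans _ _ (C3 * m)); last by rewrite [leRHS]mulrDl mul1r lerDl.
rewrite /C3 [leRHS]mulrDl; apply: lerD.
  rewrite -[leRHS]mulrA; apply: ler_wpM2l; last exact: ler_wpM2l.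
  by apply: addr_ge0 => //; apply: mulr_ge0 => //; exact: ltW.
rewrite -[leRHS]mulrA; apply: ler_wpM2l; first exact: addr_ge0.
apply: (@le_trans _ _ ((Num.sqrt c2)^-1 * (Num.sqrt (n%:R * g n))^-1)); last first.
  by apply: ler_wpM2l => //; rewrite invr_ge0.
rewrite -invfM -(sqrtrM _ (ltW c2_gt0)).
have c2ng : 0 < c2 * (n%:R * g n) by exact: mulr_gt0.
by rewrite lef_pV2 ?posrE ?sqrtr_gt0//; exact: ler_wsqrtr.
Unshelve. all: by end_near. Qed.
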